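(* Let $T>0$, $d\in\mathbb{N}$, $g\in\mathbb{R}^d$, let $f:[0,T]\to\mathbb{R}^d$ be absolutely continuous with $f'\in L^2(0,T;\mathbb{R}^d)$, let $F:\mathbb{R}^d\to\mathbb{R}^d$ be of class $C^3$, and assume that the initial value problem $y'=F(y)+f(t)$, $t\in(0,T]$, $y(0)=g$, has a unique solution $y_*$ in $X=H^1(0,T;\mathbb{R}^d)$. Let $\{X^h\subset X\}$ be a sequence of finite element subspaces spanned by piecewise linear basis functions, with $h$ the maximal element length, such that $\lim_{h\to0}\|v-\Pi_h v\|_X=0$ for all $v\in X$. Assume that $$\sup_{t\in[0,T]}\|\mathrm{D}F(y_*(t))\|_{\mathrm{op}}<\frac{1}{\sqrt{2T^2+T+\widetilde{\mathfrak C}^2+\sqrt{(2T^2+T+\widetilde{\mathfrak C}^2)^2+2T\widetilde{\mathfrak C}^2(1+2T)}}}.$$ Let $r>0$, and let $\overline h>0$ be such that for each $h\in(0,\overline h)$ the problem of minimizing $J$ over $X^h$ has a unique solution $y_*^h$ in the open ball $B(y_*,r)\subset X$. Let $$\mathfrak B=\bigcup_{t\in[0,T]}\{p\in\mathbb{R}^d:\ \|p-y_*(t)\|<\mathfrak C\,r\},$$ and assume that $$\frac{\mathrm{Lip}(F|_{\mathfrak B})\,T}{\sqrt2}<1\qquad\text{and}\qquad \sup_{z\in\mathfrak B}\|\mathrm{D}F(z)\|_{\mathrm{op}}<\frac1{\widetilde{\mathfrak C}}.$$ Then there exists a constant $C>0$ independent of $h$ such that $$\|y_*^h-y_*\|_{L^2(0,T;\mathbb{R}^d)}\le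 C h^2\qquad\text{for all } h\in(0,\overline h).$$
   Context: $\|\cdot\|$ is the Euclidean norm on $\mathbb{R}^d$, $\langle\cdot,\cdot\rangle$ the dot product, $\|\cdot\|_{\mathrm{op}}$ the induced operator norm of $d\times d$ matrices, and $\mathrm{D}F$ the Jacobian matrix of $F$. The space $X=H^1(0,T;\mathbb{R}^d)$ (elements identified with their continuous representatives) carries the inner product $\langle u,v\rangle_X=\int_0^T\langle u'(t),v'(t)\rangle\,dt+\langle u(0),v(0)\rangle$ and the induced norm $\|\cdot\|_X$, which is equivalent to the usual $H^1$ norm. A function $y\in X$ is a (strong) solution of the initial value problem if $y(0)=g$ and $y'=F(y)+f$ a.e. on $(0,T)$. $\mathfrak C$ is the smallest constant with $\max_{t\in[0,T]}\|u(t)\|\le\mathfrak C\|u\|_X$ for all $u\in X$, and $\widetilde{\mathfrak C}$ is the smallest constant with $\|u\|_{L^2(0,T;\mathbb{R}^d)}\le\widetilde{\mathfrak C}\|u\|_X$ for all $u\in X$. The objective function is $J(y)=\tfrac12\|y'-F(y)-f\|^2_{L^2(0,T;\mathbb{R}^d)}+\tfrac12\|y(0)-g\|^2$, $y\in X$. ''Spanned by piecewise linear basis functions'' means: $X^h$ is the space of all continuous functions $[0,T]\to\mathbb{R}^d$ that are affine on each element of a partition $0=t_0<\dots<t_N=T$ with maximal element length $h$. $\Pi_h:X\to X^h$ is the orthogonal projection with respect to $\langle\cdot,\cdot\rangle_X$. $\mathrm{Lip}(F|_{\mathfrak B})$ is the Lipschitz constant of $F$ restricted to $\mathfrak B$.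 $B(y_*,r)$ is the open ball in $X$ for $\|\cdot\|_X$. Statements ''for $h\in(0,\overline h)$'' refer to the members $X^h$ of the sequence with mesh size in $(0,\overline h)$. *)

(* Defs.v *)
From HB Require Import structures.
From mathcomp Require Import all_boot all_order all_algebra.
From mathcomp Require Import all_classical all_reals all_analysis.

Set Implicit Arguments.
Unset Strict Implicit.
Unset Printing Implicit Defensive.

Import Order.TTheory GRing.Theory Num.Theory.
Import numFieldNormedType.Exports.

Local Open Scope classical_set_scope.
Local Open Scope ring_scope.

Section Euclidean.
Context {R : realType} {d : nat}.
Implicit Types (u v : 'rV[R]_d) (A : 'M[R]_d) (F : 'rV[R]_d -> 'rV[R]_d).

Definition dot u v : R := \sum_i u 0 i * v 0 i.

(* The library norm `|v| on 'rV[R]_d is the sup norm, hence this definition. *)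
Definition enorm v : R := Num.sqrt (dot v v).

(* Matrices act on row vectors from the right: for F differentiable at p,
   v *m 'J F p = 'd F p v. *)
Definition opnorm A : R := sup [set enorm (v *m A) | v in [set v | enorm v <= 1]].

Fixpoint class_C (k : nat) F : Prop :=
  if k is k'.+1 then
    (forall x, differentiable F x) /\ forall v, class_C k' (fun x => 'D_v F x)
  else continuous F.

(* +oo if F is not Lipschitz on B *)
Definition Lip F (B : set 'rV[R]_d) : \bar R :=
  ereal_inf [set L%:E | L in [set L | 0 <= L /\
    forall x y, B x -> B y -> enorm (F x - F y) <= L * enorm (x - y)]].

End Euclidean.

(* Functions on the interval from 0 to T are represented by functions on R,
   only the values on [0, T] being relevant. *)
Section Sobolev.
Context {R : realType} {d : nat}.
Variable T : R.
Notation mu := (@lebesgue_measure R).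
Implicit Types (u v w f : R -> 'rV[R]_d).

Definition abs_continuous f : Prop :=
  forall e : R, 0 < e -> exists2 del : R, 0 < del &
    forall (n : nat) (a b : 'I_n -> R),
      (forall k, 0 <= a k /\ a k <= b k /\ b k <= T) ->
      (forall j k, j != k -> `]a j, b j[ `&` `]a k, b k[ = set0) ->
      \sum_k (b k - a k) < del ->
      \sum_k enorm (f (b k) - f (a k)) < e.

Definition in_L2 u : Prop := forall i,
  measurable_fun `]0, T[ (fun t => u t 0 i) /\
  (\int[mu]_(t in `]0%R, T[) ((u t 0 i) ^+ 2)%:E < +oo)%E.

(* meaningful for u satisfying in_L2 *)
Definition L2norm u : R :=
  Num.sqrt (\int[mu]_(t in `]0, T[) (enorm (u t) ^+ 2)).

(* C^1 functions with compact support in the open interval; this is the class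
   of test functions used for W^{1,p}(I) in Brezis, Functional Analysis,
   Sobolev Spaces and Partial Differential Equations, Section 8.2. *)
Definition test_function (phi : R -> R) : Prop :=
  (forall x, derivable phi x 1) /\ continuous (derive1 phi) /\
  exists a b : R, 0 < a /\ b < T /\ forall x, x \notin `[a, b] -> phi x = 0.

Definition weak_derivative u v : Prop :=
  forall phi, test_function phi -> forall i,
    \int[mu]_(t in `]0, T[) (u t 0 i * derive1 phi t) =
    - \int[mu]_(t in `]0, T[) (v t 0 i * phi t).

(* continuous representatives of the elements of H^1 *)
Definition H1 : set (R -> 'rV[R]_d) := [set u |
  {within `[0, T], continuous u} /\ in_L2 u /\
  exists v, in_L2 v /\ weak_derivative u v].

(* a representative of the weak derivative, which is unique a.e. *)
Definition wderiv u : R -> 'rV[R]_d :=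
  get [set v | in_L2 v /\ weak_derivative u v].

Definition Xdot u v : R :=
  \int[mu]_(t in `]0, T[) dot (wderiv u t) (wderiv v t) + dot (u 0) (v 0).

Definition Xnorm u : R := Num.sqrt (Xdot u u).

Definition Xball y (r : R) : set (R -> 'rV[R]_d) :=
  [set u | H1 u /\ Xnorm (u \- y) < r].

Definition Xproj (V : set (R -> 'rV[R]_d)) v : R -> 'rV[R]_d :=
  get [set w | V w /\ forall z, V z -> Xdot (v \- w) z = 0].

Definition ivp_solution (F : 'rV[R]_d -> 'rV[R]_d) f (g : 'rV[R]_d) u : Prop :=
  H1 u /\ u 0 = g /\
  {ae mu, forall t, t \in `]0, T[ -> wderiv u t = F (u t) + f t}.

Definition J (F : 'rV[R]_d -> 'rV[R]_d) f (g : 'rV[R]_d) u : R :=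
  2^-1 * L2norm (fun t => wderiv u t - F (u t) - f t) ^+ 2 +
  2^-1 * enorm (u 0 - g) ^+ 2.

(* In the next three definitions s = [:: t_1; ...; t_N] lists the nodes of
   0 = t_0 < t_1 < ... < t_N = T, that is, itv_partition 0 T s. *)
Definition node (s : seq R) (k : nat) : R := nth 0 (0 :: s) k.

Definition mesh (s : seq R) : R :=
  \big[Num.max/0]_(k < size s) (node s k.+1 - node s k).

Definition P1space (s : seq R) : set (R -> 'rV[R]_d) := [set u |
  {within `[0, T], continuous u} /\
  forall k, (k < size s)%N -> exists a b : 'rV[R]_d,
    forall t, t \in `[node s k, node s k.+1] -> u t = a + t *: b].

Definition minimizer (E : (R -> 'rV[R]_d) -> R) (V : set (R -> 'rV[R]_d)) u :=
  V u /\ forall z, V z -> E u <= E z.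

End Sobolev.

Definition Csup {R : realType} (d : nat) (T : R) : R :=
  inf [set C | 0 <= C /\ forall u : R -> 'rV[R]_d, H1 T u ->
    forall t, t \in `[0, T] -> enorm (u t) <= C * Xnorm T u].

Definition CL2 {R : realType} (d : nat) (T : R) : R :=
  inf [set C | 0 <= C /\ forall u : R -> 'rV[R]_d, H1 T u ->
    L2norm T u <= C * Xnorm T u].

(* Main.v *)
(** Aubin-Nitsche duality. The solution y = ystar is C^1 and y' has a derivative in L^2, so
    comparing J(y^h) with J at the interpolant of y shows that the residual
    y^h' - F(y^h) - f and the initial error are O(h). As Lip(F) T / sqrt 2 < 1,
    the Poincare inequality then gives e' = O(h) in L^2 and e = O(h) uniformly
    for e = y^h - y. With M = DF(y), the Euler-Lagrange equation of y^h
    linearizes to <e' - e M, v' - v M> + <e(0), v(0)> = O(h^2) (|v'| + |v|) for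
    v in X^h. If p' = - p M^T - e, p(T) = 0 and w' = w M + p, w(0) = p(0), then
    |e|^2 = <e' - e M, w' - w M> + <e(0), w(0)>, and replacing w by its
    interpolant yields |e| = O(h^2). The first smallness condition implies
    T |M| <= 1/2, so p and w are obtained, up to an arbitrarily small error, by
    finitely many Picard iterations. *)
Require Import Defs.
From HB Require Import structures.
From mathcomp Require Import all_boot all_order all_algebra.
From mathcomp Require Import all_classical all_reals all_analysis.
From mathcomp Require Import measurable_realfun.
From mathcomp Require Import ring lra.
Set Implicit Arguments.
Unset Strict Implicit.
Unset Printing Implicit Defensive.
Import Order.TTheory GRing.Theory Num.Theory.
Import numFieldNormedType.Exports.
Local Open Scope classical_set_scope.
Local Open Scope ring_scope.

(** * Integrals on intervals *)

(** Elements of H^1 are functions on the line with arbitrary values off [0, T], and their derivative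
    is a chosen representative. Precomposing with the retraction [clamp] restores continuity on the
    line, and derivatives are compared almost everywhere. The weak derivative is tied to increments
    by integration by parts with boundary terms on subintervals, obtained from C^1 cutoffs. For f,
    absolutely continuous in the epsilon-delta sense, the inequality |f(b) - f(a)| <= int |f'|
    suffices and is proved directly. In the duality argument all bounds on p and w must be
    proportional to n = |e| in L^2, so that n^2 <= Q n can be divided by n; hence the majorant for
    the increments of w' keeps |e(t)| as a function of t. Dual functions solving their equations up
    to eps cost a multiple of eps, which vanishes at the end, so no limit of iterates is taken.
    Uniformity in h comes from fixing, before the partition, one cube containing the values of y, of
    all y^h and of all interpolants, with one constant for the Lipschitz bounds of F and DF and the
    Taylor remainder there. *)

Section IntervalIntegral.
Context {R : realType}.
Notation mu := (@lebesgue_measure R).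
Implicit Types (a b c : R) (f g : R -> R).

(** The integral is unsigned: it is 0 when b <= a, hence the ordering conditions on the bounds
    below. *)
Definition rint a b f : R := \int[mu]_(x in `]a, b[) f x.

Definition L1 a b f : Prop := mu.-integrable `]a, b[ (EFin \o f).

Definition L2 a b f : Prop :=
  measurable_fun `]a, b[ f /\ L1 a b (fun x => f x ^+ 2).

Lemma oo_measure_fin a b : (mu `]a, b[ < +oo)%E.
Proof. by rewrite lebesgue_measure_itv/=; case: ifPn => // _; rewrite -EFinB ltry. Qed.

Lemma L1_measurable a b f : L1 a b f -> measurable_fun `]a, b[ f.
Proof. by move=> /(measurable_int mu) /measurable_EFinP. Qed.

Lemma L1D a b f g : L1 a b f -> L1 a b g -> L1 a b (fun x => f x + g x).
Proof.
move=> hf hg; apply: (eq_integrable _ _ _ _ (integrableD _ hf hg)) => //.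
Qed.

Lemma L1B a b f g : L1 a b f -> L1 a b g -> L1 a b (fun x => f x - g x).
Proof.
move=> hf hg; apply: (eq_integrable _ _ _ _ (integrableB _ hf hg)) => //.
Qed.

Lemma L1Z a b k f : L1 a b f -> L1 a b (fun x => k * f x).
Proof.
move=> hf; apply: (eq_integrable _ _ _ _ (integrableZl _ k hf)) => //.
Qed.

Lemma L1_norm a b f : L1 a b f -> L1 a b (fun x => `|f x|).
Proof. exact: integrable_norm. Qed.

Lemma L1_le a b f g : measurable_fun `]a, b[ f ->
  {in `]a, b[, forall x, `|f x| <= g x} -> L1 a b g -> L1 a b f.
Proof.
move=> mf fg hg; apply: (le_integrable _ _ _ hg) => //.
  exact/measurable_EFinP.
by move=> x xab /=; rewrite lee_fin (le_trans (fg _ xab))// ler_norm.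
Qed.

Lemma eq_L1 a b f g : {in `]a, b[, f =1 g} -> L1 a b f -> L1 a b g.
Proof.
move=> fg; apply: eq_integrable => // x; rewrite inE/= => xab.
by rewrite fg.
Qed.

Lemma L1S a b a' b' f : a <= a' -> b' <= b -> L1 a b f -> L1 a' b' f.
Proof.
move=> aa bb; apply: integrableS => //.
by apply: subset_itv; rewrite bnd_simp.
Qed.

Lemma L1_cst a b k : L1 a b (fun=> k).
Proof.
apply: measurable_bounded_integrable => //; first exact: oo_measure_fin.
exact: bounded_cst.
Qed.

Lemma within_cont_L1 a b f : {within `[a, b], continuous f} -> L1 a b f.
Proof.
move=> cf; have := continuous_compact_integrable (@segment_compact _ a b) cf.
by apply: integrableS => //; exact: subset_itv_oo_cc.
Qed.

Lemma cont_within a b f : continuous f -> {within `[a, b], continuous f}.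
Proof. by move=> cf; exact: continuous_subspaceT. Qed.

Lemma cont_L1 a b f : continuous f -> L1 a b f.
Proof. by move=> cf; exact/within_cont_L1/cont_within. Qed.

Lemma cont_measurable a b f : continuous f -> measurable_fun `]a, b[ f.
Proof. by move=> cf; apply: L1_measurable; exact: cont_L1. Qed.

Lemma eq_rint a b f g : {in `]a, b[, f =1 g} -> rint a b f = rint a b g.
Proof. by move=> fg; apply: eq_Rintegral => x; rewrite inE; exact: fg. Qed.

Lemma rintD a b f g : L1 a b f -> L1 a b g ->
  rint a b (fun x => f x + g x) = rint a b f + rint a b g.
Proof. by move=> hf hg; apply: RintegralD. Qed.

Lemma rintB a b f g : L1 a b f -> L1 a b g ->
  rint a b (fun x => f x - g x) = rint a b f - rint a b g.
Proof. by move=> hf hg; apply: RintegralB. Qed.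

Lemma rintZ a b k f : L1 a b f -> rint a b (fun x => k * f x) = k * rint a b f.
Proof. by move=> hf; apply: RintegralZl. Qed.

Lemma rint_le a b f g : L1 a b f -> L1 a b g ->
  {in `]a, b[, forall x, f x <= g x} -> rint a b f <= rint a b g.
Proof. by move=> hf hg fg; apply: le_Rintegral. Qed.

Lemma rint_ge0 a b f : {in `]a, b[, forall x, 0 <= f x} -> 0 <= rint a b f.
Proof. by move=> f0; apply: Rintegral_ge0. Qed.

Lemma rint_norm a b f : L1 a b f -> `|rint a b f| <= rint a b (fun x => `|f x|).
Proof. by move=> hf; apply: le_normr_Rintegral. Qed.

Lemma rint_cst a b k : a <= b -> rint a b (fun=> k) = k * (b - a).
Proof.
move=> ab; rewrite /rint Rintegral_cst//; congr (_ * _).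
rewrite -[LHS]/(fine (mu `]a, b[)) lebesgue_measure_itv/= lte_fin; case: ltP => [_|ba]; first by rewrite -EFinB.
by rewrite /= (@le_anti _ _ b a) ?ba ?ab// subrr.
Qed.

Lemma rint_nil a b f : b <= a -> rint a b f = 0.
Proof. by move=> ba; rewrite /rint set_itv_ge ?Rintegral_set0// bnd_simp -leNgt. Qed.

Lemma L1_cc a b f : L1 a b f -> mu.-integrable `[a, b] (EFin \o f).
Proof.
move=> hf; apply/integrableP; split.
  apply/measurable_EFinP; apply: (@measurable_fun_itv_cc _ _ _ false true).
  exact: L1_measurable.
rewrite integral_itv_bndoo; first by case/integrableP : hf.
by apply: measurableT_comp => //; exact: measurable_int hf.
Qed.

Lemma rint_cc a b f : measurable_fun `]a, b[ f ->
  rint a b f = \int[mu]_(x in `[a, b]) f x.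
Proof.
move=> mf; rewrite /rint /Rintegral [in RHS]integral_itv_bndoo//.
by move/measurable_EFinP : mf.
Qed.

Lemma rint_cat a b c f : a <= b -> b <= c -> L1 a c f ->
  rint a c f = rint a b f + rint b c f.
Proof.
move=> ab bc hf.
have hab : L1 a b f by apply: L1S hf.
have hbc : L1 b c f by apply: L1S hf.
rewrite !rint_cc; try exact: L1_measurable.
rewrite -(@Rintegral_itv_obnd_cbnd _ b); last first.
  apply: integrableS (L1_cc hbc) => //.
  by apply: subset_itvr; rewrite bnd_simp.
have := @Rintegral_itvB _ f (BLeft a) (BRight c) b (L1_cc hf).
by rewrite !bnd_simp ab bc => /(_ isT isT) <-; rewrite addrC subrK.
Qed.

Lemma rint_mono a b a' b' f : a <= a' -> a' <= b' -> b' <= b -> L1 a b f ->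
  {in `]a, b[, forall x, 0 <= f x} -> rint a' b' f <= rint a b f.
Proof.
move=> aa ab bb hf f0.
rewrite (@rint_cat a a' b)//; last by rewrite (le_trans ab).
rewrite (@rint_cat a' b' b)//; last exact: L1S hf.
have h1 : 0 <= rint a a' f.
  apply: rint_ge0 => x xab; apply: f0; move: x xab.
  by apply: subset_itvl; rewrite bnd_simp (le_trans ab).
have h2 : 0 <= rint b' b f.
  apply: rint_ge0 => x xab; apply: f0; move: x xab.
  by apply: subset_itvr; rewrite bnd_simp (le_trans _ ab).
by rewrite addrCA lerDl addr_ge0.
Qed.

Lemma aeS (P Q : R -> Prop) : (forall x, P x -> Q x) ->
  {ae mu, forall x, P x} -> {ae mu, forall x, Q x}.
Proof.
by move=> PQ; apply: filterS; [exact: (ae_filter_ringOfSetsType mu)|exact: PQ].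
Qed.

Lemma aeS2 (P Q S : R -> Prop) : (forall x, P x -> Q x -> S x) ->
  {ae mu, forall x, P x} -> {ae mu, forall x, Q x} -> {ae mu, forall x, S x}.
Proof.
by move=> PQ; apply: filterS2; [exact: (ae_filter_ringOfSetsType mu)|exact: PQ].
Qed.

Lemma ae_eq_rint a b f g : measurable_fun `]a, b[ f -> measurable_fun `]a, b[ g ->
  {ae mu, forall x, x \in `]a, b[ -> f x = g x} -> rint a b f = rint a b g.
Proof.
move=> mf mg fg; rewrite /rint /Rintegral; congr fine.
apply: ae_eq_integral => //; try exact/measurable_EFinP.
by apply: aeS fg => x h xab; rewrite h.
Qed.

Lemma L2_measurable a b f : L2 a b f -> measurable_fun `]a, b[ f.
Proof. by case. Qed.

Lemma L2S a b a' b' f : a <= a' -> b' <= b -> L2 a b f -> L2 a' b' f.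
Proof.
move=> aa bb [mf hf]; split; last exact: L1S hf.
by apply: measurable_funS mf => //; apply: subset_itv; rewrite bnd_simp.
Qed.

Lemma L2_mul a b f g : L2 a b f -> L2 a b g -> L1 a b (fun x => f x * g x).
Proof.
move=> [mf hf] [mg hg].
apply: (@L1_le _ _ _ (fun x => f x ^+ 2 + g x ^+ 2)).
- exact: measurable_funM.
- move=> x _; rewrite normrM -[f x ^+ 2]real_normK ?num_real//.
  rewrite -[g x ^+ 2]real_normK ?num_real//.
  have := sqr_ge0 (`|f x| - `|g x|); have := normr_ge0 (f x); have := normr_ge0 (g x).
  by nra.
- exact: L1D.
Qed.

Lemma L2_L1 a b f : L2 a b f -> L1 a b f.
Proof.
move=> hf; apply: (@eq_L1 _ _ (fun x => f x * 1)); first by move=> x; rewrite mulr1.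
apply: L2_mul => //; split => //; under eq_fun do rewrite expr1n.
exact: L1_cst.
Qed.

Lemma L2_le a b f g : measurable_fun `]a, b[ f ->
  {in `]a, b[, forall x, `|f x| <= g x} -> L2 a b g -> L2 a b f.
Proof.
move=> mf fg [mg hg]; split => //; apply: L1_le hg.
  by apply: measurable_funX.
move=> x xab; rewrite normrX lerXn2r ?nnegrE//; last exact: fg.
by rewrite (le_trans _ (fg _ xab)).
Qed.

Lemma L2D a b f g : L2 a b f -> L2 a b g -> L2 a b (fun x => f x + g x).
Proof.
move=> hf hg; have hfg := L2_mul hf hg.
case: hf hg => mf hf [mg hg]; split; first exact: measurable_funD.
apply: (@eq_L1 _ _ (fun x => (f x ^+ 2 + g x ^+ 2) + 2 * (f x * g x))).
  by move=> x _; ring.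
by apply: L1D; [exact: L1D|exact: L1Z].
Qed.

Lemma L2Z a b k f : L2 a b f -> L2 a b (fun x => k * f x).
Proof.
case=> mf hf; split; first exact: measurable_funM.
apply: (@eq_L1 _ _ (fun x => k ^+ 2 * f x ^+ 2)); last exact: L1Z.
by move=> x _; rewrite exprMn.
Qed.

Lemma L2_cst a b k : L2 a b (fun=> k).
Proof. by split => //; exact: L1_cst. Qed.

Lemma within_cont_L2 a b f : {within `[a, b], continuous f} -> L2 a b f.
Proof.
move=> cf; split; first by apply: L1_measurable; exact: within_cont_L1.
by apply: within_cont_L1 => x; apply: continuousM; exact: cf.
Qed.

Lemma cont_L2 a b f : continuous f -> L2 a b f.
Proof. by move=> cf; exact/within_cont_L2/cont_within. Qed.

(** Common core of the two Cauchy-Schwarz inequalities, for integrals and for [dot]: evaluate the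
    quadratic at its minimum [k = B / C]. If [C = 0], a nonzero [B] would allow the value -1. *)
Lemma discriminant_le (A B C : R) : 0 <= C ->
  (forall k, 0 <= A - 2 * k * B + k ^+ 2 * C) -> B ^+ 2 <= A * C.
Proof.
move=> C0 key.
have [C00|Cn0] := eqVneq C 0.
  rewrite C00 mulr0; suff -> : B = 0 by rewrite expr0n.
  apply/eqP; apply: contraT => B0.
  have := key ((A + 1) / (2 * B)); rewrite C00 mulr0 addr0.
  have -> : 2 * ((A + 1) / (2 * B)) * B = A + 1 by field.
  by rewrite opprD addNKr oppr_ge0 ler10.
have Cp : 0 < C by rewrite lt_def Cn0.
have := key (B / C).
have -> : A - 2 * (B / C) * B + (B / C) ^+ 2 * C = (A * C - B ^+ 2) / C by field.
by rewrite pmulr_lge0 ?invr_gt0// subr_ge0.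
Qed.

Lemma cauchy_schwarz_rint a b f g : L2 a b f -> L2 a b g ->
  rint a b (fun x => f x * g x) ^+ 2 <=
  rint a b (fun x => f x ^+ 2) * rint a b (fun x => g x ^+ 2).
Proof.
move=> hf hg; have hfg := L2_mul hf hg.
set A := rint a b (fun x => f x ^+ 2).
set B := rint a b (fun x => f x * g x).
set C := rint a b (fun x => g x ^+ 2).
have C0 : 0 <= C by apply: rint_ge0 => x _; exact: sqr_ge0.
have key k : 0 <= A - 2 * k * B + k ^+ 2 * C.
  have : 0 <= rint a b (fun x => (f x - k * g x) ^+ 2).
    by apply: rint_ge0 => x _; exact: sqr_ge0.
  rewrite (@eq_rint _ _ _ (fun x => (f x ^+ 2 - (2 * k) * (f x * g x)) +
    k ^+ 2 * g x ^+ 2)); last by move=> x _; ring.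
  case: hf => mf hf; case: hg => mg hg.
  rewrite rintD; [|by apply: L1B => //; exact: L1Z|exact: L1Z].
  by rewrite rintB ?rintZ//; exact: L1Z.
exact: discriminant_le.
Qed.

Lemma rint_sqr_le a b f : a <= b -> L2 a b f ->
  rint a b f ^+ 2 <= (b - a) * rint a b (fun x => f x ^+ 2).
Proof.
move=> ab hf; have := cauchy_schwarz_rint (L2_cst a b 1) hf.
rewrite (@eq_rint _ _ (fun x => 1 ^+ 2) (fun=> 1)); last by move=> x _; rewrite expr1n.
rewrite rint_cst// mul1r; congr (_ ^+ 2 <= _).
by apply: eq_rint => x _; rewrite mul1r.
Qed.

Lemma L1_sum a b n (F : 'I_n -> R -> R) : (forall i, L1 a b (F i)) ->
  L1 a b (fun t => \sum_i F i t).
Proof.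
elim: n F => [|n IH] F HF.
  by under eq_fun do rewrite big_ord0; exact: L1_cst.
by under eq_fun do rewrite big_ord_recr; apply: L1D; [exact: IH|exact: HF].
Qed.

Lemma rint_sum a b n (F : 'I_n -> R -> R) : (forall i, L1 a b (F i)) ->
  rint a b (fun t => \sum_i F i t) = \sum_i rint a b (F i).
Proof.
elim: n F => [|n IH] F HF.
  rewrite big_ord0; transitivity (rint a b (fun x : R => 0 * 0 : R)).
    by apply: eq_rint => x _; rewrite big_ord0 mul0r.
  by rewrite rintZ ?mul0r//; exact: L1_cst.
rewrite big_ord_recr/= -IH// -rintD//; last exact: L1_sum.
by apply: eq_rint => x _; rewrite big_ord_recr.
Qed.

End IntervalIntegral.

(** * Derivatives, primitives and Lebesgue differentiation *)

Section Calculus.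
Context {R : realType}.
Notation mu := (@lebesgue_measure R).
Implicit Types (a b c x y : R) (f g : R -> R).

(** Without a quotient the case y = x needs no exception, and increments on either side of x are
    treated alike, as the real induction for absolutely continuous functions requires. *)
Lemma is_derive_epsP f x l : is_derive x 1 f l <->
  forall e : R, 0 < e -> exists2 del : R, 0 < del &
    forall y, `|y - x| < del -> `|f y - f x - l * (y - x)| <= e * `|y - x|.
Proof.
split=> [[df <-] e e0|H].
  have /cvgrPdist_le/(_ e e0) : h^-1 *: ((f \o shift x) h - f x) @[h --> 0^'] --> 'D_1 f x.
    have -> : (fun h : R => h^-1 *: ((f \o shift x) h - f x)) =
      (fun h => h^-1 *: (f (h *: 1 + x) - f x)).
      by apply/funext => h; rewrite /GRing.scale/= mulr1.
    exact: df.
  move=> -[/= del del0 Hd]; exists del => // y yx.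
  have [->|yNx] := eqVneq y x; first by rewrite !subrr mulr0 subrr normr0 mulr0.
  have yx0 : y - x != 0 by rewrite subr_eq0.
  have := Hd (y - x); rewrite /= sub0r normrN subrK => /(_ yx yx0).
  rewrite distrC -(ler_pM2r (_ : 0 < `|y - x|)) ?normr_gt0// -normrM mulrBl.
  by rewrite /GRing.scale/= mulrAC mulVf// mul1r.
have cv : h^-1 *: (f (h *: 1 + x) - f x) @[h --> 0^'] --> l.
  apply/cvgrPdist_le => e e0; have [del del0 Hd] := H e e0.
  exists del => //= h; rewrite /= sub0r normrN => hd h0.
  have := Hd (h + x); rewrite addrK => /(_ hd).
  rewrite -ler_pdivrMr ?normr_gt0// -normf_div distrC scaler1.
  by rewrite mulrBl mulfK// [_ / h]mulrC.
by apply: DeriveDef; [apply/cvg_ex; exists l|exact/cvg_lim].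
Qed.

Lemma derD f g x a b : is_derive x 1 f a -> is_derive x 1 g b ->
  is_derive x 1 (fun y => f y + g y) (a + b).
Proof. exact: is_deriveD. Qed.

Lemma derB f g x a b : is_derive x 1 f a -> is_derive x 1 g b ->
  is_derive x 1 (fun y => f y - g y) (a - b).
Proof. exact: is_deriveB. Qed.

Lemma derZ f x k a : is_derive x 1 f a -> is_derive x 1 (fun y => k * f y) (k * a).
Proof. exact: is_deriveZ. Qed.

Lemma derM f g x a b : is_derive x 1 f a -> is_derive x 1 g b ->
  is_derive x 1 (fun y => f y * g y) (a * g x + f x * b).
Proof.
move=> hf hg; have := is_deriveM hf hg.
by move/is_derive_eq; apply; rewrite addrC /GRing.scale/= (mulrC (g x)).
Qed.

Lemma der_affine f x k m a : is_derive (k * x + m) 1 f a ->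
  is_derive x 1 (fun y => f (k * y + m)) (k * a).
Proof.
move=> hf; rewrite mulrC.
have hg : is_derive x 1 (fun y => k * y + m) k.
  have := derD (derZ k (is_derive_id x 1)) (is_derive_cst m x 1).
  by rewrite mulr1 addr0.
exact: (@is_derive1_comp _ f (fun y => k * y + m) x _ _ hf hg).
Qed.

Lemma der_cont f x a : is_derive x 1 f a -> {for x, continuous f}.
Proof. by case=> df _; apply: differentiable_continuous; exact/derivable1_diffP. Qed.

Lemma der_derive1 f x a : is_derive x 1 f a -> derive1 f x = a.
Proof. by rewrite derive1E => -[_ ->]. Qed.

(** The signed integral from 0 to [x]: since [rint] vanishes on reversed bounds, at least one of the
    two terms is 0. It is a primitive on the whole line. *)
Definition primitive f x : R := rint 0 x f - rint x 0 f.

Lemma rint_primitive f a b : continuous f -> a <= b ->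
  rint a b f = primitive f b - primitive f a.
Proof.
move=> cf ab; rewrite /primitive.
have := cont_L1 _ _ cf => hf.
have [a0|a0] := leP 0 a.
  rewrite (rint_nil _ (_ : 0 <= b)) ?(le_trans a0)// (rint_nil _ a0) !subr0.
  by rewrite (@rint_cat _ 0 a b)// addrC addKr.
have [b0|b0] := leP 0 b.
  rewrite (rint_nil _ b0) (rint_nil _ (ltW a0)) (@rint_cat _ a 0 b)//; last exact: ltW.
  by rewrite subr0 sub0r opprK addrC.
rewrite (rint_nil _ (ltW a0)) (rint_nil _ (ltW b0)) (@rint_cat _ a b 0)//; last exact: ltW.
by rewrite !sub0r opprK addrC addrK.
Qed.

Lemma is_derive_primitive f x : continuous f -> is_derive x 1 (primitive f) (f x).
Proof.
(* [A] lies to the left of both [x] and 0, so near [x] the integral from [A] and [primitive f]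
   differ by a constant. *)
move=> cf; pose A := Num.min x 0 - 1.
have Ax : A < x by rewrite /A ltrBlDr (@le_lt_trans _ _ x)// ?ge_min ?lexx// ltrDl.
have A0 : A < 0 by rewrite /A ltrBlDr (@le_lt_trans _ _ 0)// ?ge_min ?lexx ?orbT// ltrDl.
have xx1 : x < x + 1 by rewrite ltrDl.
have [dF F'] := @continuous_FTC1_closed _ f A x (x + 1) xx1
  (L1_cc (cont_L1 A (x + 1) cf)) Ax (cf x).
have dF1 : is_derive x 1 (fun y => \int[mu]_(t in `[A, y]) f t) (f x).
  exact: (DeriveDef dF (etrans (esym (derive1E _ _)) F')).
have := derB dF1 (is_derive_cst (rint A 0 f) x 1); rewrite subr0.
apply: near_eq_is_derive; near=> y.
have Ay : A < y by near: y; exact: lt_nbhsr.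
rewrite -rint_cc; last exact: cont_measurable.
rewrite (rint_primitive cf (ltW Ay)) (rint_primitive cf (ltW A0)).
have p0 : primitive f 0 = 0 by rewrite /primitive subrr.
by rewrite /cst p0 sub0r opprK subrK.
Unshelve. all: by end_near. Qed.

Lemma rint_derive f g a b : a <= b -> (forall x, is_derive x 1 f (g x)) ->
  continuous g -> rint a b g = f b - f a.
Proof.
move=> ab df cg; rewrite (rint_primitive cg ab).
have := @is_derive_0_is_cst _ (fun x => f x - primitive g x) a b.
move=> H; have : f a - primitive g a = f b - primitive g b.
  apply: H => x; rewrite -(subrr (g x)).
  by apply: derB => //; exact: is_derive_primitive.
by lra.
Qed.

(** Lebesgue's differentiation theorem for [m] extended by 0 outside [0, T], which is integrable
    over the line. *)
Lemma ae_is_derive_rint T m : L1 0 T m ->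
  {ae mu, forall x, x \in `]0, T[ -> is_derive x 1 (fun y => rint 0 y m) (m x)}.
Proof.
move=> hm; have hm' := L1_cc hm.
have loc := integrable_locally_restrict (measurable_itv `[0, T]) hm'.
have intm y : mu.-integrable [set` Interval (BLeft 0) (BRight y)] (EFin \o (m \_ `[0, T])).
  apply: (@integrableS _ _ _ _ setT) => //.
  rewrite -restrict_EFin.
  by apply/integrable_restrict => //; rewrite setTI.
have := @FTC1 _ (m \_ `[0, T]) (BLeft 0) intm loc.
apply: aeS => x H xT; move: (xT); rewrite in_itv/= => /andP[x0 xT'].
have [dF F'] := H x0.
have mx : (m \_ `[0, T]) x = m x by rewrite patchE mem_set//= in_itv/= !ltW.
move: F'; rewrite mx => F'.
have dF1 := @DeriveDef _ _ _ _ _ _ _ dF (etrans (esym (derive1E _ _)) F').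
apply: near_eq_is_derive dF1; near=> y.
have yT : y < T by near: y; exact: lt_nbhsl.
rewrite /= (rint_cc (_ : measurable_fun `]0, y[ m)).
  apply: eq_Rintegral => z; rewrite inE/= in_itv/= => /andP[z0 zy].
  by rewrite patchE mem_set//= in_itv/= z0 (le_trans zy)// ltW.
by apply: L1_measurable; apply: L1S hm => //; exact: ltW.
Unshelve. all: by end_near. Qed.

Lemma ae_eq0_rint0 T m : L1 0 T m ->
  (forall x, 0 <= x -> x <= T -> rint 0 x m = 0) ->
  {ae mu, forall x, x \in `]0, T[ -> m x = 0}.
Proof.
move=> hm m0; apply: aeS (ae_is_derive_rint hm) => x + xT => /(_ xT) dm.
move: xT; rewrite in_itv/= => /andP[x0 xT].
have : is_derive x 1 (fun=> 0 : R) (m x).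
  apply: near_eq_is_derive dm; near=> y; apply: m0.
    by apply: ltW; near: y; exact: lt_nbhsr.
  by apply: ltW; near: y; exact: lt_nbhsl.
by case=> _ <-; rewrite derive_cst.
Unshelve. all: by end_near. Qed.

End Calculus.

(** * Weak derivatives *)

Section Cutoff.
Context {R : realType}.
Notation mu := (@lebesgue_measure R).
Implicit Types (a b c x y T : R) (f g u v p : R -> R).

(** The remainder is at most (y - x)^2. Combinations of shifts of y |y| are C^1 with explicit
    derivatives; the cutoffs below are of this kind. *)
Lemma is_derive_mul_norm x : is_derive x 1 (fun y : R => y * `|y|) (2 * `|x|).
Proof.
apply/is_derive_epsP => e e0; exists e => // y yx.
apply: (@le_trans _ _ (`|y - x| * `|y - x|)); last first.
  by rewrite ler_wpM2r// ltW.
case: (ger0P x) => x0; case: (ger0P y) => y0; rewrite -normrM ger0_norm -?expr2 ?sqr_ge0//;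
  rewrite ler_norml; have := sqr_ge0 x; have := sqr_ge0 y; have := sqr_ge0 (y - x);
  by move=> *; apply/andP; split; nra.
Qed.

(* tent is the hat function on [-1, 1] and step its odd primitive *)
Definition tent x : R := (`|x + 1| - 2 * `|x| + `|x - 1|) / 2.
Definition step x : R :=
  ((x + 1) * `|x + 1| - 2 * (x * `|x|) + (x - 1) * `|x - 1|) / 4.

Lemma is_derive_step x : is_derive x 1 step (tent x).
Proof.
have h1 := @der_affine _ _ x 1 1 _ (is_derive_mul_norm (1 * x + 1)).
have h2 := @der_affine _ _ x 1 (-1) _ (is_derive_mul_norm (1 * x - 1)).
have h0 := derZ 2 (is_derive_mul_norm x).
have := derZ 4^-1 (derD (derB h1 h0) h2).
set F := (fun y : R => _); set l := 4^-1 * _.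
have -> : F = step by apply/funext => y; rewrite /F /step !mul1r mulrC.
by move/is_derive_eq; apply; rewrite /l /tent !mul1r; field.
Qed.

Lemma tent_ge0 x : 0 <= tent x.
Proof.
by rewrite /tent; case: (ger0P (x + 1)); case: (ger0P x); case: (ger0P (x - 1)); lra.
Qed.

Lemma tent_out x : 1 <= `|x| -> tent x = 0.
Proof.
rewrite /tent; case: (ger0P (x + 1)); case: (ger0P x); case: (ger0P (x - 1)); lra.
Qed.

Lemma continuous_tent : continuous tent.
Proof.
move=> x; apply: cvgMl; apply: cvgD; last first.
  by apply: cvg_norm; apply: cvgB; [exact: cvg_id|exact: cvg_cst].
apply: cvgB; last by apply: cvgMr; exact: cvg_norm.
by apply: cvg_norm; apply: cvgD; [exact: cvg_id|exact: cvg_cst].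
Qed.

Lemma step_le x : x <= -1 -> step x = - 2^-1.
Proof.
move=> h; rewrite /step (ler0_norm (_ : x + 1 <= 0)); last lra.
by rewrite !ltr0_norm; [field|lra|lra].
Qed.

Lemma step_ge x : 1 <= x -> step x = 2^-1.
Proof. by move=> h; rewrite /step !ger0_norm; [field|lra|lra|lra]. Qed.

Lemma step_bound x : `|step x| <= 2^-1.
Proof.
by rewrite ler_norml /step; case: (ger0P (x + 1)); case: (ger0P x);
  case: (ger0P (x - 1)) => ? ? ?; apply/andP; split; nra.
Qed.

(** With N = n + 1 large, it rises from 0 to 1 on [a + 1/N, a + 3/N] and falls back on
    [b - 3/N, b - 1/N]. The shift by 2 keeps the support inside the open interval, as test functions
    require. *)
Definition cutoff a b n x : R :=
  step (n.+1%:R * x + (- n.+1%:R * a - 2)) - step (n.+1%:R * x + (- n.+1%:R * b + 2)).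

Definition dcutoff a b n x : R :=
  n.+1%:R * tent (n.+1%:R * x + (- n.+1%:R * a - 2)) -
  n.+1%:R * tent (n.+1%:R * x + (- n.+1%:R * b + 2)).

Lemma is_derive_cutoff a b n x : is_derive x 1 (cutoff a b n) (dcutoff a b n x).
Proof. by apply: derB; apply: der_affine; exact: is_derive_step. Qed.

Lemma continuous_comp_affine f k m : continuous f -> continuous (fun x => f (k * x + m)).
Proof.
move=> cf x; apply: (@continuous_comp _ _ _ (fun y => k * y + m) f); last exact: cf.
by apply: cvgD; [apply: cvgMr; exact: cvg_id|exact: cvg_cst].
Qed.

Lemma continuous_dcutoff a b n : continuous (dcutoff a b n).
Proof.
by move=> x; apply: cvgB; apply: cvgMr; apply: continuous_comp_affine; exact: continuous_tent.
Qed.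

Lemma continuous_cutoff a b n : continuous (cutoff a b n).
Proof. by move=> x; exact: der_cont (is_derive_cutoff a b n x). Qed.

Lemma cutoff_bound a b n x : `|cutoff a b n x| <= 1.
Proof.
rewrite /cutoff; have := step_bound (n.+1%:R * x + (- n.+1%:R * a - 2)).
have := step_bound (n.+1%:R * x + (- n.+1%:R * b + 2)).
by rewrite !ler_norml => /andP[h1 h2] /andP[h3 h4]; apply/andP; split; lra.
Qed.

(** By 4 <= N (b - a), to the left of a + 1/N and to the right of b - 1/N both steps have reached
    the same constant value, so they cancel. *)
Lemma cutoff_eq0 a b n x : 4 <= n.+1%:R * (b - a) ->
  (n.+1%:R * (x - a) <= 1) \/ (n.+1%:R * (b - x) <= 1) ->
  cutoff a b n x = 0 /\ dcutoff a b n x = 0.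
Proof.
rewrite /cutoff /dcutoff; set N := n.+1%:R => Nab [h|h].
  rewrite !step_le; [|lra|lra]; rewrite !tent_out; first by split; ring.
    by rewrite ler0_norm; lra.
  by rewrite ler0_norm; lra.
rewrite !step_ge; [|lra|lra]; rewrite !tent_out; first by split; ring.
  by rewrite ger0_norm; lra.
by rewrite ger0_norm; lra.
Qed.

Lemma cutoff_eq1 a b n x : 3 <= n.+1%:R * (x - a) -> 3 <= n.+1%:R * (b - x) ->
  cutoff a b n x = 1.
Proof.
by move=> h1 h2; rewrite /cutoff step_ge ?step_le; lra.
Qed.

Lemma near_ge_natmul k c : 0 < k -> \forall n \near \oo, c <= n.+1%:R * k.
Proof.
move=> k0; exists (Num.truncn (`|c| / k)).+1 => // n /= hn.
rewrite (le_trans (ler_norm _))// -ler_pdivrMr//.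
rewrite (le_trans (ltW (truncnS_gt _)))// ler_nat.
exact: (leq_trans hn).
Qed.

Lemma cutoff_cvg a b f : a < b -> L1 a b f ->
  rint a b (fun x => f x * cutoff a b n x) @[n --> \oo] --> rint a b f.
Proof.
move=> ab hf.
have mf := L1_measurable hf.
have mc n : measurable_fun `]a, b[ (cutoff a b n).
  by apply: cont_measurable; exact: continuous_cutoff.
have H1 : {ae mu, forall x, `]a, b[%classic x ->
    (f x * cutoff a b n x)%:E @[n --> \oo] --> (f x)%:E}.
  apply: aeW => x /=; rewrite in_itv/= => /andP[ax xb].
  apply: cvg_EFin; first by near=> n.
  have h1 := near_ge_natmul 3 (_ : 0 < x - a); have h2 := near_ge_natmul 3 (_ : 0 < b - x).
  apply: cvg_near_cst; near=> n => /=; rewrite cutoff_eq1 ?mulr1//.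
    by near: n; apply: h1; rewrite subr_gt0.
  by near: n; apply: h2; rewrite subr_gt0.
have H2 : {ae mu, forall x n, `]a, b[%classic x ->
    (`|(f x * cutoff a b n x)%:E| <= (`|f x|)%:E)%E}.
  apply: aeW => x n _; rewrite abse_EFin lee_fin normrM.
  by rewrite ler_piMr// cutoff_bound.
have [_ _ H] := @dominated_convergence _ _ _ mu `]a, b[%classic (measurable_itv _)
  (fun n x => (f x * cutoff a b n x)%:E) (EFin \o f) (fun x => `|f x|%:E)
  (fun n => (measurable_EFinP _ _).2 (measurable_funM mf (mc n)))
  ((measurable_EFinP _ _).2 mf) H1 (L1_norm hf) H2.
have ff : (\int[mu]_(x in `]a, b[) (EFin \o f) x)%E \is a fin_num.
  exact: integrable_fin_num hf.
by move: H; rewrite -(fineK ff); exact: fine_cvg.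
Unshelve. all: by end_near. Qed.

(** The derivative of the cutoff is a difference of two bumps of mass 1 concentrating at the
    endpoints; this limit produces the boundary terms of integration by parts. *)
Lemma dcutoff_cvg a b f : a < b -> continuous f ->
  rint a b (fun x => f x * dcutoff a b n x) @[n --> \oo] --> f a - f b.
Proof.
move=> ab cf; apply/cvgrPdist_le => e e0.
have ba0 : 0 < b - a by rewrite subr_gt0.
have e20 : 0 < e / 2 by rewrite divr_gt0.
have near_pt c : exists2 del : R, 0 < del & forall x, `|c - x| < del -> `|f c - f x| <= e / 2.
  by have /cvgrPdist_le/(_ _ e20)[del /= del0 H] := cf c; exists del.
have [d1 d10 H1] := near_pt a; have [d2 d20 H2] := near_pt b.
near=> n.
have Nab : 4 <= n.+1%:R * (b - a) by near: n; exact: near_ge_natmul.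
have Nd1 : 4 <= n.+1%:R * d1 by near: n; exact: near_ge_natmul.
have Nd2 : 4 <= n.+1%:R * d2 by near: n; exact: near_ge_natmul.
set N : R := n.+1%:R in Nab Nd1 Nd2 *.
have N0 : 0 < N by rewrite ltr0n.
pose la x := N * tent (N * x + (- N * a - 2)).
pose lb x := N * tent (N * x + (- N * b + 2)).
have cla : continuous la.
  by move=> x; apply: cvgMr; apply: continuous_comp_affine; exact: continuous_tent.
have clb : continuous lb.
  by move=> x; apply: cvgMr; apply: continuous_comp_affine; exact: continuous_tent.
have la0 x : 0 <= la x by rewrite mulr_ge0 ?tent_ge0// ltW.
have lb0 x : 0 <= lb x by rewrite mulr_ge0 ?tent_ge0// ltW.
have Ila : rint a b la = 1.
  rewrite (rint_derive (ltW ab) (fun x => der_affine (is_derive_step (N * x + (- N * a - 2)))) cla).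
  by rewrite step_ge ?step_le; lra.
have Ilb : rint a b lb = 1.
  rewrite (rint_derive (ltW ab) (fun x => der_affine (is_derive_step (N * x + (- N * b + 2)))) clb).
  by rewrite step_ge ?step_le; lra.
have cM g h : continuous g -> continuous h -> continuous (fun x => g x * h x).
  by move=> cg ch x; apply: cvgM; [exact: cg|exact: ch].
have cB k g : continuous g -> continuous (fun x => k - g x).
  by move=> cg x; apply: cvgB; [exact: cvg_cst|exact: cg].
(* Estimate for one bump [l] at [c]: it has mass 1 and vanishes at distance 4/N or more from [c]. As
   4/N <= del, f stays within e/2 of f(c) on its support. *)
have key (c : R) (l : R -> R) (del : R) : 4 <= N * del -> continuous l -> (forall x, 0 <= l x) -> rint a b l = 1 ->
    (forall x, `|c - x| < del -> `|f c - f x| <= e / 2) ->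
    (forall x, 4 <= N * `|c - x| -> l x = 0) ->
    `|f c - rint a b (fun x => f x * l x)| <= e / 2.
  move=> Ndel cl l0 Il Hc lout.
  have -> : f c - rint a b (fun x => f x * l x) = rint a b (fun x => (f c - f x) * l x).
    rewrite (_ : rint a b (fun x => (f c - f x) * l x) =
      rint a b (fun x => f c * l x - f x * l x)); last first.
      by apply: eq_rint => x _; rewrite mulrBl.
    rewrite rintB; [|by apply: L1Z; exact: cont_L1|by apply: cont_L1; exact: cM].
    by rewrite rintZ ?Il ?mulr1//; exact: cont_L1.
  have c1 : continuous (fun x => (f c - f x) * l x) by apply: cM => //; exact: cB.
  apply: le_trans (rint_norm (cont_L1 _ _ c1)) _.
  have -> : e / 2 = rint a b (fun x => e / 2 * l x).
    by rewrite rintZ ?Il ?mulr1//; exact: cont_L1.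
  apply: rint_le => [||x _].
  - by apply: L1_norm; exact: cont_L1.
  - by apply: L1Z; exact: cont_L1.
  - rewrite normrM (ger0_norm (l0 x)).
    have [xd|xd] := ltP `|c - x| del; first by rewrite ler_wpM2r// Hc.
    by rewrite lout ?mulr0// (le_trans Ndel)// ler_wpM2l// ltW.
have -> : rint a b (fun x => f x * dcutoff a b n x) =
    rint a b (fun x => f x * la x) - rint a b (fun x => f x * lb x).
  rewrite -rintB; [|by apply: cont_L1; exact: cM..].
  by apply: eq_rint => x _; rewrite -mulrBr.
have ha : `|f a - rint a b (fun x => f x * la x)| <= e / 2.
  apply: (key a la d1) => // x h; rewrite /la tent_out ?mulr0//.
  by move: h; clear; case: (ger0P (a - x)) => ? ?; case: (ger0P (N * x + _)) => ?; lra.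
have hb : `|f b - rint a b (fun x => f x * lb x)| <= e / 2.
  apply: (key b lb d2) => // x h; rewrite /lb tent_out ?mulr0//.
  by move: h; clear; case: (ger0P (b - x)) => ? ?; case: (ger0P (N * x + _)) => ?; lra.
rewrite opprB addrACA -opprB opprD opprK -addrA.
apply: le_trans (_ : `|(f a - rint a b (fun x => f x * la x)) -
   (f b - rint a b (fun x => f x * lb x))| <= _).
  by rewrite le_eqVlt; apply/orP; left; apply/eqP; congr (`|_|); ring.
by apply: le_trans (ler_normB _ _) _; rewrite [e]splitr lerD.
Unshelve. all: by end_near. Qed.

Lemma rint_supp T a b f : 0 <= a -> a <= b -> b <= T -> L1 0 T f ->
  (forall x, x <= a -> f x = 0) -> (forall x, b <= x -> f x = 0) ->
  rint 0 T f = rint a b f.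
Proof.
move=> a0 ab bT hf fa fb.
rewrite (rint_cat a0 (le_trans ab bT) hf) (@rint_cat _ a b T)//; last exact: L1S hf.
rewrite (@eq_rint _ 0 a f (fun=> 0)); last first.
  by move=> x; rewrite in_itv/= => /andP[_ xa]; rewrite fa// ltW.
rewrite (@eq_rint _ b T f (fun=> 0)); last first.
  by move=> x; rewrite in_itv/= => /andP[xb _]; rewrite fb// ltW.
by rewrite !rint_cst// !mul0r add0r addr0.
Qed.

(* The boundary terms come from testing with p times a cutoff of [a, b]. *)
Lemma weak_integration_by_parts T u v p dp a b :
  0 <= a -> a <= b -> b <= T -> continuous u -> L1 0 T v ->
  (forall phi, test_function T phi ->
    rint 0 T (fun t => u t * derive1 phi t) = - rint 0 T (fun t => v t * phi t)) ->
  (forall x, is_derive x 1 p (dp x)) -> continuous dp ->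
  rint a b (fun x => u x * dp x) =
  u b * p b - u a * p a - rint a b (fun x => v x * p x).
Proof.
move=> a0; rewrite le_eqVlt => /predU1P[<-|ab] bT cu hv uv dpp cdp.
  by rewrite !rint_nil// !subrr.
have cp : continuous p by move=> x; exact: der_cont (dpp x).
have cM g h : continuous g -> continuous h -> continuous (fun x => g x * h x).
  by move=> cg ch x; apply: cvgM; [exact: cg|exact: ch].
have hvp a' b' : 0 <= a' -> b' <= T -> L1 a' b' (fun x => v x * p x).
  move=> a'0 b'T; apply: (@L1S _ 0 T) => //.
  have H := @integrableMl _ _ _ mu `]0, T[%classic (measurable_itv _) _ p hv (cont_measurable cp).
  have /compact_bounded [M [Mr HM]] := continuous_compact (@cont_within _ 0 T _ cp) (@segment_compact _ 0 T).
  apply: (eq_integrable _ _ _ _ (H _)) => //.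
  exists M; split => // z Mz x /= xT; apply: HM => //.
  by exists x => //; apply: subset_itv_oo_cc.
have c1 := cutoff_cvg ab (cont_L1 a b (cM _ _ cu cdp)).
have c2 := dcutoff_cvg ab (cM _ _ cu cp).
have c3 := cutoff_cvg ab (hvp a b a0 bT).
have ba0 : 0 < b - a by rewrite subr_gt0.
(* The definition of the weak derivative tested with [phi = p * cutoff], the integrals over (0, T)
   being cut down to (a, b). As n grows, the three integrals converge to the terms of the
   formula. *)
have E : \forall n \near \oo,
    rint a b (fun x => u x * dp x * cutoff a b n x) +
    rint a b (fun x => u x * p x * dcutoff a b n x) =
    - rint a b (fun x => v x * p x * cutoff a b n x).
  near=> n.
  have Nab : 4 <= n.+1%:R * (b - a) by near: n; exact: near_ge_natmul.
  set N : R := n.+1%:R in Nab *.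
  have N0 : 0 < N by rewrite ltr0n.
  pose phi x := p x * cutoff a b n x.
  pose dphi x := dp x * cutoff a b n x + p x * dcutoff a b n x.
  have dphiE x : is_derive x 1 phi (dphi x).
    exact: derM (dpp x) (is_derive_cutoff a b n x).
  have d1E : derive1 phi = dphi by apply/funext => x; exact: der_derive1.
  have cc := @continuous_cutoff a b n; have cdc := @continuous_dcutoff a b n.
  have cphi : continuous phi by exact: cM.
  have cdphi : continuous dphi.
    by move=> x; apply: cvgD; apply: cM.
  have outa x : N * (x - a) <= 1 -> cutoff a b n x = 0 /\ dcutoff a b n x = 0.
    by move=> h; apply: cutoff_eq0 => //; left.
  have outb x : N * (b - x) <= 1 -> cutoff a b n x = 0 /\ dcutoff a b n x = 0.
    by move=> h; apply: cutoff_eq0 => //; right.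
  have tphi : test_function T phi.
    split; first by move=> x; case: (dphiE x).
    split; first by rewrite d1E.
    exists (a + N^-1), (b - N^-1); split; first by rewrite ltr_wpDl// invr_gt0.
    split; first by rewrite (lt_le_trans _ bT)// ltrBlDr ltrDl invr_gt0.
    move=> x; rewrite in_itv/= negb_and -!ltNge => /orP[h|h]; rewrite /phi.
      rewrite (outa x _).1 ?mulr0//; rewrite mulrC -ler_pdivlMr// div1r.
      by rewrite lerBlDl ltW.
    rewrite (outb x _).1 ?mulr0//; rewrite mulrC -ler_pdivlMr// div1r.
    by rewrite lerBlDl -lerBlDr ltW.
  have := uv phi tphi; rewrite d1E.
  have la x : x <= a -> N * (x - a) <= 1.
    by move=> xa; rewrite (@le_trans _ _ 0)// pmulr_rle0// subr_le0.
  have lb x : b <= x -> N * (b - x) <= 1.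
    by move=> xa; rewrite (@le_trans _ _ 0)// pmulr_rle0// subr_le0.
  rewrite (@rint_supp T a b)//; last 4 first.
  - exact: ltW.
  - by apply: cont_L1; exact: cM.
  - by move=> x /la/outa[h1 h2]; rewrite /dphi h1 h2 !mulr0 addr0 mulr0.
  - by move=> x /lb/outb[h1 h2]; rewrite /dphi h1 h2 !mulr0 addr0 mulr0.
  have hvpc : L1 0 T (fun x => v x * p x * cutoff a b n x).
    have mvp := hvp 0 T (lexx _) (lexx _).
    apply: L1_le (L1_norm mvp).
      by apply: measurable_funM; [exact: L1_measurable mvp|exact: cont_measurable].
    by move=> x _; rewrite normrM ler_piMr// cutoff_bound.
  rewrite (@rint_supp T a b (fun t => v t * phi t))//; last 4 first.
  - exact: ltW.
  - by apply: eq_L1 hvpc => x _; rewrite /phi mulrA.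
  - by move=> x /la/outa[h1 h2]; rewrite /phi h1 !mulr0.
  - by move=> x /lb/outb[h1 h2]; rewrite /phi h1 !mulr0.
  move=> H; rewrite -rintD; [|by apply: cont_L1; apply: (cM) => //; exact: cM|by apply: cont_L1; apply: (cM) => //; exact: cM].
  transitivity (rint a b (fun t => u t * dphi t)).
    by apply: eq_rint => x _; rewrite /dphi; ring.
  by rewrite H; congr (- _); apply: eq_rint => x _; rewrite /phi mulrA.
have L : - rint a b (fun x => v x * p x * cutoff a b n x) @[n --> \oo] -->
    - rint a b (fun x => v x * p x) by exact: cvgN.
have L' : - rint a b (fun x => v x * p x * cutoff a b n x) @[n --> \oo] -->
    rint a b (fun x => u x * dp x) + (u a * p a - u b * p b).
  apply: cvg_trans (cvgD c1 c2); apply: near_eq_cvg.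
  by near=> n => /=; near: n; exact: E.
have : - rint a b (fun x => v x * p x) =
    rint a b (fun x => u x * dp x) + (u a * p a - u b * p b).
  exact: (norm_cvg_unique L L').
set A := rint a b (fun x => v x * p x); set B := rint a b _; lra.
Unshelve. all: by end_near. Qed.

End Cutoff.

(** * Absolutely continuous functions *)

Section AbsolutelyContinuous.
Context {R : realType}.
Notation mu := (@lebesgue_measure R).
Implicit Types (s t x y z c : R) (phi m : R -> R) (l : seq (R * R)).

(** The supremum of the points where [P] holds is reached and then passed by the local step around
    it, unless it equals [t]. The local step leads from any nearby point left of [c] to any nearby
    point right of [c], which covers both moves. *)
Lemma real_induction s t (P : R -> Prop) : s <= t -> P s ->
  (forall c, s <= c -> c <= t -> exists2 eta : R, 0 < eta &
    forall y z, s <= y -> z <= t -> c - eta < y -> y <= c -> c <= z -> z < c + eta ->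
    P y -> P z) -> P t.
Proof.
move=> st Ps H; pose S := [set x | [/\ s <= x, x <= t & P x]].
have Ss : S s by split.
have hS : has_sup S by split; [exists s|exists t => x []].
set c := sup S.
have sc : s <= c by apply: ub_le_sup => //; case: hS.
have ct : c <= t by apply: ge_sup; [exists s|move=> x []].
have [eta eta0 He] := H c sc ct.
have [y [sy yt Py] yc] := sup_adherent eta0 hS.
have yc' : y <= c by apply: ub_le_sup => //; case: hS.
have : t <= c.
  rewrite leNgt; apply/negP => ct'.
  pose z := Num.min t (c + eta / 2).
  have cz : c < z by rewrite lt_min ct' ltrDl divr_gt0.
  have zt : z <= t by rewrite ge_min lexx.
  have zc : z < c + eta.
    rewrite (@le_lt_trans _ _ (c + eta / 2))// ?ge_min ?lexx ?orbT//.
    by rewrite ltrD2l ltr_pdivrMr// ltr_pMr// ltr1n.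
  have : S z by split => //; [rewrite (le_trans sc)// ltW|exact: (He y z _ _ _ _ (ltW cz))].
  move=> Sz; have : z <= c by apply: ub_le_sup => //; case: hS.
  by rewrite leNgt cz.
move=> tc; have tc' : t = c by apply/le_anti; rewrite tc ct.
by apply: (He y t) => //; rewrite -?tc' ?ltrDl.
Qed.

Definition ac_on T phi : Prop :=
  forall e : R, 0 < e -> exists2 del : R, 0 < del &
    forall (n : nat) (a b : 'I_n -> R),
      (forall k, 0 <= a k /\ a k <= b k /\ b k <= T) ->
      (forall j k, j != k -> `]a j, b j[ `&` `]a k, b k[ = set0) ->
      \sum_k (b k - a k) < del ->
      \sum_k `|phi (b k) - phi (a k)| < e.

(** Ordered lists of intervals replace indexed families because real induction appends intervals at
    the right end; [ac_list] returns to the indexed form. *)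
Let ordered_in x y l := pairwise (fun p q => p.2 <= q.1) l &&
  all (fun p => [&& x <= p.1, p.1 <= p.2 & p.2 <= y]) l.

Let ordered_in_rcons x y z l : x <= y -> y <= z -> ordered_in x y l ->
  ordered_in x z (rcons l (y, z)).
Proof.
move=> xy yz /andP[pl al]; rewrite /ordered_in pairwise_rcons pl andbT all_rcons/= xy yz lexx/=.
apply/andP; split; apply: sub_all al => p /and3P[h1 h2 h3] //=.
by rewrite h1 h2 (le_trans h3).
Qed.

Let ordered_inW x y z l : y <= z -> ordered_in x y l -> ordered_in x z l.
Proof.
move=> yz /andP[pl al]; rewrite /ordered_in pl/=; apply: sub_all al => p /and3P[h1 h2 h3].
by rewrite h1 h2 (le_trans h3).
Qed.

Let ac_list T phi (e del : R) :
  (forall (n : nat) (a b : 'I_n -> R),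
      (forall k, 0 <= a k /\ a k <= b k /\ b k <= T) ->
      (forall j k, j != k -> `]a j, b j[ `&` `]a k, b k[ = set0) ->
      \sum_k (b k - a k) < del ->
      \sum_k `|phi (b k) - phi (a k)| < e) ->
  forall x y l, 0 <= x -> y <= T -> ordered_in x y l ->
  \sum_(p <- l) (p.2 - p.1) < del -> \sum_(p <- l) `|phi p.2 - phi p.1| < e.
Proof.
move=> H x y l x0 yT /andP[pl al].
rewrite !(big_nth (0, 0)) !big_mkord => hl.
apply: (H _ (fun i => (nth (0, 0) l i).1) (fun i => (nth (0, 0) l i).2)) => //.
- move=> k; have /(all_nthP (0, 0))/(_ k (ltn_ord k)) := al => /and3P[h1 h2 h3].
  by rewrite (le_trans x0 h1) h2 (le_trans h3 yT).
- suff W (j k : 'I_(size l)) : (j < k)%N ->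
      `](nth (0, 0) l j).1, (nth (0, 0) l j).2[ `&`
      `](nth (0, 0) l k).1, (nth (0, 0) l k).2[ = set0.
    move=> j k; rewrite neq_ltn => /orP[jk|kj]; first exact: W.
    by rewrite setIC; exact: W.
  move=> jk; have /(pairwiseP (0, 0))/(_ j k (ltn_ord j) (ltn_ord k) jk) h := pl.
  rewrite -subset0 => z [/=]; rewrite !in_itv/= => /andP[_ z1] /andP[z2 _].
  by have := lt_le_trans z1 h; rewrite ltNge (ltW z2).
Qed.

(** Here [a] and [b] are the increments of phi and of its majorant int |m| over a step [u], and [k]
    is the derivative of phi. Each increment is within (e/2)|u| of its linear part, and the two
    linear parts have the same absolute value. *)
Lemma le_increment (a b k u e : R) : `|a - k * u| <= e / 2 * `|u| ->
  `|b - `|k| * u| <= e / 2 * `|u| -> `|a| <= `|b| + e * `|u|.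
Proof.
have := ler_normD (a - k * u) (k * u); have := ler_normD (b - (b - `|k| * u)) (b - `|k| * u).
have := ler_normB b (b - `|k| * u); rewrite subKr !subrK normrM normr_id -normrM.
by move=> *; lra.
Qed.

(* Real induction along the interval: near a point where phi' = m and
   (int |m|)' = |m| the increment is controlled by that of int |m|; the remaining
   points lie in an open set of small measure, where absolute continuity applies. *)
Lemma ac_increment_le T phi m s t : 0 <= s -> s <= t -> t <= T ->
  ac_on T phi -> L1 0 T m ->
  {ae mu, forall x, x \in `]0, T[ -> is_derive x 1 phi (m x)} ->
  `|phi t - phi s| <= rint s t (fun x => `|m x|).
Proof.
move=> s0 st tT acphi hm dphi.
have hm' := L1_norm hm.
pose G x := rint 0 x (fun x => `|m x|).
have Gst x y : 0 <= x -> x <= y -> y <= T -> G y - G x = rint x y (fun x => `|m x|).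
  move=> x0 xy yT; rewrite /G (@rint_cat _ 0 x y)//; last exact: L1S hm'.
  by rewrite addrAC subrr add0r.
have Gmono x y : 0 <= x -> x <= y -> y <= T -> 0 <= G y - G x.
  by move=> x0 xy yT; rewrite Gst//; apply: rint_ge0.
rewrite -Gst//; apply/ler_addgt0Pr => e' e'0.
(* One [e] pays for the exceptional set and [e * (t - s)] for the linearization errors, in total
   [e']. *)
pose e := e' / (1 + (t - s)).
have ts0 : 0 < 1 + (t - s) by rewrite ltr_wpDr// subr_ge0.
have e0 : 0 < e by rewrite divr_gt0.
have [del del0 Hdel] := acphi e e0.
have dG := ae_is_derive_rint hm'.
have [A [mA A0 HA]] : {ae mu, forall x, x \in `]0, T[ -> is_derive x 1 phi (m x) /\ is_derive x 1 G `|m x|}.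
  by apply: aeS2 dphi dG => x h1 h2 xT; split; [exact: h1|exact: h2].
(* The exceptional null set; the endpoints are added because derivatives are given in the open
   interval only. *)
pose Z := A `|` ([set 0] `|` [set T]).
have mZ : measurable Z by apply: measurableU => //; exact: measurableU.
have Z0 : mu Z = 0%E.
  apply: null_set_setU => //; first exact: measurableU.
  by apply: null_set_setU => //; exact: lebesgue_measure_set1.
have [U [oU ZU UZ]] := @lebesgue_regularity_outer R Z del mZ (eq_ind_r (fun r => (r < +oo)%E) (ltry 0) Z0) del0.
have mU : measurable U by exact: open_measurable.
have Udel : (mu U < del%:E)%E.
  rewrite -(setDUK ZU).
  apply: (@le_lt_trans _ _ (mu Z + mu (U `\` Z))%E).
    by apply: measureU2 => //; exact: measurableD.
  by rewrite Z0 add0e.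
have Ufin x y : (mu (U `&` `]x, y]) <= mu U)%E.
  by apply: le_measure; rewrite ?inE//; exact: measurableI.
(* Length of the part of [U] passed so far. It bounds the total length of the listed intervals,
   which therefore stays below [del]. *)
pose M x := fine (mu (U `&` `]s, x])).
have Mfin x : mu (U `&` `]s, x]) \is a fin_num.
  by rewrite ge0_fin_numE// (le_lt_trans (Ufin _ _))// (lt_trans Udel)// ltry.
have Mmono x y : x <= y -> M x <= M y.
  move=> xy; apply: fine_le => //; apply: le_measure; rewrite ?inE; try exact: measurableI.
  by apply: setIS; apply: subset_itvl; rewrite bnd_simp.
have Mext y z : s <= y -> y <= z -> (`]y, z] `<=` U) -> M y + (z - y) <= M z.
  move=> sy yz yzU.
  have E : U `&` `]s, z] = (U `&` `]s, y]) `|` `]y, z].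
    rewrite -[`]y, z]%classic in RHS](_ : U `&` `]y, z] = _); last by rewrite setIidr.
    by rewrite -setIUr -itv_bndbnd_setU// bnd_simp.
  rewrite /M E measureU//; last 2 first.
  - exact: measurableI.
  - rewrite -subset0 => x [[_ /=]]; rewrite !in_itv/= => /andP[_ xy] /andP[yx _].
    by move: xy; rewrite leNgt yx.
  have hyz : mu `]y, z] = (z - y)%:E.
    rewrite lebesgue_measure_itv/= lte_fin; case: ltP => [_|zy]; first by rewrite -EFinB.
    by rewrite (@le_anti _ _ z y) ?zy ?yz// subrr.
  change (fine (mu (U `&` `]s, y])) + (z - y) <= fine (mu (U `&` `]s, y]) + mu `]y, z])%E).
  by rewrite hyz fineD.
(* Invariant of the real induction: increments across [U] are put on the list and left to absolute
   continuity, all others are charged to [G] and to a linear error. *)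
pose Good x := exists l, [/\ ordered_in s x l, \sum_(p <- l) (p.2 - p.1) <= M x &
  `|phi x - phi s| <= \sum_(p <- l) `|phi p.2 - phi p.1| + (G x - G s) + e * (x - s)].
have extA y z : y <= z -> `|phi z - phi y| <= G z - G y + e * (z - y) -> Good y -> Good z.
  move=> yz h [l [ol ml hl]]; exists l; split; first exact: ordered_inW ol.
    by rewrite (le_trans ml)// Mmono.
  have := ler_distD (phi y) (phi z) (phi s).
  by move: h hl; move: (\sum_(p <- l) _) => Sl; clear; lra.
have extB y z : s <= y -> y <= z -> z <= T -> (`]y, z] `<=` U) -> Good y -> Good z.
  move=> sy yz zT yzU [l [ol ml hl]]; exists (rcons l (y, z)).
  rewrite !big_rcons /=; split; first exact: ordered_in_rcons.
    by apply: le_trans (Mext _ _ sy yz yzU); rewrite lerD2r.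
  have := ler_distD (phi y) (phi z) (phi s).
  have : 0 <= e * (z - y) by rewrite mulr_ge0 ?subr_ge0// ltW.
  have := Gmono y z (le_trans s0 sy) yz zT.
  by move: hl; move: (\sum_(p <- l) _) => Sl; clear; lra.
have [l [ol ml hl]] : Good t.
  apply: (@real_induction s t) => //.
    exists [::]; rewrite /ordered_in/= !big_nil !subrr mulr0 !addr0 normr0; split => //.
    by rewrite fine_ge0.
  move=> c sc ct.
  have [Uc|nUc] := pselect (U c).
    have [eta /= eta0 Heta] := oU _ Uc.
    exists eta => // y z sy zt ey yc cz ze.
    apply: extB => //; [exact: le_trans cz|exact: le_trans tT|].
    move=> x /=; rewrite in_itv/= => /andP[yx xz]; apply: Heta => /=.
    by move: cz ze sc yc ey yx xz; clear => *; rewrite ltr_norml; apply/andP; split; lra.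
  have nZc : ~ Z c by move=> /ZU.
  have cT : c \in `]0, T[.
    rewrite in_itv/= !lt_def (le_trans s0 sc) (le_trans ct tT) !andbT.
    by apply/andP; split; apply/eqP => h; apply: nZc; right; [left|right].
  have [d1 d2] : is_derive c 1 phi (m c) /\ is_derive c 1 G `|m c|.
    by apply: contrapT => h; apply: nZc; left; apply: HA => /= /(_ cT).
  have e20 : 0 < e / 2 by rewrite divr_gt0.
  have [eta1 eta10 H1] := (is_derive_epsP _ _ _).1 d1 _ e20.
  have [eta2 eta20 H2] := (is_derive_epsP _ _ _).1 d2 _ e20.
  exists (Num.min eta1 eta2); first by rewrite lt_min eta10.
  move=> y z sy zt ey yc cz ze gy.
  have [yc1 yc2] : `|y - c| < eta1 /\ `|y - c| < eta2.
    by apply/andP; rewrite -lt_min distrC ger0_norm ?subr_ge0// ltrBlDr -ltrBlDl.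
  have [zc1 zc2] : `|z - c| < eta1 /\ `|z - c| < eta2.
    by apply/andP; rewrite -lt_min ger0_norm ?subr_ge0// ltrBlDl.
  have cT' : c <= T := le_trans ct tT.
  have zT : z <= T := le_trans zt tT.
  have gc : Good c.
    apply: (extA y) => //.
    have := le_increment (H1 y yc1) (H2 y yc2).
    rewrite (distrC (phi y)) (distrC (G y)) (distrC y).
    by rewrite (ger0_norm (Gmono _ _ (le_trans s0 sy) yc cT')) (@ger0_norm _ (c - y)) ?subr_ge0.
  apply: (extA c) => //; have := le_increment (H1 z zc1) (H2 z zc2).
  by rewrite (ger0_norm (Gmono _ _ (le_trans s0 sc) cz zT)) (@ger0_norm _ (z - c)) ?subr_ge0.
have Mt : M t < del.
  by rewrite -lte_fin fineK// (le_lt_trans (Ufin _ _)).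
have := ac_list Hdel s0 tT ol (le_lt_trans ml Mt).
have ee : e' = e * (1 + (t - s)) by rewrite /e divfK// gt_eqF.
by move: hl; move: (\sum_(p <- l) _) => Sl; rewrite ee; clear; lra.
Qed.

End AbsolutelyContinuous.

(** * Euclidean norms and vector-valued L^2 functions *)

Section EuclideanNorm.
Context {R : realType} {d : nat}.
Implicit Types (u v w : 'rV[R]_d) (k : R) (A : 'M[R]_d).

Lemma dotC u v : dot u v = dot v u.
Proof. by apply: eq_bigr => i _; rewrite mulrC. Qed.

Lemma dotDl u v w : dot (u + v) w = dot u w + dot v w.
Proof. by rewrite -big_split; apply: eq_bigr => i _; rewrite mxE mulrDl. Qed.

Lemma dotZl k u v : dot (k *: u) v = k * dot u v.
Proof. by rewrite /dot big_distrr/=; apply: eq_bigr => i _; rewrite mxE mulrA. Qed.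

Lemma dotNl u v : dot (- u) v = - dot u v.
Proof. by rewrite -scaleN1r dotZl mulN1r. Qed.

Lemma dotBl u v w : dot (u - v) w = dot u w - dot v w.
Proof. by rewrite dotDl dotNl. Qed.

Lemma dotDr u v w : dot w (u + v) = dot w u + dot w v.
Proof. by rewrite ![dot w _]dotC dotDl. Qed.

Lemma dotZr k u v : dot u (k *: v) = k * dot u v.
Proof. by rewrite ![dot u _]dotC dotZl. Qed.

Lemma dotBr u v w : dot w (u - v) = dot w u - dot w v.
Proof. by rewrite ![dot w _]dotC dotBl. Qed.

Lemma dot0l u : dot 0 u = 0.
Proof. by rewrite /dot big1// => i _; rewrite mxE mul0r. Qed.

Lemma dot0r u : dot u 0 = 0.
Proof. by rewrite dotC dot0l. Qed.

Lemma dot_ge0 u : 0 <= dot u u.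
Proof. by apply: sumr_ge0 => i _; rewrite -expr2 sqr_ge0. Qed.

Lemma dot_mulmx u v A : dot (u *m A) v = dot u (v *m A^T).
Proof.
rewrite /dot; under eq_bigr do rewrite mxE big_distrl/=.
rewrite exchange_big/=; apply: eq_bigr => i _; rewrite mxE big_distrr/=.
by apply: eq_bigr => j _; rewrite mxE; ring.
Qed.

Lemma enorm_ge0 u : 0 <= enorm u.
Proof. exact: sqrtr_ge0. Qed.

Lemma enorm_sqr u : enorm u ^+ 2 = dot u u.
Proof. by rewrite sqr_sqrtr// dot_ge0. Qed.

Lemma enorm0 : enorm (0 : 'rV[R]_d) = 0.
Proof. by rewrite /enorm dot0l sqrtr0. Qed.

Lemma enormZ k u : enorm (k *: u) = `|k| * enorm u.
Proof. by rewrite /enorm dotZl dotZr mulrA -expr2 sqrtrM ?sqr_ge0// sqrtr_sqr. Qed.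

Lemma enormN u : enorm (- u) = enorm u.
Proof. by rewrite -scaleN1r enormZ normrN normr1 mul1r. Qed.

Lemma enormBC u v : enorm (u - v) = enorm (v - u).
Proof. by rewrite -opprB enormN. Qed.

Lemma dot_le_enorm u v : `|dot u v| <= enorm u * enorm v.
Proof.
rewrite -(@ler_pXn2r _ 2)// ?nnegrE ?mulr_ge0 ?enorm_ge0//.
rewrite real_normK ?num_real// exprMn !enorm_sqr.
apply: discriminant_le; first exact: dot_ge0.
move=> k; have := dot_ge0 (u - k *: v).
by rewrite dotBl !dotBr !dotZl !dotZr (dotC v u); congr (0 <= _); ring.
Qed.

Lemma enormD u v : enorm (u + v) <= enorm u + enorm v.
Proof.
rewrite -(@ler_pXn2r _ 2)// ?nnegrE ?addr_ge0 ?enorm_ge0//.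
rewrite enorm_sqr dotDl !dotDr (dotC v u) sqrrD !enorm_sqr.
have := le_trans (ler_norm _) (dot_le_enorm u v); lra.
Qed.

Lemma enormB u v : enorm (u - v) <= enorm u + enorm v.
Proof. by rewrite (le_trans (enormD _ _))// enormN. Qed.

Lemma coord_le_enorm u i : `|u 0 i| <= enorm u.
Proof.
rewrite -sqrtr_sqr ler_wsqrtr// /dot (bigD1 i)//= -expr2 lerDl.
by apply: sumr_ge0 => j _; rewrite -expr2 sqr_ge0.
Qed.

Lemma enorm_le_coord u k : 0 <= k -> (forall i, `|u 0 i| <= k) -> enorm u <= d%:R * k.
Proof.
move=> k0 uk; have dk0 : 0 <= d%:R * k by rewrite mulr_ge0.
rewrite -(@ler_pXn2r _ 2)// ?nnegrE ?enorm_ge0// enorm_sqr.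
apply: (@le_trans _ _ (\sum_(i < d) k ^+ 2)).
  apply: ler_sum => i _; rewrite -expr2 -[u 0 i ^+ 2]real_normK ?num_real//.
  by rewrite lerXn2r ?nnegrE.
rewrite sumr_const card_ord -[leLHS]mulr_natl exprMn; apply: ler_wpM2r; first exact: sqr_ge0.
by rewrite expr2 -natrM ler_nat; case: (d) => // n; rewrite leq_pmulr.
Qed.

Lemma enorm_eq0 u : enorm u <= 0 -> u = 0.
Proof.
move=> u0; apply/rowP => i; rewrite mxE; apply/eqP; rewrite -normr_eq0 -normr_le0.
by rewrite normr_id (le_trans (coord_le_enorm u i)).
Qed.

(** [sup] is an upper bound only for a set that is bounded above, so this is needed before [opnorm]
    estimates anything. *)
Lemma opnorm_bounded A : has_ubound [set enorm (v *m A) | v in [set v | enorm v <= 1]].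
Proof.
pose k := \sum_i \sum_j `|A i j|.
have k0 : 0 <= k by apply: sumr_ge0 => i _; exact: sumr_ge0.
exists (d%:R * k) => _ [v /= v1 <-]; apply: enorm_le_coord => // j.
rewrite mxE (le_trans (ler_norm_sum _ _ _))//; apply: ler_sum => i _.
rewrite normrM; apply: (@le_trans _ _ (1 * `|A i j|)).
  by rewrite ler_wpM2r// (le_trans (coord_le_enorm _ _)).
by rewrite mul1r (bigD1 j)//= lerDl sumr_ge0.
Qed.

Lemma enorm_mulmx u A : enorm (u *m A) <= opnorm A * enorm u.
Proof.
have [u0|u0] := leP (enorm u) 0.
  by rewrite (enorm_eq0 u0) mul0mx enorm0 mulr0.
have -> : u = enorm u *: ((enorm u)^-1 *: u) by rewrite scalerA divff ?scale1r// gt_eqF.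
rewrite -scalemxAl !enormZ (ger0_norm (enorm_ge0 u)) mulrCA ler_wpM2l ?enorm_ge0//.
have E : `|(enorm u)^-1| * enorm u = 1 by rewrite normfV ger0_norm ?mulVf ?enorm_ge0// gt_eqF.
rewrite E mulr1; apply: ub_le_sup; first exact: opnorm_bounded.
by exists ((enorm u)^-1 *: u) => //=; rewrite enormZ E.
Qed.

(** |u A^T|^2 = <u A^T A, u>, and one factor |u A^T| cancels. The dual equation involves M^T, while
    the available bound is for M. *)
Lemma enorm_mulmx_tr u A k : (forall v, enorm (v *m A) <= k * enorm v) ->
  enorm (u *m A^T) <= k * enorm u.
Proof.
move=> H; have [h|h] := leP (enorm (u *m A^T)) 0.
  have := H u; have := enorm_ge0 (u *m A); move: h.
  rewrite le_eqVlt => /predU1P[->|]; last first.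
    by move=> hh; have := enorm_ge0 (u *m A^T); rewrite leNgt hh.
  by move=> h1 h2; exact: le_trans h2.
rewrite -(ler_pM2r h) -expr2 enorm_sqr -dot_mulmx.
apply: (le_trans (ler_norm _)); apply: (le_trans (dot_le_enorm _ _)).
by rewrite mulrAC ler_wpM2r ?enorm_ge0// H.
Qed.

End EuclideanNorm.

Section VectorL2.
Context {R : realType} {d : nat}.
Variable T : R.
Notation mu := (@lebesgue_measure R).
Implicit Types (u v w : R -> 'rV[R]_d) (k : R) (M : R -> 'M[R]_d).

Lemma in_L2P u : in_L2 T u <-> forall i, L2 0 T (fun t => u t 0 i).
Proof.
split=> H i; have [h1 h2] := H i.
  split=> //; apply/integrableP; split.
    by apply/measurable_EFinP; exact: measurable_funX.
  by under eq_integral do rewrite /= ger0_norm ?sqr_ge0//.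
split => //; move/integrableP : h2 => [_].
by under eq_integral do rewrite /= ger0_norm ?sqr_ge0//.
Qed.

Lemma in_L2D u v : in_L2 T u -> in_L2 T v -> in_L2 T (fun t => u t + v t).
Proof.
move=> /in_L2P hu /in_L2P hv; apply/in_L2P => i.
by under eq_fun do rewrite mxE; exact: L2D.
Qed.

Lemma in_L2Z k u : in_L2 T u -> in_L2 T (fun t => k *: u t).
Proof.
by move=> /in_L2P hu; apply/in_L2P => i; under eq_fun do rewrite mxE; exact: L2Z.
Qed.

Lemma in_L2B u v : in_L2 T u -> in_L2 T v -> in_L2 T (fun t => u t - v t).
Proof.
move=> hu /(in_L2Z (-1)) hv; under eq_fun do rewrite -scaleN1r; exact: in_L2D.
Qed.

Lemma in_L2_cont u : (forall i, continuous (fun t => u t 0 i)) -> in_L2 T u.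
Proof. by move=> hu; apply/in_L2P => i; exact: cont_L2. Qed.

Lemma eq_in_L2 u v : (forall t, t \in `]0, T[ -> u t = v t) -> in_L2 T u -> in_L2 T v.
Proof.
move=> uv /in_L2P hu; apply/in_L2P => i; have [h1 h2] := hu i; split.
  by apply: eq_measurable_fun h1 => t; rewrite inE => tT; rewrite uv.
by apply: eq_L1 h2 => t tT; rewrite uv.
Qed.

Lemma L2_sum n (F : 'I_n -> R -> R) : (forall i, L2 0 T (F i)) ->
  L2 0 T (fun t => \sum_i F i t).
Proof.
elim: n F => [|n IH] F HF.
  by under eq_fun do rewrite big_ord0; exact: L2_cst.
by under eq_fun do rewrite big_ord_recr; apply: L2D; [exact: IH|exact: HF].
Qed.

Lemma in_L2_mulmx u M : in_L2 T u -> (forall i j, continuous (fun t => M t i j)) ->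
  in_L2 T (fun t => u t *m M t).
Proof.
move=> /in_L2P hu cM; apply/in_L2P => j; under eq_fun do rewrite mxE.
apply: L2_sum => i; have [K [Kr HK]] := compact_bounded
  (continuous_compact (@cont_within _ 0 T _ (cM i j)) (@segment_compact _ 0 T)).
have [mu_ hu2] := hu i.
apply: (@L2_le _ _ _ _ (fun t => (`|K| + 1) * `|u t 0 i|)).
- by apply: measurable_funM => //; exact: cont_measurable.
- move=> t tT; rewrite normrM mulrC ler_wpM2r//; apply: HK; first by rewrite ltr_pwDr// ler_norm.
  by exists t => //; exact: subset_itv_oo_cc.
- apply: L2Z; split; first exact: measurableT_comp.
  by under eq_fun do rewrite real_normK ?num_real//.
Qed.

Lemma dot_L1 u v : in_L2 T u -> in_L2 T v -> L1 0 T (fun t => dot (u t) (v t)).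
Proof. by move=> /in_L2P hu /in_L2P hv; apply: L1_sum => i; exact: L2_mul. Qed.

Lemma enorm_L2 u : in_L2 T u -> L2 0 T (fun t => enorm (u t)).
Proof.
move=> hu; split; last by under eq_fun do rewrite enorm_sqr; exact: dot_L1.
apply: (@measurableT_comp _ _ _ _ _ _ (@Num.sqrt R)).
  by apply: continuous_measurable_fun; exact: sqrt_continuous.
exact: (L1_measurable (dot_L1 hu hu)).
Qed.

Definition L2dot u v : R := rint 0 T (fun t => dot (u t) (v t)).

Lemma L2dotC u v : L2dot u v = L2dot v u.
Proof. by apply: eq_rint => t _; rewrite dotC. Qed.

Lemma L2dotDl u v w : in_L2 T u -> in_L2 T v -> in_L2 T w ->
  L2dot (fun t => u t + v t) w = L2dot u w + L2dot v w.
Proof.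
move=> hu hv hw; rewrite -rintD; [|exact: dot_L1|exact: dot_L1].
by apply: eq_rint => t _; rewrite dotDl.
Qed.

Lemma L2dotBl u v w : in_L2 T u -> in_L2 T v -> in_L2 T w ->
  L2dot (fun t => u t - v t) w = L2dot u w - L2dot v w.
Proof.
move=> hu hv hw; rewrite -rintB; [|exact: dot_L1|exact: dot_L1].
by apply: eq_rint => t _; rewrite dotBl.
Qed.

Lemma L2dotZl k u v : in_L2 T u -> in_L2 T v ->
  L2dot (fun t => k *: u t) v = k * L2dot u v.
Proof.
move=> hu hv; rewrite -rintZ; last exact: dot_L1.
by apply: eq_rint => t _; rewrite dotZl.
Qed.

Lemma L2dotDr u v w : in_L2 T u -> in_L2 T v -> in_L2 T w ->
  L2dot w (fun t => u t + v t) = L2dot w u + L2dot w v.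
Proof. by move=> hu hv hw; rewrite ![L2dot w _]L2dotC L2dotDl. Qed.

Lemma L2dotBr u v w : in_L2 T u -> in_L2 T v -> in_L2 T w ->
  L2dot w (fun t => u t - v t) = L2dot w u - L2dot w v.
Proof. by move=> hu hv hw; rewrite ![L2dot w _]L2dotC L2dotBl. Qed.

Lemma L2dotZr k u v : in_L2 T u -> in_L2 T v ->
  L2dot v (fun t => k *: u t) = k * L2dot v u.
Proof. by move=> hu hv; rewrite ![L2dot v _]L2dotC L2dotZl. Qed.

Lemma L2norm_ge0 u : 0 <= L2norm T u.
Proof. exact: sqrtr_ge0. Qed.

Lemma L2normE u : L2norm T u = Num.sqrt (rint 0 T (fun t => enorm (u t) ^+ 2)).
Proof. by []. Qed.

Lemma L2norm_sqr u : L2norm T u ^+ 2 = L2dot u u.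
Proof.
rewrite sqr_sqrtr; last by apply: (@rint_ge0 _ 0 T) => t _; exact: sqr_ge0.
by apply: (@eq_rint _ 0 T) => t _; rewrite enorm_sqr.
Qed.

Lemma L2norm_sqr_rint u : L2norm T u ^+ 2 = rint 0 T (fun t => enorm (u t) ^+ 2).
Proof. by rewrite L2norm_sqr; apply: eq_rint => t _; rewrite enorm_sqr. Qed.

Lemma rint_enorm_mul_le u v : in_L2 T u -> in_L2 T v ->
  rint 0 T (fun t => enorm (u t) * enorm (v t)) <= L2norm T u * L2norm T v.
Proof.
move=> hu hv; have h0 : 0 <= rint 0 T (fun t => enorm (u t) * enorm (v t)).
  by apply: rint_ge0 => t _; rewrite mulr_ge0 ?enorm_ge0.
rewrite -(@ler_pXn2r _ 2)// ?nnegrE ?mulr_ge0 ?L2norm_ge0//.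
by rewrite exprMn !L2norm_sqr_rint cauchy_schwarz_rint//; exact: enorm_L2.
Qed.

Lemma L2dot_le u v : in_L2 T u -> in_L2 T v -> `|L2dot u v| <= L2norm T u * L2norm T v.
Proof.
move=> hu hv; apply: le_trans (rint_enorm_mul_le hu hv).
apply: (le_trans (rint_norm (dot_L1 hu hv))); apply: rint_le => [||t _].
- by apply: L1_norm; exact: dot_L1.
- by apply: L2_mul; exact: enorm_L2.
- exact: dot_le_enorm.
Qed.

Lemma L2normD u v : in_L2 T u -> in_L2 T v ->
  L2norm T (fun t => u t + v t) <= L2norm T u + L2norm T v.
Proof.
move=> hu hv; rewrite -(@ler_pXn2r _ 2)// ?nnegrE ?addr_ge0 ?L2norm_ge0//.
rewrite L2norm_sqr L2dotDl ?L2dotDr//; [|exact: in_L2D..].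
rewrite (L2dotC v u) sqrrD !L2norm_sqr.
by have := le_trans (ler_norm _) (L2dot_le hu hv); lra.
Qed.

Lemma L2normZ k u : in_L2 T u -> L2norm T (fun t => k *: u t) = `|k| * L2norm T u.
Proof.
move=> hu; rewrite L2normE (@eq_rint _ _ _ _ (fun t => k ^+ 2 * enorm (u t) ^+ 2)).
  rewrite rintZ; last exact: (enorm_L2 hu).2.
  by rewrite sqrtrM ?sqr_ge0// sqrtr_sqr.
by move=> t _; rewrite enormZ exprMn real_normK ?num_real.
Qed.

Lemma L2normB u v : in_L2 T u -> in_L2 T v ->
  L2norm T (fun t => u t - v t) <= L2norm T u + L2norm T v.
Proof.
move=> hu hv; have := L2normD hu (in_L2Z (-1) hv).
by rewrite L2normZ// normrN normr1 mul1r; under eq_fun do rewrite scaleN1r.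
Qed.

Lemma L2norm_mono u v k : 0 <= k -> in_L2 T u -> in_L2 T v ->
  (forall t, t \in `]0, T[ -> enorm (u t) <= k * enorm (v t)) ->
  L2norm T u <= k * L2norm T v.
Proof.
move=> k0 hu hv uv; rewrite -(@ler_pXn2r _ 2)// ?nnegrE ?mulr_ge0 ?L2norm_ge0//.
rewrite exprMn !L2norm_sqr_rint -rintZ; last exact: (enorm_L2 hv).2.
apply: rint_le => [||t tT]; first exact: (enorm_L2 hu).2.
  by apply: L1Z; exact: (enorm_L2 hv).2.
by rewrite -exprMn lerXn2r ?nnegrE ?mulr_ge0 ?enorm_ge0// uv.
Qed.

Lemma L2norm_le_cst u k : 0 < T -> 0 <= k -> in_L2 T u ->
  (forall t, t \in `]0, T[ -> enorm (u t) <= k) -> L2norm T u <= Num.sqrt T * k.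
Proof.
move=> T0 k0 hu uk; rewrite -(@ler_pXn2r _ 2)// ?nnegrE ?mulr_ge0 ?L2norm_ge0 ?sqrtr_ge0//.
rewrite exprMn L2norm_sqr_rint sqr_sqrtr ?(ltW T0)//.
apply: (@le_trans _ _ (rint 0 T (fun=> k ^+ 2))).
  apply: rint_le => [||t tT]; first exact: (enorm_L2 hu).2.
    exact: L1_cst.
  by rewrite lerXn2r ?nnegrE ?enorm_ge0// uk.
by rewrite rint_cst ?(ltW T0)// subr0 mulrC.
Qed.

Lemma ae_L2norm u v : in_L2 T u -> in_L2 T v ->
  {ae mu, forall t, t \in `]0, T[ -> u t = v t} -> L2norm T u = L2norm T v.
Proof.
move=> hu hv uv; rewrite !L2normE; congr Num.sqrt; apply: ae_eq_rint.
- exact: L1_measurable (enorm_L2 hu).2.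
- exact: L1_measurable (enorm_L2 hv).2.
- by apply: aeS uv => t h tT; rewrite h.
Qed.

Lemma ae_L2dotl u v w : in_L2 T u -> in_L2 T v -> in_L2 T w ->
  {ae mu, forall t, t \in `]0, T[ -> u t = v t} -> L2dot u w = L2dot v w.
Proof.
move=> hu hv hw uv; apply: ae_eq_rint.
- exact: L1_measurable (dot_L1 hu hw).
- exact: L1_measurable (dot_L1 hv hw).
- by apply: aeS uv => t h tT; rewrite h.
Qed.

Definition vint (s t : R) u : 'rV[R]_d := \row_i rint s t (fun x => u x 0 i).

(* duality: |int u|^2 = int <int u, u> <= |int u| int |u| *)
Lemma enorm_vint s t u : (forall i, L1 s t (fun x => u x 0 i)) ->
  L1 s t (fun x => enorm (u x)) ->
  enorm (vint s t u) <= rint s t (fun x => enorm (u x)).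
Proof.
move=> hu he; set I := vint s t u; set K := rint _ _ _.
have [I0|I0] := leP (enorm I) 0.
  by rewrite (le_trans I0)//; apply: rint_ge0 => x _; exact: enorm_ge0.
rewrite -(ler_pM2l I0) -expr2 enorm_sqr.
have h i : L1 s t (fun x => I 0 i * u x 0 i) by exact: L1Z.
have h1 := L1_sum h; have h2 := rint_sum h.
have -> : dot I I = rint s t (fun x => dot I (u x)).
  rewrite [RHS]h2; apply: eq_bigr => i _; rewrite rintZ//.
  by congr (_ * _); rewrite mxE.
rewrite -rintZ//; apply: rint_le => [||x _] //; first exact: L1Z.
by rewrite (le_trans (ler_norm _))// dot_le_enorm.
Qed.

End VectorL2.

(** * The space H^1 *)

Section WeakDerivative.
Context {R : realType} {d : nat}.
Variable T : R.
Hypothesis T0 : 0 < T.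
Notation mu := (@lebesgue_measure R).
Implicit Types (u v w : R -> 'rV[R]_d) (a b k t : R).

(** The retraction of the line onto [0, T]. Composing with it turns a function continuous within
    [0, T] into one continuous on the line, with the same values on [0, T]. *)
Definition clamp t : R := Num.min (Num.max t 0) T.

Lemma clamp_in t : clamp t \in `[0, T].
Proof.
by rewrite in_itv/= /clamp le_min le_max lexx orbT ge_min lexx orbT (ltW T0).
Qed.

Lemma clamp_id t : t \in `[0, T] -> clamp t = t.
Proof. by rewrite in_itv/= /clamp => /andP[h1 h2]; rewrite max_l// min_l. Qed.

Lemma clamp_continuous : continuous clamp.
Proof.
move=> x; apply: (@continuous_min R _ (fun y : R => Num.max y 0 : R^o) (fun=> T : R^o)); last exact: cvg_cst.
by apply: (@continuous_max R _ (id : R -> R^o) (fun=> 0 : R^o)); [exact: cvg_id|exact: cvg_cst].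
Qed.

Lemma clamp_lipschitz s t : s <= t -> 0 <= clamp t - clamp s <= t - s.
Proof.
move=> st; rewrite /clamp; have [h1|h1] := leP t 0; have [h2|h2] := leP s 0.
all: by rewrite ?minElt; do ?case: ifPn => ?; apply/andP; split; lra.
Qed.

Lemma within_comp_clamp (V : topologicalType) (u : R -> V) :
  {within `[0, T], continuous u} -> continuous (u \o clamp).
Proof.
move=> /subspace_continuousP cu x.
have cin : `[0, T]%classic (clamp x) by exact: clamp_in.
have h : clamp y @[y --> x] --> within `[0, T] (nbhs (clamp x)).
  move=> P HP; change (nbhs x (clamp @^-1` P)).
  have H := @clamp_continuous x _ HP.
  apply: (@filterS _ (nbhs x) _ (clamp @^-1` [set y | `[0, T]%classic y -> P y])); last exact: H.
  by move=> y; apply; exact: clamp_in.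
exact: (cvg_comp _ _ h (cu _ cin)).
Qed.

Lemma within_clamp_coord u i : {within `[0, T], continuous u} ->
  continuous (fun t => u (clamp t) 0 i).
Proof.
move=> /within_comp_clamp cu x.
apply: (@continuous_comp _ _ _ (u \o clamp) (fun v : 'rV[R]_d => v 0 i)); first exact: cu.
exact: coord_continuous.
Qed.

Lemma in_oo_cc t : t \in `]0, T[ -> t \in `[0, T].
Proof. exact: subset_itv_oo_cc. Qed.

Lemma within_in_L2 u : {within `[0, T], continuous u} -> in_L2 T u.
Proof.
move=> cu; apply: (@eq_in_L2 _ _ _ (u \o clamp)); last first.
  by apply: in_L2_cont => i; exact: within_clamp_coord.
by move=> t tT; rewrite /= clamp_id//; exact: in_oo_cc.
Qed.

Lemma weak_ibp u v (p dp : R -> R) a b i : 0 <= a -> a <= b -> b <= T ->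
  {within `[0, T], continuous u} -> in_L2 T v -> weak_derivative T u v ->
  (forall x : R, is_derive x 1 p (dp x)) -> continuous dp ->
  rint a b (fun x => u x 0 i * dp x) =
  u b 0 i * p b - u a 0 i * p a - rint a b (fun x => v x 0 i * p x).
Proof.
move=> a0 ab bT cu /in_L2P hv uv dpp cdp.
have H phi : test_function T phi ->
    rint 0 T (fun t => u (clamp t) 0 i * derive1 phi t) = - rint 0 T (fun t => v t 0 i * phi t).
  move=> tphi; rewrite -[RHS](uv phi tphi i); apply: eq_rint => t tT.
  by rewrite clamp_id//; exact: in_oo_cc.
have := weak_integration_by_parts a0 ab bT (within_clamp_coord (i := i) cu)
  (L2_L1 (hv i)) H dpp cdp.
rewrite !clamp_id ?in_itv/= ?a0 ?bT ?(le_trans a0 ab) ?(le_trans ab bT)// => <-.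
apply: eq_rint => t; rewrite in_itv/= => /andP[ta tb]; rewrite clamp_id// in_itv/=.
by rewrite (le_trans a0 (ltW ta)) (le_trans (ltW tb) bT).
Qed.

(** Integration by parts against the constant 1, which is allowed because [weak_ibp] keeps the
    boundary terms: the fundamental theorem of calculus for H^1. *)
Lemma weak_increment u v a b : 0 <= a -> a <= b -> b <= T ->
  {within `[0, T], continuous u} -> in_L2 T v -> weak_derivative T u v ->
  u b - u a = vint a b v.
Proof.
move=> a0 ab bT cu hv uv; apply/rowP => i; rewrite !mxE.
have := @weak_ibp u v (fun=> 1) (fun=> 0) a b i a0 ab bT cu hv uv
  (fun x => is_derive_cst (1 : R) x 1) (@cst_continuous _ _ (0 : R)).
rewrite (@eq_rint _ a b (fun x => u x 0 i * 0) (fun=> 0)); last by move=> x _; rewrite mulr0.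
rewrite rint_cst// mul0r !mulr1 (@eq_rint _ a b _ (fun x => v x 0 i)); last by move=> x _; rewrite mulr1.
by move=> /eqP; rewrite eq_sym subr_eq0 => /eqP.
Qed.

(** Both candidates have the same integral over every (0, x), namely the increment of [u]; Lebesgue
    differentiation then gives equality almost everywhere. *)
Lemma weak_derivative_ae_unique u v w : {within `[0, T], continuous u} ->
  in_L2 T v -> weak_derivative T u v -> in_L2 T w -> weak_derivative T u w ->
  {ae mu, forall t, t \in `]0, T[ -> v t = w t}.
Proof.
move=> cu hv uv hw uw.
have H i : {ae mu, forall t, t \in `]0, T[ -> v t 0 i - w t 0 i = 0}.
  have hvi := L2_L1 ((in_L2P _ _).1 hv i); have hwi := L2_L1 ((in_L2P _ _).1 hw i).
  apply: (@ae_eq0_rint0 _ T (fun t => v t 0 i - w t 0 i)); first exact: L1B.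
  move=> x x0 xT; rewrite rintB; [|exact: L1S hvi|exact: L1S hwi].
  have e1 := weak_increment (lexx 0) x0 xT cu hv uv.
  have e2 := weak_increment (lexx 0) x0 xT cu hw uw.
  by have := congr1 (fun z : 'rV[R]_d => z 0 i) (etrans (esym e1) e2); rewrite !mxE => ->; rewrite subrr.
have := @filter_forall _ _ _ _ (ae_filter_ringOfSetsType mu) H.
apply: aeS => t h tT; apply/rowP => i; apply/eqP; rewrite -subr_eq0.
by apply/eqP; exact: h.
Qed.

Lemma H1_continuous u : H1 T u -> {within `[0, T], continuous u}.
Proof. by case. Qed.

Lemma H1_in_L2 u : H1 T u -> in_L2 T u.
Proof. by case=> _ []. Qed.

Lemma H1_wderiv u : H1 T u -> in_L2 T (wderiv T u) /\ weak_derivative T u (wderiv T u).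
Proof. by move=> [_ [_ h]]; exact: (getPex h). Qed.

(** [wderiv] is an unspecified choice among representatives, so an explicit derivative can be
    identified with it only almost everywhere; all later identities for [wderiv] of explicit
    functions pass through here. *)
Lemma H1_intro u v : {within `[0, T], continuous u} -> in_L2 T v ->
  weak_derivative T u v ->
  H1 T u /\ {ae mu, forall t, t \in `]0, T[ -> wderiv T u t = v t}.
Proof.
move=> cu hv uv.
have hu : H1 T u by split => //; split; [exact: within_in_L2|exists v].
split => //; have [h1 h2] := H1_wderiv hu.
exact: weak_derivative_ae_unique h1 h2 hv uv.
Qed.

Lemma L1_mul_cont (f p : R -> R) : L2 0 T f -> continuous p -> L1 0 T (fun t => f t * p t).
Proof. by move=> hf cp; apply: L2_mul => //; exact: cont_L2. Qed.

Lemma test_function_cont phi : test_function T phi -> continuous phi /\ continuous (derive1 phi).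
Proof.
move=> [h1 [h2 _]]; split => // x.
exact: (der_cont (DeriveDef (h1 x) erefl)).
Qed.

Lemma H1_lin u w k : H1 T u -> H1 T w ->
  H1 T (fun t => u t + k *: w t) /\
  {ae mu, forall t, t \in `]0, T[ ->
     wderiv T (fun t => u t + k *: w t) t = wderiv T u t + k *: wderiv T w t}.
Proof.
move=> hu hw; have [u1 u2] := H1_wderiv hu; have [w1 w2] := H1_wderiv hw.
apply: H1_intro.
- move=> t; apply: cvgD; first exact: H1_continuous.
  by apply: cvgZr; exact: (H1_continuous hw).
- by apply: in_L2D => //; exact: in_L2Z.
- move=> phi tphi i; have [cp cdp] := test_function_cont tphi.
  have hu0 := (in_L2P _ _).1 (H1_in_L2 hu) i; have hw0 := (in_L2P _ _).1 (H1_in_L2 hw) i.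
  have hu1 := (in_L2P _ _).1 u1 i; have hw1 := (in_L2P _ _).1 w1 i.
  have e1 : rint 0 T (fun t => u t 0 i * derive1 phi t) =
    - rint 0 T (fun t => wderiv T u t 0 i * phi t) by exact: u2.
  have e2 : rint 0 T (fun t => w t 0 i * derive1 phi t) =
    - rint 0 T (fun t => wderiv T w t 0 i * phi t) by exact: w2.
  suff : rint 0 T (fun t => (u t + k *: w t) 0 i * derive1 phi t) =
    - rint 0 T (fun t => (wderiv T u t + k *: wderiv T w t) 0 i * phi t) by [].
  transitivity (rint 0 T (fun t => u t 0 i * derive1 phi t + k * (w t 0 i * derive1 phi t))).
    by apply: eq_rint => t _; rewrite !mxE; ring.
  rewrite rintD; [|exact: L1_mul_cont|by apply: L1Z; exact: L1_mul_cont].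
  rewrite rintZ; last exact: L1_mul_cont.
  rewrite e1 e2 mulrN -opprD -rintZ; last exact: L1_mul_cont.
  rewrite -rintD; [|exact: L1_mul_cont|by apply: L1Z; exact: L1_mul_cont].
  by congr (- _); apply: eq_rint => t _; rewrite !mxE; ring.
Qed.

Lemma H1_sub u w : H1 T u -> H1 T w -> H1 T (u \- w) /\
  {ae mu, forall t, t \in `]0, T[ -> wderiv T (u \- w) t = wderiv T u t - wderiv T w t}.
Proof.
move=> hu hw; have [h1 h2] := H1_lin (-1) hu hw.
have E : (u \- w) = (fun t => u t + -1 *: w t).
  by apply/funext => t; rewrite /= scaleN1r.
rewrite E; split => //; apply: aeS h2 => t h tT.
by rewrite h// scaleN1r.
Qed.

Lemma H1_increment u a b : H1 T u -> 0 <= a -> a <= b -> b <= T ->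
  u b - u a = vint a b (wderiv T u).
Proof.
by move=> hu a0 ab bT; have [h1 h2] := H1_wderiv hu; apply: weak_increment => //;
  exact: H1_continuous.
Qed.

Lemma enorm_increment_le u a b : H1 T u -> 0 <= a -> a <= b -> b <= T ->
  enorm (u b - u a) <= rint a b (fun t => enorm (wderiv T u t)).
Proof.
move=> hu a0 ab bT; rewrite H1_increment//.
have [h1 _] := H1_wderiv hu; apply: enorm_vint.
  by move=> i; apply: (@L1S _ 0 T) => //; apply: L2_L1; exact: (in_L2P _ _).1.
by apply: (@L1S _ 0 T) => //; apply: L2_L1; exact: enorm_L2.
Qed.

(** Cauchy-Schwarz on (0, t). Keeping the factor [t] instead of [T] is what yields T^2 / 2 after
    integration, hence the 1 / sqrt 2 in the Poincare inequality. *)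
Lemma enorm_increment_sqr_le u t : H1 T u -> t \in `[0, T] ->
  enorm (u t - u 0) ^+ 2 <= t * L2norm T (wderiv T u) ^+ 2.
Proof.
move=> hu; rewrite in_itv/= => /andP[t0 tT].
have he := enorm_L2 (H1_wderiv hu).1.
have he' : L2 0 t (fun s => enorm (wderiv T u s)) by exact: L2S he.
have h := enorm_increment_le hu (lexx 0) t0 tT.
apply: (@le_trans _ _ (rint 0 t (fun s => enorm (wderiv T u s)) ^+ 2)).
  by rewrite lerXn2r ?nnegrE ?enorm_ge0// (le_trans (enorm_ge0 _) h).
apply: (le_trans (rint_sqr_le t0 he')); rewrite subr0 ler_wpM2l// L2norm_sqr_rint.
apply: rint_mono => //; first exact: he.2.
by move=> x _; exact: sqr_ge0.
Qed.

Lemma enorm_sup_le u t : H1 T u -> t \in `[0, T] ->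
  enorm (u t) <= enorm (u 0) + Num.sqrt T * L2norm T (wderiv T u).
Proof.
move=> hu tT; have := enorm_increment_sqr_le hu tT.
move: tT; rewrite in_itv/= => /andP[t0 tT] h.
rewrite -[u t](subrK (u 0)) addrC (le_trans (enormD _ _))// lerD2l.
rewrite -(@ler_pXn2r _ 2)// ?nnegrE ?enorm_ge0 ?mulr_ge0 ?L2norm_ge0 ?sqrtr_ge0//.
rewrite exprMn (sqr_sqrtr (ltW T0)); apply: (le_trans h).
by rewrite ler_wpM2r ?sqr_ge0.
Qed.

Lemma Poincare_L2norm u : H1 T u ->
  L2norm T (fun t => u t - u 0) <= T / Num.sqrt 2 * L2norm T (wderiv T u).
Proof.
move=> hu; set K := L2norm T (wderiv T u).
have K0 : 0 <= K by exact: L2norm_ge0.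
have hu0 : in_L2 T (fun t => u t - u 0).
  by apply: in_L2B; [exact: H1_in_L2|apply: in_L2_cont => i; exact: cst_continuous].
have T20 : 0 <= T / Num.sqrt 2 by rewrite divr_ge0 ?sqrtr_ge0 ?(ltW T0).
rewrite -(@ler_pXn2r _ 2)// ?nnegrE ?mulr_ge0 ?L2norm_ge0//.
rewrite L2norm_sqr_rint.
pose f (x : R) := K ^+ 2 * x.
have cf : continuous f by move=> x; apply: cvgMr; exact: cvg_id.
apply: (@le_trans _ _ (rint 0 T f)).
  apply: rint_le => [||t tT]; [exact: (enorm_L2 hu0).2|exact: cont_L1|].
  by rewrite /f mulrC enorm_increment_sqr_le//; exact: in_oo_cc.
pose G x := K ^+ 2 * (2^-1 * (x * x)).
have dG (x : R) : is_derive x 1 G (f x).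
  have := derZ (K ^+ 2) (derZ 2^-1 (derM (is_derive_id x 1) (is_derive_id x 1))).
  by move/is_derive_eq; apply; rewrite /f mul1r mulr1; field.
rewrite (rint_derive (ltW T0) dG cf) /G.
  rewrite !exprMn exprVn (sqr_sqrtr (ler0n _ 2)).
  by rewrite [leLHS](_ : _ = (T ^+ 2 * 2^-1) * K ^+ 2)//; field.
exact: ltW.
Qed.

Lemma H1_L2dot_ibp u (p dp : R -> 'rV[R]_d) : H1 T u ->
  (forall (i : 'I_d) (x : R), is_derive x 1 (fun t => p t 0 i) (dp x 0 i)) ->
  (forall i, continuous (fun t => dp t 0 i)) ->
  L2dot T (wderiv T u) p = dot (u T) (p T) - dot (u 0) (p 0) - L2dot T u dp.
Proof.
move=> hu dpp cdp; have [h1 h2] := H1_wderiv hu.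
have cp i : continuous (fun t => p t 0 i) by move=> x; exact: der_cont (dpp i x).
have L1u i := L1_mul_cont ((in_L2P _ _).1 (H1_in_L2 hu) i) (cdp i).
have L1w i := L1_mul_cont ((in_L2P _ _).1 h1 i) (cp i).
rewrite /L2dot /dot (rint_sum L1u) (rint_sum L1w) -!sumrB.
apply: eq_bigr => i _.
rewrite (@weak_ibp u _ (fun t => p t 0 i) _ 0 T i (lexx 0) (ltW T0) (lexx T) (H1_continuous hu) h1 h2 (dpp i) (cdp i)).
by rewrite opprB addrC subrK.
Qed.

Lemma XnormE u : H1 T u ->
  Xnorm T u = Num.sqrt (L2norm T (wderiv T u) ^+ 2 + enorm (u 0) ^+ 2).
Proof. by move=> hu; rewrite L2norm_sqr enorm_sqr. Qed.

(** Each admissible constant is at least |u(t)| / |u|_X, hence so is their infimum. The infimum is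
    over a nonempty set because 1 + sqrt T is admissible, which also settles the case |u|_X = 0. *)
Lemma enorm_le_Csup u t : H1 T u -> t \in `[0, T] -> enorm (u t) <= Csup d T * Xnorm T u.
Proof.
move=> hu tT; pose S : set R := [set C | 0 <= C /\ forall u : R -> 'rV[R]_d, H1 T u ->
    forall t, t \in `[0, T] -> enorm (u t) <= C * Xnorm T u].
rewrite -[Csup d T]/(inf S).
have X0 v : 0 <= Xnorm T v by exact: sqrtr_ge0.
have Sne : S (1 + Num.sqrt T).
  split; first by rewrite addr_ge0 ?sqrtr_ge0.
  move=> v hv s sT; apply: (le_trans (enorm_sup_le hv sT)).
  rewrite mulrDl mul1r lerD// ?ler_wpM2l ?sqrtr_ge0// XnormE//.
    by rewrite -[leLHS]ger0_norm ?enorm_ge0// -sqrtr_sqr ler_wsqrtr// lerDr sqr_ge0.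
  by rewrite -[leLHS]ger0_norm ?L2norm_ge0// -sqrtr_sqr ler_wsqrtr// lerDl sqr_ge0.
have [Xu0|Xu0] := leP (Xnorm T u) 0.
  have [_ /(_ u hu t tT)] := Sne.
  have -> : Xnorm T u = 0 by apply/le_anti; rewrite Xu0 X0.
  by rewrite !mulr0.
rewrite -ler_pdivrMr//; apply: lb_le_inf; first by exists (1 + Num.sqrt T).
by move=> C [C0 HC]; rewrite ler_pdivrMr// HC.
Qed.

End WeakDerivative.

(** * Piecewise linear interpolation *)

Section Ramp.
Context {R : realType}.
Notation mu := (@lebesgue_measure R).
Implicit Types (a b t T : R) (f g phi : R -> R).

(** The primitive of the indicator of [a, b[ that vanishes at [a]. Interpolants are sums of ramps,
    so their continuity and weak derivatives reduce to the case of a single ramp. *)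
Definition ramp a b t : R := clamp (b - a) (t - a).
Lemma continuous_vsum (V : normedModType R) n (F : 'I_n -> R -> V) :
  (forall i, continuous (F i)) -> continuous (fun t => \sum_i F i t).
Proof.
elim: n F => [|n IH] F cF x.
  by under eq_fun do rewrite big_ord0; exact: cvg_cst.
under eq_fun do rewrite big_ord_recr/=.
by apply: cvgD; [exact: (IH (fun i => F (widen_ord (leqnSn n) i)))|exact: cF].
Qed.

(** Half-open, so that every t in [0, T[ belongs to exactly one element of the partition. *)
Definition ind a b t : R := (t \in `[a, b[)%:R.

Lemma ramp_l a b t : a <= b -> t <= a -> ramp a b t = 0.
Proof. by move=> ab ta; rewrite /ramp /clamp max_r ?min_l; lra. Qed.

Lemma ramp_m a b t : a <= t -> t <= b -> ramp a b t = t - a.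
Proof. by move=> ab ta; rewrite /ramp /clamp max_l ?min_l; lra. Qed.

Lemma ramp_r a b t : a <= b -> b <= t -> ramp a b t = b - a.
Proof. by move=> ab ta; rewrite /ramp /clamp max_l ?min_r; lra. Qed.

Lemma continuous_ramp a b : continuous (ramp a b).
Proof.
move=> x; apply: (@continuous_comp _ _ _ (fun t => t - a) (clamp (b - a))).
  by apply: cvgB; [exact: cvg_id|exact: cvg_cst].
exact: clamp_continuous.
Qed.

Lemma ind_measurable a b (D : set R) : measurable D -> measurable_fun D (ind a b).
Proof.
move=> mD; rewrite (_ : ind a b = \1_(`[a, b[%classic : set R)).
  by apply: measurable_funTS; exact: measurable_indic.
by apply/funext => t; rewrite /ind indicE mem_setE.
Qed.

Lemma ind_L1 T a b f : L1 0 T f -> L1 0 T (fun t => ind a b t * f t).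
Proof.
move=> hf; apply: L1_le (L1_norm hf).
  by apply: measurable_funM; [exact: ind_measurable|exact: L1_measurable hf].
by move=> t _; rewrite normrM /ind; case: (_ \in _); rewrite ?normr1 ?mul1r// normr0 mul0r.
Qed.

Lemma rint_ind T a b f : 0 <= a -> a <= b -> b <= T -> L1 0 T f ->
  rint 0 T (fun t => ind a b t * f t) = rint a b f.
Proof.
move=> a0 ab bT hf; have h := ind_L1 a b hf.
rewrite (rint_cat a0 (le_trans ab bT) h) (@rint_cat _ a b T)//; last exact: L1S h.
rewrite (@eq_rint _ 0 a _ (fun=> 0)); last first.
  by move=> x; rewrite in_itv/= => /andP[_ xa]; rewrite /ind in_itv/= leNgt xa mul0r.
rewrite (@eq_rint _ b T _ (fun=> 0)); last first.
  by move=> x; rewrite in_itv/= => /andP[xb _]; rewrite /ind in_itv/= [x < b]ltNge (ltW xb) andbF mul0r.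
rewrite !rint_cst// ?(le_trans ab)// !mul0r add0r addr0.
by apply: eq_rint => x; rewrite in_itv/= => /andP[ax xb]; rewrite /ind in_itv/= (ltW ax) xb mul1r.
Qed.

Lemma test_function_bounds T phi : test_function T phi -> phi 0 = 0 /\ phi T = 0.
Proof.
move=> [_ [_ [a [b [a0 [bT H]]]]]]; split; apply: H; rewrite in_itv/= negb_and -!ltNge.
  by rewrite a0.
by rewrite bT orbT.
Qed.

Lemma test_function_der T phi (x : R) : test_function T phi -> is_derive x 1 phi (derive1 phi x).
Proof. by move=> [h _]; rewrite derive1E; exact: DeriveDef. Qed.

Lemma ramp_weak_derivative T a b phi : 0 <= a -> a <= b -> b <= T -> test_function T phi ->
  rint 0 T (fun t => ramp a b t * derive1 phi t) = - rint 0 T (fun t => ind a b t * phi t).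
Proof.
move=> a0 ab bT tphi; have [cp cdp] := test_function_cont tphi.
have [p0 pT] := test_function_bounds tphi.
have dp x := @test_function_der T phi x tphi.
have h : L1 0 T (fun t => ramp a b t * derive1 phi t).
  by apply: cont_L1 => x; apply: cvgM; [exact: continuous_ramp|exact: cdp].
rewrite (rint_ind a0 ab bT (cont_L1 _ _ cp)).
rewrite (rint_cat a0 (le_trans ab bT) h) (@rint_cat _ a b T)//; last exact: L1S h.
rewrite (@eq_rint _ 0 a _ (fun=> 0)); last first.
  by move=> x; rewrite in_itv/= => /andP[_ xa]; rewrite ramp_l ?mul0r// ltW.
rewrite rint_cst// mul0r add0r.
rewrite (@eq_rint _ b T _ (fun t => (b - a) * derive1 phi t)); last first.
  by move=> x; rewrite in_itv/= => /andP[xb _]; rewrite ramp_r// ltW.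
rewrite rintZ ?(rint_derive bT dp cdp) ?pT; last exact: cont_L1.
rewrite (@eq_rint _ a b _ (fun t => (t - a) * derive1 phi t)); last first.
  by move=> x; rewrite in_itv/= => /andP[ax xb]; rewrite ramp_m// ltW.
have cta : continuous (fun t : R => (t - a) * derive1 phi t).
  by move=> x; apply: cvgM; [apply: cvgB; [exact: cvg_id|exact: cvg_cst]|exact: cdp].
pose G (t : R) := (t - a) * phi t.
have dG (x : R) : is_derive x 1 G (phi x + (x - a) * derive1 phi x).
  have := derM (derB (is_derive_id x 1) (is_derive_cst a x 1)) (dp x).
  by move/is_derive_eq; apply; rewrite subr0 mul1r.
have cG : continuous (fun t : R => phi t + (t - a) * derive1 phi t).
  by move=> x; apply: cvgD; [exact: cp|exact: cta].
have := rint_derive ab dG cG; rewrite /G subrr mul0r subr0.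
by rewrite rintD; [lra|exact: cont_L1|exact: cont_L1].
Qed.

End Ramp.

Section Interpolation.
Context {R : realType} {d : nat}.
Variables (T : R) (s : seq R).
Hypothesis T0 : 0 < T.
Hypothesis part : itv_partition 0 T s.
Notation mu := (@lebesgue_measure R).
Implicit Types (w W : R -> 'rV[R]_d) (k j : nat) (t : R).

Lemma node_lt k : (k < size s)%N -> node s k < node s k.+1.
Proof. by move=> ks; have [/(pathP 0) h _] := part; exact: h. Qed.

Lemma node_last : node s (size s) = T.
Proof.
have [_ /eqP lT] := part.
by rewrite /node -[size s]/((size (0 :: s)).-1) nth_last /= lT.
Qed.

Lemma node_le j k : (j <= k)%N -> (k <= size s)%N -> node s j <= node s k.
Proof.
move=> /subnK <-; elim: (k - j)%N => // n IH ns.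
by rewrite (le_trans (IH (ltnW ns)))// ltW// node_lt.
Qed.

Lemma node_ge0 k : (k <= size s)%N -> 0 <= node s k.
Proof. exact: (@node_le 0). Qed.

Lemma node_leT k : (k <= size s)%N -> node s k <= T.
Proof. by move=> ks; rewrite -node_last; exact: node_le. Qed.

Lemma node_mesh k : (k < size s)%N -> node s k.+1 - node s k <= mesh s.
Proof.
move=> ks; rewrite /mesh.
exact: (le_bigmax _ (fun i : 'I_(size s) => node s i.+1 - node s i) (Ordinal ks)).
Qed.

Lemma mesh_ge0 : 0 <= mesh s.
Proof. exact: bigmax_ge_id. Qed.

Lemma node_locate t : 0 <= t -> t < T -> exists2 k, (k < size s)%N & t \in `[node s k, node s k.+1[.
Proof.
move=> t0 tT; pose P k := (k <= size s)%N && (node s k <= t).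
have P0 : exists k, P k by exists 0%N; rewrite /P/=.
have Pb k : P k -> (k <= size s)%N by case/andP.
case: (ex_maxnP P0 Pb) => k /andP[ks kt] kmax.
have ks' : (k < size s)%N.
  rewrite ltn_neqAle ks andbT; apply/eqP => E.
  by move: kt; rewrite E node_last leNgt tT.
exists k => //; rewrite in_itv/= kt/= ltNge; apply/negP => h.
by have := kmax k.+1; rewrite /P ks' h ltnn => /(_ isT).
Qed.

Lemma ind_node k j t : (k < size s)%N -> (j < size s)%N -> t \in `[node s k, node s k.+1[ ->
  ind (node s j) (node s j.+1) t = (j == k)%:R.
Proof.
move=> ks js; rewrite /ind !in_itv/= => /andP[h1 h2]; case: ltngtP => [jk|kj|->].
- by rewrite [t < _]ltNge (le_trans (node_le jk (ltnW ks)) h1) andbF.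
- by rewrite leNgt (lt_le_trans h2 (node_le kj (ltnW js))).
- by rewrite h1 h2.
Qed.

Definition slope w k : 'rV[R]_d :=
  (node s k.+1 - node s k)^-1 *: (w (node s k.+1) - w (node s k)).

(** The nodal interpolant, written as the primitive of its piecewise constant derivative; at a node
    the sum telescopes. The estimates use it through its value at 0 and its derivative [dinterp]. *)
Definition interp w t : 'rV[R]_d :=
  w 0 + \sum_(k < size s) ramp (node s k) (node s k.+1) t *: slope w k.

Definition dinterp w t : 'rV[R]_d :=
  \sum_(k < size s) ind (node s k) (node s k.+1) t *: slope w k.

Lemma interp0 w : interp w 0 = w 0.
Proof.
rewrite /interp big1 ?addr0// => k _; rewrite ramp_l ?scale0r//; first exact/ltW/node_lt.
exact/node_ge0/ltnW.
Qed.

Lemma interp_coord w i t :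
  interp w t 0 i = w 0 0 i + \sum_(k < size s) slope w k 0 i * ramp (node s k) (node s k.+1) t.
Proof. by rewrite mxE summxE; congr (_ + _); apply: eq_bigr => k _; rewrite mxE mulrC. Qed.

Lemma dinterp_coord w i t :
  dinterp w t 0 i = \sum_(k < size s) slope w k 0 i * ind (node s k) (node s k.+1) t.
Proof. by rewrite summxE; apply: eq_bigr => k _; rewrite mxE mulrC. Qed.

Lemma interp_P1 w : P1space T s (interp w).
Proof.
split.
  apply: continuous_subspaceT => t; apply: cvgD; first exact: cvg_cst.
  apply: continuous_vsum => k x; apply: cvgZr_tmp; exact: continuous_ramp.
(* On element [j] the ramps of earlier elements are saturated, those of later ones vanish, and the
   own ramp is t - node j; this gives the affine coefficients. *)
move=> j js; exists (w 0 + \sum_(k < size s) ((if (k < j)%N then node s k.+1 - node s k else 0) *: slope w k)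
  - node s j *: slope w j), (slope w j) => t; rewrite in_itv/= => /andP[h1 h2].
have E (k : 'I_(size s)) : ramp (node s k) (node s k.+1) t *: slope w k =
    (if (k < j)%N then node s k.+1 - node s k else 0) *: slope w k +
    (if k == Ordinal js then (t - node s j) *: slope w j else 0).
  have nk : node s k <= node s k.+1 by exact/ltW/node_lt.
  rewrite -val_eqE/=; case: ltngtP => [kj|jk|kj].
  - by rewrite ramp_r ?addr0// (le_trans (node_le kj (ltnW js))).
  - by rewrite ramp_l ?scale0r ?addr0// (le_trans h2)// node_le// ltnW.
  - by rewrite kj ramp_m// scale0r add0r.
rewrite /interp (eq_bigr _ (fun q _ => E q)).
rewrite big_split/=.
have -> : \sum_(i < size s) (if i == Ordinal js then (t - node s j) *: slope w j else 0) =
    (t - node s j) *: slope w j by rewrite -big_mkcond big_pred1_eq.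
rewrite scalerBl.
by rewrite -!addrA; congr (_ + (_ + _)); rewrite addrC.
Qed.

Lemma dinterp_in_L2 w : in_L2 T (dinterp w).
Proof.
apply/in_L2P => i; under eq_fun do rewrite dinterp_coord.
apply: L2_sum => k; apply: L2Z; split; first exact: ind_measurable.
apply: (@eq_L1 _ _ _ (fun t => ind (node s k) (node s k.+1) t * 1)); last by apply: ind_L1; exact: L1_cst.
by move=> t _; rewrite /ind; case: (_ \in _); rewrite ?mulr1 ?expr1n// expr0n.
Qed.

Lemma interp_weak_derivative w : weak_derivative T (interp w) (dinterp w).
Proof.
move=> phi tphi i; have [cp cdp] := test_function_cont tphi.
have [p0 pT] := test_function_bounds tphi.
have dp x := @test_function_der _ T phi x tphi.
have hr (k : 'I_(size s)) : L1 0 T (fun t => slope w k 0 i *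
    (ramp (node s k) (node s k.+1) t * derive1 phi t)).
  by apply: L1Z; apply: cont_L1 => x; apply: cvgM; [exact: continuous_ramp|exact: cdp].
have hi (k : 'I_(size s)) : L1 0 T (fun t => slope w k 0 i *
    (ind (node s k) (node s k.+1) t * phi t)).
  by apply: L1Z; apply: ind_L1; exact: cont_L1.
suff : rint 0 T (fun t => interp w t 0 i * derive1 phi t) =
  - rint 0 T (fun t => dinterp w t 0 i * phi t) by [].
transitivity (rint 0 T (fun t => w 0 0 i * derive1 phi t + \sum_(k < size s) slope w k 0 i *
    (ramp (node s k) (node s k.+1) t * derive1 phi t))).
  apply: eq_rint => t _; rewrite interp_coord mulrDl big_distrl/=; congr (_ + _).
  by apply: eq_bigr => k _; rewrite mulrA.
rewrite rintD; [|by apply: L1Z; exact: cont_L1|exact: L1_sum].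
rewrite rintZ; last exact: cont_L1.
rewrite (rint_derive (ltW T0) dp cdp) p0 pT subrr mulr0 add0r (rint_sum hr).
transitivity (- rint 0 T (fun t => \sum_(k < size s) slope w k 0 i *
    (ind (node s k) (node s k.+1) t * phi t))); last first.
  congr (- _); apply: eq_rint => t _; rewrite dinterp_coord big_distrl/=.
  by apply: eq_bigr => k _; rewrite mulrA.
rewrite (rint_sum hi) -sumrN; apply: eq_bigr => k _.
rewrite rintZ; last by apply: cont_L1 => x; apply: cvgM; [exact: continuous_ramp|exact: cdp].
rewrite rintZ; last by apply: ind_L1; exact: cont_L1.
rewrite (@ramp_weak_derivative _ T)// ?mulrN//.
- exact/node_ge0/ltnW.
- exact/ltW/node_lt.
- exact: node_leT.
Qed.

(** The derivative is carried as data and required on the whole line, so that the fundamental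
    theorem of calculus needs no care at 0 and T. *)
Definition is_C1 w W : Prop :=
  (forall (i : 'I_d) (x : R), is_derive x 1 (fun t => w t 0 i) (W x 0 i)) /\
  (forall i, continuous (fun t => W t 0 i)).

Lemma is_C1_coord_continuous w W i : is_C1 w W -> continuous (fun t => w t 0 i).
Proof. by move=> [h _] x; exact: der_cont (h i x). Qed.

Lemma continuous_rowP w : (forall i, continuous (fun t => w t 0 i)) -> continuous w.
Proof.
move=> cw t; have -> : w = (fun t => \sum_i w t 0 i *: delta_mx 0 i).
  by apply/funext => x; exact: row_sum_delta.
by apply: continuous_vsum => i x; apply: cvgZr_tmp; exact: cw.
Qed.

Lemma C1_H1 w W : is_C1 w W ->
  H1 T w /\ {ae mu, forall t, t \in `]0, T[ -> wderiv T w t = W t}.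
Proof.
move=> hw; have cw i := @is_C1_coord_continuous w W i hw.
case: hw => dw cW; apply: H1_intro => //.
- by apply: continuous_subspaceT; exact: continuous_rowP.
- exact: in_L2_cont.
move=> phi tphi i; have [cp cdp] := test_function_cont tphi.
have [p0 pT] := test_function_bounds tphi.
have dp x := @test_function_der _ T phi x tphi.
suff : rint 0 T (fun t => w t 0 i * derive1 phi t) = - rint 0 T (fun t => W t 0 i * phi t) by [].
have c1 : continuous (fun t => W t 0 i * phi t).
  by move=> x; apply: cvgM; [exact: cW|exact: cp].
have c2 : continuous (fun t => w t 0 i * derive1 phi t).
  by move=> x; apply: cvgM; [exact: cw|exact: cdp].
have cc : continuous (fun t => W t 0 i * phi t + w t 0 i * derive1 phi t).
  by move=> x; apply: cvgD; [exact: c1|exact: c2].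
have := rint_derive (ltW T0) (fun x => derM (dw i x) (dp x)) cc.
by rewrite p0 pT !mulr0 subrr rintD; [lra|exact: cont_L1|exact: cont_L1].
Qed.

(* on an element the slope of the interpolant is a value of W, by the mean value theorem *)
Lemma dinterp_error w W (m : R -> R) : is_C1 w W -> L2 0 T m ->
  (forall x y i, 0 <= x -> x <= y -> y <= T -> `|W y 0 i - W x 0 i| <= rint x y m) ->
  (forall x, x \in `]0, T[ -> 0 <= m x) ->
  L2norm T (fun t => W t - dinterp w t) <= d%:R * mesh s * Num.sqrt (rint 0 T (fun t => m t ^+ 2)).
Proof.
move=> [dw cW] hm Wm m0.
set I := rint 0 T (fun t => m t ^+ 2).
have I0 : 0 <= I by apply: rint_ge0 => t _; exact: sqr_ge0.
have hE : in_L2 T (fun t => W t - dinterp w t).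
  by apply: in_L2B; [exact: in_L2_cont|exact: dinterp_in_L2].
have M0 := mesh_ge0.
rewrite -(@ler_pXn2r _ 2)// ?nnegrE ?L2norm_ge0 ?mulr_ge0 ?sqrtr_ge0//.
rewrite exprMn (sqr_sqrtr I0) L2norm_sqr_rint.
(* Bound for the squared error on element [k]: by Cauchy-Schwarz the square of int m over the
   element is at most its length times int m^2. *)
pose B k := d%:R ^+ 2 * ((node s k.+1 - node s k) * rint (node s k) (node s k.+1) (fun t => m t ^+ 2)).
have hB (k : 'I_(size s)) : L1 0 T (fun t => ind (node s k) (node s k.+1) t * B k).
  by apply: ind_L1; exact: L1_cst.
apply: (@le_trans _ _ (rint 0 T (fun t => \sum_(k < size s) ind (node s k) (node s k.+1) t * B k))).
  apply: rint_le => [||t tT]; [exact: (enorm_L2 hE).2|exact: L1_sum|].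
  have [k ks tk] : exists2 k, (k < size s)%N & t \in `[node s k, node s k.+1[.
    by apply: node_locate; move: tT; rewrite in_itv/= => /andP[/ltW].
  rewrite (bigD1 (Ordinal ks))//= [X in _ <= _ + X]big1 ?addr0; last first.
    move=> j jk; rewrite (@ind_node k)// -(val_eqE j (Ordinal ks))/= in jk *.
    by rewrite (negbTE jk) mul0r.
  rewrite (@ind_node k k)// eqxx mul1r.
  have -> : dinterp w t = slope w k.
    rewrite /dinterp (bigD1 (Ordinal ks))//= (@ind_node k k)// eqxx scale1r big1 ?addr0//.
    move=> j jk; rewrite (@ind_node k)// -(val_eqE j (Ordinal ks))/= in jk *.
    by rewrite (negbTE jk) scale0r.
  set a := node s k in tk *; set b := node s k.+1 in tk *.
  have ab : a < b by exact: node_lt.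
  have a0 : 0 <= a by exact/node_ge0/ltnW.
  have bT : b <= T by exact: node_leT.
  have L2ab : L2 a b m by exact: L2S hm.
  have r0 : 0 <= rint a b m.
    apply: rint_ge0 => x; rewrite in_itv/= => /andP[ax xb]; apply: m0; rewrite in_itv/=.
    by rewrite (le_lt_trans a0 ax) (lt_le_trans xb bT).
  (* The mean value point [c] depends on the coordinate, so coordinates are treated separately, at
     the cost of the factor [d]. *)
  have cmp i : `|(W t - slope w k) 0 i| <= rint a b m.
    have cwi : {within `[a, b], continuous (fun t => w t 0 i)}.
      by apply: cont_within => x; exact: der_cont (dw i x).
    have [c cab Ec] := MVT ab (fun x _ => dw i x) cwi.
    have -> : (W t - slope w k) 0 i = W t 0 i - W c 0 i.
      by rewrite !mxE -/a -/b Ec mulrC mulfK// subr_eq0 gt_eqF.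
    have mono x y : a <= x -> x <= y -> y <= b -> rint x y m <= rint a b m.
      move=> ax xy yb; apply: rint_mono => //; first exact: L2_L1.
      move=> z; rewrite in_itv/= => /andP[az zb]; apply: m0; rewrite in_itv/=.
      by rewrite (le_lt_trans a0 az) (lt_le_trans zb bT).
    move: tk cab; rewrite !in_itv/= => /andP[t1 t2] /andP[c1 c2].
    have [ct|tc] := leP c t.
      apply: le_trans (mono c t (ltW c1) ct (ltW t2)); apply: Wm => //.
        by rewrite (le_trans a0)// ltW.
      by rewrite (le_trans (ltW t2)).
    rewrite distrC; apply: le_trans (mono t c t1 (ltW tc) (ltW c2)); apply: Wm.
    - exact: le_trans t1.
    - exact: ltW.
    - by rewrite (le_trans (ltW c2)).
  have h := enorm_le_coord r0 cmp.
  apply: (@le_trans _ _ ((d%:R * rint a b m) ^+ 2)).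
    by rewrite lerXn2r ?nnegrE ?enorm_ge0 ?mulr_ge0.
  by rewrite exprMn ler_wpM2l ?sqr_ge0// rint_sqr_le// ltW.
rewrite (rint_sum hB).
(* Integrating over element [k] gives a second factor of its length, hence mesh^2. The integral of
   m^2 over the element is written as a difference so that the sum telescopes. *)
apply: (@le_trans _ _ (\sum_(k < size s) (d%:R * mesh s) ^+ 2 *
    (rint 0 (node s k.+1) (fun t => m t ^+ 2) - rint 0 (node s k) (fun t => m t ^+ 2)))).
  apply: ler_sum => k _.
  have ab : node s k < node s k.+1 by exact: node_lt.
  have a0 : 0 <= node s k by exact/node_ge0/ltnW.
  have bT : node s k.+1 <= T by exact: node_leT.
  have ab' := ltW ab.
  rewrite rint_ind ?rint_cst//; last exact: L1_cst.
  rewrite (@rint_cat _ 0 (node s k) (node s k.+1))//; last by apply: L1S hm.2.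
  rewrite addrAC subrr add0r /B exprMn.
  set q := rint (node s k) _ _; set h := node s k.+1 - node s k.
  have q0 : 0 <= q by apply: rint_ge0 => x _; exact: sqr_ge0.
  have h0 : 0 <= h by rewrite subr_ge0.
  rewrite (_ : _ * h = d%:R ^+ 2 * (h ^+ 2) * q); last by ring.
  rewrite ler_wpM2r// ler_wpM2l ?sqr_ge0// lerXn2r ?nnegrE//.
  exact: node_mesh.
rewrite -big_distrr/= -(big_mkord xpredT (fun k => rint 0 (node s k.+1) (fun t => m t ^+ 2) -
  rint 0 (node s k) (fun t => m t ^+ 2))) telescope_sumr// node_last.
by rewrite [X in _ - X](rint_nil _ (lexx _)) subr0.
Qed.

(** The error vanishes at 0, so its maximum is controlled by its derivative. This gives only first
    order in the mesh, which is enough: in the duality argument it is multiplied by another small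
    factor. *)
Lemma interp_error w W (k : R) t : is_C1 w W -> t \in `[0, T] ->
  L2norm T (fun t => W t - dinterp w t) <= k ->
  enorm (w t - interp w t) <= Num.sqrt T * k.
Proof.
move=> hw tT hk; have [h1 h2] := C1_H1 hw.
have [h3 h4] := H1_intro T0 (interp_P1 w).1 (dinterp_in_L2 w) (interp_weak_derivative w).
have [h5 h6] := H1_sub T0 h1 h3.
have := enorm_sup_le T0 h5 tT; rewrite /= interp0 subrr enorm0 add0r.
move=> /le_trans; apply; rewrite ler_wpM2l ?sqrtr_ge0//; apply: le_trans hk.
rewrite (@ae_L2norm _ _ _ _ (fun t => W t - dinterp w t))//.
- exact: (H1_wderiv h5).1.
- by apply: in_L2B; [apply: in_L2_cont; case: hw|exact: dinterp_in_L2].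
- apply: aeS2 h6 (aeS2 (fun t a b => conj a b) h2 h4) => x a [b c] xT.
  by rewrite a// b// c.
Qed.

End Interpolation.

(** * Smooth maps on boxes *)

Section SmoothMaps.
Context {R : realType} {d : nat}.
Implicit Types (G F : 'rV[R]_d -> 'rV[R]_d) (x y v : 'rV[R]_d) (rho : R).

(** A closed cube is compact and convex: derivatives are bounded on it, and it contains the segments
    to which the mean value theorem is applied. *)
Definition box rho x : Prop := forall i, `|x 0 i| <= rho.

Lemma enorm_box rho x : enorm x <= rho -> box rho x.
Proof. by move=> h i; rewrite (le_trans (coord_le_enorm _ _)). Qed.

Lemma box_bound rho (g : 'rV[R]_d -> R) : continuous g ->
  exists2 K, 0 <= K & forall x, box rho x -> `|g x| <= K.
Proof.
move=> cg; have cb : compact [set x : 'rV[R]_d | forall i, `[(- rho), rho]%classic (x ord0 i)].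
  exact: (@rV_compact R d (fun=> `[(- rho), rho]%classic) (fun=> @segment_compact R (- rho) rho)).
have /compact_bounded[M [Mr HM]] := continuous_compact (continuous_subspaceT cg) cb.
exists (`|M| + 1); first by rewrite addr_ge0.
move=> x bx; apply: HM; first by rewrite (le_lt_trans (ler_norm _))// ltrDl.
by exists x => // i /=; have := bx i; rewrite in_itv/= ler_norml.
Qed.

Lemma box_segment rho x y (s : R) : box rho x -> box rho y -> 0 <= s -> s <= 1 ->
  box rho (x + s *: (y - x)).
Proof.
move=> bx byy s0 s1 i; rewrite !mxE; have := bx i; have := byy i.
by rewrite !ler_norml => /andP[h1 h2] /andP[h3 h4]; apply/andP; split; nra.
Qed.

Lemma is_derive_segment G x v i (s : R) : (forall x, differentiable G x) ->
  is_derive s 1 (fun s => G (x + s *: v) 0 i) ('D_v G (x + s *: v) 0 i).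
Proof.
move=> dG; set p := x + s *: v.
have dv : derivable G p v by apply: diff_derivable; exact: dG.
have /derivable_mxP/(_ 0 i) dvi := dv.
rewrite (derive_mx dv) mxE.
have E : (fun h : R => h^-1 *: (G (x + (h *: 1 + s) *: v) 0 i - G (x + s *: v) 0 i)) =
    (fun h : R => h^-1 *: (G (h *: v + p) 0 i - G p 0 i)).
  apply/funext => h; congr (_ *: (G _ 0 i - _)).
  by rewrite /p scalerDl [h *: 1](mulr1 h) addrCA.
by apply: DeriveDef; [rewrite /derivable /= E|rewrite /derive /= E].
Qed.

Lemma jacobianE F x v : differentiable F x -> 'D_v F x = v *m 'J F x.
Proof. exact: deriveEjacobian. Qed.

Lemma derive_sum_coord G p v : differentiable G p ->
  'D_v G p = \sum_j v 0 j *: 'D_(delta_mx 0 j) G p.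
Proof.
move=> dG; rewrite deriveEjacobian// {1}(row_sum_delta v) mulmx_suml.
by apply: eq_bigr => j _; rewrite deriveEjacobian// scalemxAl.
Qed.

(* the mean value theorem on segments, coordinate by coordinate *)
Lemma box_lipschitz G rho : (forall x, differentiable G x) ->
  (forall v, continuous (fun x => 'D_v G x)) ->
  exists2 L, 0 <= L & forall x y, box rho x -> box rho y ->
    enorm (G y - G x) <= L * enorm (y - x).
Proof.
move=> dG cG.
have H (ij : 'I_d * 'I_d) : exists K, 0 <= K /\
    forall x, box rho x -> `|'D_(delta_mx 0 ij.2) G x 0 ij.1| <= K.
  have [K K0 HK] := @box_bound rho (fun x => 'D_(delta_mx 0 ij.2) G x 0 ij.1)
    (fun x => continuous_comp (cG _ x) (@coord_continuous _ _ _ _ _ _)).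
  by exists K.
have [K HK] := choice H.
pose S := \sum_i \sum_j K (i, j).
have S0 : 0 <= S by apply: sumr_ge0 => i _; apply: sumr_ge0 => j _; have [] := HK (i, j).
exists (d%:R * S); first by rewrite mulr_ge0.
move=> x y bx byy; rewrite -mulrA; apply: enorm_le_coord.
  by rewrite mulr_ge0 ?enorm_ge0.
move=> i; have dg s := @is_derive_segment G x (y - x) i s dG.
have cg : {within `[0, 1], continuous (fun s : R => G (x + s *: (y - x)) 0 i)}.
  by apply: cont_within => s; exact: der_cont (dg s).
have [c c01 Ec] := MVT ltr01 (fun s _ => dg s) cg.
move: Ec; rewrite subr0 mulr1 scale1r [x + (y - x)]addrC subrK scale0r addr0 => Ec.
rewrite mxE [in X in _ + X]mxE Ec (derive_sum_coord _ (dG _)).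
rewrite summxE (le_trans (ler_norm_sum _ _ _))//.
move: c01; rewrite in_itv/= => /andP[c0 c1].
have bc := box_segment bx byy (ltW c0) (ltW c1).
apply: (@le_trans _ _ (\sum_j K (i, j) * enorm (y - x))).
  apply: ler_sum => j _; rewrite mxE normrM mulrC ler_pM//; last exact: coord_le_enorm.
  by have [_] := HK (i, j); exact.
rewrite -big_distrl/= ler_wpM2r ?enorm_ge0// /S [leRHS](bigD1 i)//= lerDl.
by apply: sumr_ge0 => k _; apply: sumr_ge0 => j _; have [] := HK (k, j).
Qed.

Lemma class_C_continuous k F : class_C k F -> continuous F.
Proof.
by case: k => // k [h _] x; exact: differentiable_continuous.
Qed.

Lemma jacobian_continuous F i j : class_C 1 F -> continuous (fun x => 'J F x i j).
Proof.
move=> [dF cF]; have -> : (fun x => 'J F x i j) = (fun x => 'D_(delta_mx 0 i) F x 0 j).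
  apply/funext => x; rewrite (jacobianE _ (dF x)) -rowE.
  by rewrite [RHS]mxE.
move=> x; apply: (@continuous_comp _ _ _ (fun x => 'D_(delta_mx 0 i) F x) (fun v : 'rV[R]_d => v 0 j)).
  exact: cF.
exact: coord_continuous.
Qed.

(** The Taylor remainder is treated one coordinate at a time: the mean value theorem puts DF at an
    intermediate point of the segment, and DF is Lipschitz. A single constant for the three bounds
    keeps later constants short. *)
Lemma box_C2_bounds F rho : class_C 2 F ->
  exists2 L, 0 <= L &
   [/\ forall x y, box rho x -> box rho y -> enorm (F y - F x) <= L * enorm (y - x),
       forall x y v, box rho x -> box rho y ->
         enorm (v *m 'J F y - v *m 'J F x) <= L * enorm (y - x) * enorm v &
       forall x y, box rho x -> box rho y ->
         enorm (F y - F x - (y - x) *m 'J F x) <= L * enorm (y - x) ^+ 2].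
Proof.
move=> [dF cF].
have cdF v : continuous (fun x => 'D_v F x) by exact: (@class_C_continuous 1).
have [L1 L10 HL1] := box_lipschitz rho dF cdF.
have H (j : 'I_d) : exists K, 0 <= K /\ forall x y, box rho x -> box rho y ->
    enorm ('D_(delta_mx 0 j) F y - 'D_(delta_mx 0 j) F x) <= K * enorm (y - x).
  have [h1 h2] := cF (delta_mx 0 j).
  by have [K K0 HK] := box_lipschitz rho h1 h2; exists K.
have [K HK] := choice H.
pose S := \sum_j K j.
have S0 : 0 <= S by apply: sumr_ge0 => j _; have [] := HK j.
have tri n (f : 'I_n -> 'rV[R]_d) : enorm (\sum_i f i) <= \sum_i enorm (f i).
  elim: n f => [|n IH] f; first by rewrite !big_ord0 enorm0.
  by rewrite !big_ord_recr/= (le_trans (enormD _ _))// lerD2r.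
have HJ x y v : box rho x -> box rho y ->
    enorm (v *m 'J F y - v *m 'J F x) <= S * enorm (y - x) * enorm v.
  move=> bx byy.
  have E z : v *m 'J F z = \sum_j v 0 j *: 'D_(delta_mx 0 j) F z.
    by rewrite -derive_sum_coord; [apply/esym/jacobianE; exact: dF|exact: dF].
  move: (E x) (E y); move: ('J F x) ('J F y) => Jx Jy -> ->.
  rewrite -sumrB; apply: (le_trans (tri _ _)).
  rewrite /S -mulrA big_distrl/=; apply: ler_sum => j _.
  rewrite -scalerBr enormZ mulrA mulrC ler_pM ?enorm_ge0//; last exact: coord_le_enorm.
  by have [_] := HK j; apply.
(* [L1] serves F, [S] serves DF, and [d * S] the Taylor remainder assembled from its coordinates. *)
pose L := L1 + (d%:R + 1) * S.
have dS : 0 <= d%:R * S by rewrite mulr_ge0.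
exists L; first by rewrite addr_ge0// mulr_ge0// addr_ge0.
split=> [x y bx byy|x y v bx byy|x y bx byy].
- apply: (le_trans (HL1 _ _ bx byy)); rewrite ler_wpM2r ?enorm_ge0// /L; nra.
- apply: (le_trans (HJ _ _ v bx byy)); rewrite ler_wpM2r ?enorm_ge0// ler_wpM2r ?enorm_ge0// /L; nra.
- apply: (@le_trans _ _ (d%:R * (S * enorm (y - x) ^+ 2))); last first.
    rewrite mulrA ler_wpM2r ?sqr_ge0// /L; nra.
  apply: enorm_le_coord => [|i]; first by rewrite mulr_ge0 ?sqr_ge0.
  have dg s := @is_derive_segment F x (y - x) i s dF.
  have cg : {within `[0, 1], continuous (fun s : R => F (x + s *: (y - x)) 0 i)}.
    by apply: cont_within => s; exact: der_cont (dg s).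
  have [c c01 Ec] := MVT ltr01 (fun s _ => dg s) cg.
  move: Ec; rewrite subr0 mulr1 scale1r [x + (y - x)]addrC subrK scale0r addr0 => Ec.
  move: c01; rewrite in_itv/= => /andP[c0 c1].
  have bc := box_segment bx byy (ltW c0) (ltW c1).
  have EJ := jacobianE (y - x) (dF (x + c *: (y - x))).
  have HJc := HJ _ _ (y - x) bx bc.
  move: EJ HJc; move: ('J F x) ('J F (x + c *: (y - x))) => Jx Jc EJ HJc.
  have -> : (F y - F x - (y - x) *m Jx) 0 i = ((y - x) *m Jc - (y - x) *m Jx) 0 i.
    by rewrite -EJ [LHS]mxE [RHS]mxE; congr (_ + _); rewrite mxE [in X in _ + X]mxE.
  apply: (le_trans (coord_le_enorm _ _)); apply: (le_trans HJc).
  rewrite addrC addKr enormZ -mulrA ler_wpM2l// expr2 ler_wpM2r ?enorm_ge0//.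
  by rewrite ler_piMl ?enorm_ge0// ger0_norm ltW.
Qed.

End SmoothMaps.

(** * Linear differential equations *)

Section LinearODE.
Context {R : realType} {d : nat}.
Variable T : R.
Hypothesis T0 : 0 < T.
Implicit Types (u x y X b : R -> 'rV[R]_d) (A : R -> 'M[R]_d) (q e s t : R).

Lemma continuous_enorm u : (forall i, continuous (fun t => u t 0 i)) ->
  continuous (fun t => enorm (u t)).
Proof.
move=> cu t; apply: (@continuous_comp _ _ _ (fun t => dot (u t) (u t)) (@Num.sqrt R)).
  have := @continuous_vsum _ R d (fun i t => u t 0 i * u t 0 i); apply => i s.
  by apply: cvgM; exact: cu.
exact: sqrt_continuous.
Qed.

Lemma continuous_mulmx u A i : (forall i, continuous (fun t => u t 0 i)) ->
  (forall i j, continuous (fun t => A t i j)) -> continuous (fun t => (u t *m A t) 0 i).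
Proof.
move=> cu cA t; under eq_fun do rewrite mxE.
have := @continuous_vsum _ R d (fun j t => u t 0 j * A t j i); apply => j s.
by apply: cvgM; [exact: cu|exact: cA].
Qed.

Lemma continuous_rowD u b i : (forall i, continuous (fun t => u t 0 i)) ->
  (forall i, continuous (fun t => b t 0 i)) -> continuous (fun t => (u t + b t) 0 i).
Proof.
by move=> cu cb t; under eq_fun do rewrite mxE; apply: cvgD; [exact: cu|exact: cb].
Qed.

Lemma C1_enorm_le x X s t : is_C1 x X -> s <= t ->
  enorm (x t - x s) <= rint s t (fun r => enorm (X r)).
Proof.
move=> [dx cX] st; have -> : x t - x s = vint s t X.
  by apply/rowP => i; rewrite !mxE (rint_derive st (dx i) (cX i)).
apply: enorm_vint; first by move=> i; exact: cont_L1.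
by apply: cont_L1; exact: continuous_enorm.
Qed.

(** Written with [primitive] rather than an integral from 0 to t, so that the iterates are C^1 on
    the whole line. *)
Fixpoint picard A b (x0 : 'rV[R]_d) (n : nat) t : 'rV[R]_d :=
  if n is n'.+1 then
    \row_i (x0 0 i + primitive (fun s => (picard A b x0 n' s *m A s + b s) 0 i) t)
  else x0.

Section Picard.
Variables (A : R -> 'M[R]_d) (b : R -> 'rV[R]_d) (x0 : 'rV[R]_d) (q : R).
Hypothesis cA : forall i j, continuous (fun t => A t i j).
Hypothesis cb : forall i, continuous (fun t => b t 0 i).
Hypothesis q0 : 0 <= q.
Hypothesis qA : forall t v, enorm (v *m A t) <= q * enorm v.
Hypothesis qT : T * q <= 2^-1.
Let B0 := enorm x0 + rint 0 T (fun t => enorm (b t)).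
Let pic := picard A b x0.

Lemma picard_coord_continuous n i : continuous (fun t => pic n t 0 i).
Proof.
elim: n i => [|n IH] i t; first exact: cvg_cst.
rewrite /pic/=; under eq_fun do rewrite mxE.
apply: cvgD; first exact: cvg_cst.
have ci : continuous (fun s => (pic n s *m A s + b s) 0 i).
  by apply: continuous_rowD => // j; exact: continuous_mulmx.
exact: der_cont (is_derive_primitive t ci).
Qed.

Lemma picard_C1 n : is_C1 (pic n.+1) (fun t => pic n t *m A t + b t).
Proof.
have ci i : continuous (fun s => (pic n s *m A s + b s) 0 i).
  apply: continuous_rowD => // j; apply: continuous_mulmx => // k.
  exact: picard_coord_continuous.
split => // i t.
have -> : (fun t => pic n.+1 t 0 i) =
    (fun t => x0 0 i + primitive (fun s => (pic n s *m A s + b s) 0 i) t).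
  by apply/funext => s; rewrite /pic/= mxE.
have := derD (is_derive_cst (x0 0 i) t 1) (is_derive_primitive t (ci i)).
by rewrite add0r.
Qed.

Lemma picard0 n : pic n 0 = x0.
Proof.
case: n => // n; apply/rowP => i; rewrite /pic/= mxE /primitive subrr addr0.
by [].
Qed.

Let Ib t : 0 <= t -> t <= T -> 0 <= rint 0 t (fun s => enorm (b s)) <= rint 0 T (fun s => enorm (b s)).
Proof.
move=> t0 tT; rewrite rint_ge0 ?rint_mono//=.
- by apply: cont_L1; exact: continuous_enorm.
- by move=> s _; exact: enorm_ge0.
- by move=> s _; exact: enorm_ge0.
Qed.

Let B00 : 0 <= B0.
Proof. by rewrite addr_ge0 ?enorm_ge0//; have /andP[] := Ib (ltW T0) (lexx T). Qed.

(** The bound 2 B0 reproduces itself: the integral of |x_n A| is at most T q (2 B0) <= B0, and the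
    initial value with the source contributes another B0. *)
Lemma picard_bound n t : t \in `[0, T] -> enorm (pic n t) <= 2 * B0.
Proof.
elim: n t => [|n IH] t.
  move=> _; rewrite /pic/=; have /andP[+ _] := Ib (ltW T0) (lexx T).
  by rewrite /B0; have := enorm_ge0 x0; lra.
rewrite in_itv/= => /andP[t0 tT].
have := C1_enorm_le (picard_C1 n) t0; rewrite picard0 => h.
rewrite -[pic n.+1 t](subrK x0) (le_trans (enormD _ _))//.
have cn i := @picard_coord_continuous n i.
have : rint 0 t (fun r => enorm (pic n r *m A r + b r)) <=
    rint 0 t (fun r => q * (2 * B0) + enorm (b r)).
  apply: rint_le => [||r]; [apply: cont_L1|apply: L1D|].
  - by apply: continuous_enorm => i; apply: continuous_rowD => // j; exact: continuous_mulmx.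
  - exact: L1_cst.
  - by apply: cont_L1; exact: continuous_enorm.
  rewrite in_itv/= => /andP[r0 rt]; rewrite (le_trans (enormD _ _))// lerD2r.
  rewrite (le_trans (qA _ _))// ler_wpM2l// IH// in_itv/= ltW//=.
  by rewrite (le_trans (ltW rt)).
rewrite rintD ?rint_cst//; [|exact: L1_cst|by apply: cont_L1; exact: continuous_enorm].
have /andP[_ hb] := Ib t0 tT; move: h hb; rewrite /B0.
have : q * (2 * B0) * (t - 0) <= B0.
  rewrite subr0; apply: (@le_trans _ _ (q * (2 * B0) * T)); first by rewrite ler_wpM2l ?mulr_ge0.
  have H : T * q * B0 <= 2^-1 * B0 by exact: ler_wpM2r.
  rewrite [leLHS](_ : _ = 2 * (T * q * B0)); last by ring.
  by apply: (le_trans (ler_wpM2l (ler0n _ 2) H)); rewrite mulrA divff ?mul1r.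
rewrite /B0; set I1 := rint 0 t (fun r => enorm (pic n r *m A r + b r)).
by set I2 := rint 0 t _; set I3 := rint 0 T _; move=> *; lra.
Qed.

(** The Picard map contracts by T q <= 1/2 in the maximum norm; 4 B0 is twice the uniform bound on
    the iterates. *)
Lemma picard_cauchy n t : t \in `[0, T] ->
  enorm (pic n.+1 t - pic n t) <= 2^-1 ^+ n * (4 * B0).
Proof.
elim: n t => [|n IH] t tT.
  rewrite expr0 mul1r (le_trans (enormB _ _))//.
  by have := picard_bound 1 tT; have := picard_bound 0 tT; lra.
have h : is_C1 (fun t => pic n.+2 t - pic n.+1 t) (fun t => (pic n.+1 t - pic n t) *m A t).
  have [d1 c1] := picard_C1 n.+1; have [d2 c2] := picard_C1 n.
  have E i s : ((pic n.+1 s - pic n s) *m A s) 0 i =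
      (pic n.+1 s *m A s + b s) 0 i - (pic n s *m A s + b s) 0 i.
    by rewrite mulmxBl !mxE; ring.
  split=> [i s|i s].
    rewrite E; have := derB (d1 i s) (d2 i s).
    by congr (is_derive _ _ _ _); apply/funext => r; rewrite !mxE.
  by under eq_fun do rewrite E; apply: cvgB; [exact: c1|exact: c2].
move: (tT); rewrite in_itv/= => /andP[t0 tT'].
have := C1_enorm_le h t0; rewrite !picard0 subrr subr0 => /le_trans; apply.
set D := 2^-1 ^+ n * (4 * B0) in IH *.
have D0 : 0 <= D by rewrite mulr_ge0 ?exprn_ge0// mulr_ge0.
apply: (@le_trans _ _ (rint 0 t (fun=> q * D))).
  apply: rint_le => [||s]; [|exact: L1_cst|].
    by apply: cont_L1; apply: continuous_enorm; case: h.
  rewrite in_itv/= => /andP[s0 st]; rewrite (le_trans (qA _ _))// ler_wpM2l// IH//.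
  by rewrite in_itv/= ltW//= (le_trans (ltW st)).
rewrite rint_cst// subr0.
apply: (@le_trans _ _ (q * D * T)); first by rewrite ler_wpM2l ?mulr_ge0.
rewrite exprS -[leRHS]mulrA -/D [leLHS](_ : _ = T * q * D); last by ring.
exact: ler_wpM2r.
Qed.

(* y is the Picard iterate preceding x *)
Lemma approx_linear_ode e : 0 < e -> exists x y Y,
  [/\ is_C1 x (fun t => y t *m A t + b t), is_C1 y Y, x 0 = x0 &
      forall t, t \in `[0, T] ->
      [/\ enorm (x t - y t) <= e, enorm (x t) <= 2 * B0, enorm (y t) <= 2 * B0 &
          enorm (Y t) <= q * (2 * B0) + enorm (b t)]].
Proof.
move=> e0.
have [n Hn] : exists n, 2^-1 ^+ n * (4 * B0) <= e.
  have h : (2^-1 : R) ^+ n @[n --> \oo] --> (0 : R).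
    by apply: cvg_expr; rewrite ger0_norm// invf_lt1// ltr1n.
  have B4 : 0 < 4 * B0 + 1 by rewrite ltr_wpDl// mulr_ge0.
  have /cvgrPdist_le/(_ _ (divr_gt0 e0 B4))[N _ /(_ N (leqnn _))/=] := h.
  rewrite sub0r normrN ger0_norm ?exprn_ge0// => hN; exists N.
  rewrite ler_pdivlMr// in hN; apply: le_trans hN.
  by rewrite ler_wpM2l ?exprn_ge0// lerDl.
(* [y] must itself be C^1 with a bounded derivative, so a third iterate is needed to express that
   derivative; hence the shift by two. *)
exists (pic n.+2), (pic n.+1), (fun t => pic n t *m A t + b t).
split; [exact: picard_C1|exact: picard_C1|exact: picard0|move=> t tT; split].
- apply: (le_trans (picard_cauchy n.+1 tT)); apply: le_trans Hn.
  rewrite ler_wpM2r ?mulr_ge0// exprS ler_piMl ?exprn_ge0// invf_le1//.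
  by rewrite ler1n.
- exact: picard_bound.
- exact: picard_bound.
- rewrite (le_trans (enormD _ _))// lerD2r (le_trans (qA _ _))// ler_wpM2l//.
  exact: picard_bound.
Qed.

End Picard.

Lemma rint_reflect (f : R -> R) : continuous f ->
  rint 0 T (fun t => f (T - t)) = rint 0 T f.
Proof.
move=> cf; pose G t := - primitive f (-1 * t + T).
have dG (t : R) : is_derive t 1 G (f (-1 * t + T)).
  have := derZ (-1) (der_affine (is_derive_primitive (-1 * t + T) cf)).
  rewrite !mulN1r opprK; congr (is_derive _ _ _ _).
  by apply/funext => s; rewrite /G !mulN1r.
transitivity (rint 0 T (fun t => f (-1 * t + T))).
  by apply: eq_rint => t _; rewrite mulN1r addrC.
rewrite (rint_derive (ltW T0) dG); last exact: continuous_comp_affine.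
rewrite (rint_primitive cf (ltW T0)) /G mulN1r addNr mulr0 add0r.
by rewrite opprK addrC.
Qed.

End LinearODE.

(** * Duality *)

Section Duality.
Context {R : realType} {d : nat}.
Variables (T q LM : R) (M : R -> 'M[R]_d) (e : R -> 'rV[R]_d) (s : seq R).
Hypothesis T0 : 0 < T.
Hypothesis part : itv_partition 0 T s.
Hypothesis cM : forall i j, continuous (fun t => M t i j).
Hypothesis q0 : 0 <= q.
Hypothesis qM : forall t v, enorm (v *m M t) <= q * enorm v.
Hypothesis qT : T * q <= 2^-1.
Hypothesis LM0 : 0 <= LM.
Hypothesis HLM : forall x y v, 0 <= x -> x <= y -> y <= T ->
  enorm (v *m M y - v *m M x) <= LM * (y - x) * enorm v.
Hypothesis he : H1 T e.
Hypothesis ce : forall i, continuous (fun t => e t 0 i).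

Let E1 := rint 0 T (fun t => enorm (e t)).
(** Bound for w: twice |p(0)| + int |p|, where |p| <= 2 E1. *)
Let K := 4 * (1 + T) * E1.

Let E10 : 0 <= E1.
Proof. by apply: rint_ge0 => t _; exact: enorm_ge0. Qed.

Let reflect_continuous (f : R -> R) : continuous f -> continuous (fun t => f (T - t)).
Proof.
move=> cf; have -> : (fun t => f (T - t)) = (fun t => f (-1 * t + T)).
  by apply/funext => t; rewrite mulN1r addrC.
exact: continuous_comp_affine.
Qed.

Let reflect_in t : t \in `[0, T] -> T - t \in `[0, T].
Proof. by rewrite !in_itv/= => /andP[t0 tT]; apply/andP; split; lra. Qed.

(* p' = - p M^T - e, p(T) = 0 and w' = w M + p, w(0) = p(0), up to eps *)
Lemma dual_problem eps : 0 < eps -> exists p ph w wh Wh : R -> 'rV[R]_d,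
  [/\ is_C1 p (fun t => - (ph t *m (M t)^T + e t)), p T = 0,
      is_C1 w (fun t => wh t *m M t + p t), is_C1 wh Wh & w 0 = p 0] /\
  (forall i, continuous (fun t => ph t 0 i)) /\
  forall t, t \in `[0, T] ->
    [/\ enorm (p t - ph t) <= eps, enorm (p t) <= 2 * E1 & enorm (ph t) <= 2 * E1] /\
    [/\ enorm (w t - wh t) <= eps, enorm (w t) <= K, enorm (wh t) <= K &
        enorm (Wh t) <= q * K + 2 * E1].
Proof.
move=> eps0.
(* The equation for p runs backwards from p(T) = 0; with x(t) = p(T - t) it becomes x' = x M(T -
   t)^T + e(T - t), x(0) = 0. *)
have cMT i j : continuous (fun t => (M (T - t))^T i j).
  by under eq_fun do rewrite mxE; exact: (@reflect_continuous (fun t => M t j i)).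
have [x [y [Y [hx hy x00 Hx]]]] := @approx_linear_ode R d T T0 (fun t => (M (T - t))^T)
  (fun t => e (T - t)) 0 q
  cMT
  (fun i => @reflect_continuous (fun t => e t 0 i) (@ce i)) q0
  (fun t v => enorm_mulmx_tr v (qM (T - t))) qT eps eps0.
have EE : rint 0 T (fun t => enorm (e (T - t))) = E1.
  exact: (@rint_reflect _ _ T0 _ (continuous_enorm ce)).
rewrite enorm0 add0r EE in Hx.
pose p t := x (T - t); pose ph t := y (T - t).
have cph i : continuous (fun t => ph t 0 i).
  apply: (@reflect_continuous (fun t => y t 0 i)); exact: is_C1_coord_continuous hy.
have hp : is_C1 p (fun t => - (ph t *m (M t)^T + e t)).
  split=> [i t|i].
    have [hd _] := hx.
    have := @der_affine _ (fun t => x t 0 i) t (-1) T _ (hd i (-1 * t + T)).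
    rewrite mulN1r; have -> : - t + T = T - t by rewrite addrC.
    rewrite subKr mulN1r mxE.
    have -> : (fun r => x (-1 * r + T) 0 i) = (fun r => p r 0 i).
      by apply/funext => r; rewrite mulN1r addrC.
    by move=> h; apply: (is_derive_eq h); rewrite [RHS]mxE [in RHS]mxE.
  under eq_fun do rewrite mxE; move=> t; apply: cvgN.
  apply: continuous_rowD => // j; apply: continuous_mulmx => // k l.
  by under eq_fun do rewrite mxE; exact: cM.
have cp i : continuous (fun t => p t 0 i) by exact: is_C1_coord_continuous hp.
have pE t : t \in `[0, T] -> [/\ enorm (p t - ph t) <= eps, enorm (p t) <= 2 * E1 & enorm (ph t) <= 2 * E1].
  by move=> /reflect_in/Hx[].
have [w [wh [Wh [hw hwh w0 Hw]]]] := @approx_linear_ode R d T T0 M p (p 0) q cM cp q0 qM qT eps eps0.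
have T0in : 0 \in `[0, T] by rewrite in_itv/= lexx ltW.
have BK : 2 * (enorm (p 0) + rint 0 T (fun t => enorm (p t))) <= K.
  have [_ h1 _] := pE _ T0in.
  have h2 : rint 0 T (fun t => enorm (p t)) <= 2 * E1 * T.
    rewrite -[X in _ * X]subr0 -(rint_cst _ (ltW T0)); apply: rint_le.
    - by apply: cont_L1; exact: continuous_enorm.
    - exact: L1_cst.
    - by move=> t /in_oo_cc/pE[].
  rewrite /K; move: h1 h2; set a := enorm _; set b := rint 0 T _.
  by clearbody E1 a b; lra.
exists p, ph, w, wh, Wh; split; first by split => //; rewrite /p subrr.
split => // t tT; split; first exact: pE.
have [h1 h2 h3 h4] := Hw t tT; have [_ h5 _] := pE t tT.
split => //; [exact: le_trans BK|exact: le_trans BK|].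
by rewrite (le_trans h4)// lerD// ler_wpM2l.
Qed.

Let n := L2norm T e.

Let E1n : E1 <= Num.sqrt T * n.
Proof.
rewrite -(@ler_pXn2r _ 2)// ?nnegrE ?mulr_ge0 ?sqrtr_ge0 ?L2norm_ge0//.
rewrite exprMn (sqr_sqrtr (ltW T0)) L2norm_sqr_rint.
have := rint_sqr_le (ltW T0) (enorm_L2 (H1_in_L2 he)).
by rewrite subr0.
Qed.

(** Integrating <e', p> by parts, p(T) = 0 removes the end term, w(0) = p(0) cancels the initial
    one, and the source of p produces |e|^2. The last two terms measure how far [ph] and [wh] are
    from p and w. *)
Lemma dual_identity (p ph w wh : R -> 'rV[R]_d) : is_C1 p (fun t => - (ph t *m (M t)^T + e t)) -> p T = 0 ->
  (forall i, continuous (fun t => ph t 0 i)) ->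
  (forall i, continuous (fun t => w t 0 i)) ->
  (forall i, continuous (fun t => wh t 0 i)) -> w 0 = p 0 ->
  L2dot T (fun t => wderiv T e t - e t *m M t) (fun t => wh t *m M t + p t - w t *m M t) +
  dot (e 0) (w 0) =
  L2dot T e e + L2dot T e (fun t => (ph t - p t) *m (M t)^T) +
  L2dot T (fun t => wderiv T e t - e t *m M t) (fun t => (wh t - w t) *m M t).
Proof.
move=> hp pT cph cw cwh w0.
have cp i : continuous (fun t => p t 0 i) by exact: is_C1_coord_continuous hp.
have cMt i j : continuous (fun t => (M t)^T i j).
  by under eq_fun do rewrite mxE; exact: cM.
have L2p := @in_L2_cont _ _ T _ cp; have L2ph := @in_L2_cont _ _ T _ cph.
have L2w := @in_L2_cont _ _ T _ cw; have L2wh := @in_L2_cont _ _ T _ cwh.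
have L2e := H1_in_L2 he; have [L2E _] := H1_wderiv he.
have L2eM : in_L2 T (fun t => e t *m M t) by exact: in_L2_mulmx.
have L2G : in_L2 T (fun t => wderiv T e t - e t *m M t) by exact: in_L2B.
have L2pM : in_L2 T (fun t => p t *m (M t)^T) by exact: in_L2_mulmx.
have L2phM : in_L2 T (fun t => ph t *m (M t)^T) by exact: in_L2_mulmx.
have -> : (fun t => wh t *m M t + p t - w t *m M t) = (fun t => p t + (wh t - w t) *m M t).
  by apply/funext => t; rewrite mulmxBl [wh t *m M t + _]addrC addrA.
rewrite L2dotDr//; last by apply: in_L2_mulmx => //; exact: in_L2B.
rewrite L2dotBl//.
have ibp := @H1_L2dot_ibp _ _ T T0 e p _ he hp.1 hp.2.
rewrite pT dot0r sub0r in ibp.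
have e1 : L2dot T e (fun t => - (ph t *m (M t)^T + e t)) =
    - (L2dot T e (fun t => ph t *m (M t)^T) + L2dot T e e).
  rewrite -L2dotDr// -mulN1r -L2dotZr//; last exact: in_L2D.
  by apply: eq_rint => t _; rewrite scaleN1r.
have e2 : L2dot T (fun t => e t *m M t) p = L2dot T e (fun t => p t *m (M t)^T).
  by apply: eq_rint => t _; rewrite dot_mulmx.
have e3 : L2dot T e (fun t => (ph t - p t) *m (M t)^T) =
    L2dot T e (fun t => ph t *m (M t)^T) - L2dot T e (fun t => p t *m (M t)^T).
  by rewrite -L2dotBr//; apply: eq_rint => t _; rewrite mulmxBl.
by rewrite ibp e1 e2 e3 w0; ring.
Qed.

Let sT := Num.sqrt T.
(** All constants are relative to n, using E1 <= sqrt T n: [k1 * n] bounds w, [c1 * n] is the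
    constant part of the majorant for the increments of w', and [Cm * n] bounds the L^2 norm of that
    majorant. *)
Let k1 := 4 * (1 + T) * sT.
Let c1 := 2 * q * sT + q * (q * k1 + 2 * sT) + k1 * LM.
Let Cm := Num.sqrt (2 * T * c1 ^+ 2 + 2).

(** The three groups come from the derivative of the interpolant of w, from the interpolant itself,
    and from the interpolation error. *)
Definition duality_constant : R :=
  (sT * (q * k1 + 2 * sT) + d%:R * T * Cm) + (sT * k1 + T * d%:R * T * Cm) + (1 + q * T) * d%:R * Cm.

Lemma duality_constant_ge0 : 0 <= duality_constant.
Proof.
have h1 : 0 <= sT by exact: sqrtr_ge0.
have h2 : 0 <= k1 by rewrite /k1 !mulr_ge0// addr_ge0// ltW.
have h3 : 0 <= Cm by exact: sqrtr_ge0.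
have T0' := ltW T0.
by rewrite /duality_constant !(addr_ge0, mulr_ge0).
Qed.

(** [kappa] measures the defect in Galerkin orthogonality and will be of order h^2, [eta] will be of
    order h. Testing with the interpolant of w costs [kappa]; the interpolation error contributes
    the product [eta * mesh s]. *)
Lemma duality_estimate (kappa eta : R) : 0 <= kappa ->
  L2norm T (fun t => wderiv T e t - e t *m M t) <= eta ->
  (forall w : R -> 'rV[R]_d,
     `|L2dot T (fun t => wderiv T e t - e t *m M t)
              (fun t => dinterp s w t - interp s w t *m M t) + dot (e 0) (interp s w 0)| <=
     kappa * (L2norm T (dinterp s w) + L2norm T (interp s w))) ->
  L2norm T e <= duality_constant * (kappa + eta * mesh s).
Proof.
move=> kappa0 Geta EL.
set G := (fun t => wderiv T e t - e t *m M t) in Geta EL *.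
have T0' := ltW T0.
have n0 : 0 <= n by exact: L2norm_ge0.
have sT0 : 0 <= sT by exact: sqrtr_ge0.
have k10 : 0 <= k1 by rewrite /k1 !mulr_ge0// addr_ge0.
have c10 : 0 <= c1 by rewrite /c1 !(addr_ge0, mulr_ge0).
have Cm0 : 0 <= Cm by exact: sqrtr_ge0.
have eta0 : 0 <= eta by exact: le_trans (L2norm_ge0 _ _) Geta.
have h0 := mesh_ge0 s; set h := mesh s in h0 *.
have hT : h <= T.
  apply/bigmax_leP; split => // k _.
  have := node_leT part (ltn_ord k); have := node_ge0 part (ltnW (ltn_ord k)); lra.
have L2e := H1_in_L2 he; have [L2E _] := H1_wderiv he.
have L2G : in_L2 T G by apply: in_L2B => //; exact: in_L2_mulmx.
have Kn : K <= k1 * n.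
  by rewrite /K /k1 -[leRHS]mulrA ler_wpM2l// mulr_ge0// addr_ge0.
have main eps : 0 < eps ->
    n ^+ 2 <= duality_constant * (kappa + eta * h) * n + eps * (n * (sT * q) + eta * (sT * q)).
  move=> eps0.
  have [p [ph [w [wh [Wh [[hp pT hw hwh w0] [cph bnd]]]]]]] := dual_problem eps0.
  have cw i : continuous (fun t => w t 0 i) by exact: is_C1_coord_continuous hw.
  have cwh i : continuous (fun t => wh t 0 i) by exact: is_C1_coord_continuous hwh.
  have cp i : continuous (fun t => p t 0 i) by exact: is_C1_coord_continuous hp.
  have cWh i : continuous (fun t => Wh t 0 i) by case: hwh.
  set W := (fun t => wh t *m M t + p t) in hw.
  have cW i : continuous (fun t => W t 0 i) by case: hw.
  have cMt i j : continuous (fun t => (M t)^T i j).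
    by under eq_fun do rewrite mxE; exact: cM.
  have id := dual_identity hp pT cph cw cwh w0.
  rewrite -/G -L2norm_sqr -/n in id.
  have bE t : t \in `]0, T[ -> _ := fun h => bnd t (in_oo_cc h).
  have L2w := @in_L2_cont _ _ T _ cw; have L2W := @in_L2_cont _ _ T _ cW.
  have err1 : `|L2dot T e (fun t => (ph t - p t) *m (M t)^T)| <= n * (sT * (q * eps)).
    have L2f : in_L2 T (fun t => (ph t - p t) *m (M t)^T).
      by apply: in_L2_mulmx => //; apply: in_L2B; exact: in_L2_cont.
    apply: (le_trans (L2dot_le L2e L2f)); rewrite ler_wpM2l//.
    apply: L2norm_le_cst => //; first by rewrite mulr_ge0// ltW.
    move=> t /bE[[h1 _ _] _]; apply: (le_trans (enorm_mulmx_tr _ (qM t))).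
    by rewrite ler_wpM2l// enormBC.
  have err2 : `|L2dot T G (fun t => (wh t - w t) *m M t)| <= eta * (sT * (q * eps)).
    have L2f : in_L2 T (fun t => (wh t - w t) *m M t).
      by apply: in_L2_mulmx => //; apply: in_L2B; exact: in_L2_cont.
    apply: (le_trans (L2dot_le L2G L2f)); rewrite ler_pM ?L2norm_ge0//.
    apply: L2norm_le_cst => //; first by rewrite mulr_ge0// ltW.
    move=> t /bE[_ [h1 _ _ _]]; apply: (le_trans (qM _ _)).
    by rewrite ler_wpM2l// enormBC.
  (* Majorant for the increments of W = wh M + p. The source of p contributes |e(t)|, kept pointwise
     so that only its L^2 norm n enters; a maximum of |e| would not be bounded by n. *)
  pose m t := c1 * n + enorm (e t).
  have cm : continuous m.
    by move=> t; apply: cvgD; [exact: cvg_cst|exact: continuous_enorm].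
  have m0 t : 0 <= m t by rewrite addr_ge0 ?enorm_ge0// mulr_ge0.
  have Wm x y i : 0 <= x -> x <= y -> y <= T -> `|W y 0 i - W x 0 i| <= rint x y m.
    move=> x0 xy yT.
    have in_xy t : x <= t -> t <= y -> t \in `[0, T].
      by move=> xt ty; rewrite in_itv/= (le_trans x0 xt) (le_trans ty yT).
    have -> : W y 0 i - W x 0 i = (W y - W x) 0 i by rewrite [RHS]mxE [in X in _ = _ + X]mxE.
    apply: (le_trans (coord_le_enorm _ _)).
    have -> : W y - W x = (p y - p x) + (wh y - wh x) *m M y + (wh x *m M y - wh x *m M x).
      by rewrite /W mulmxBl; apply/rowP => j; rewrite !mxE; ring.
    have cst_rint c (u : R -> 'rV[R]_d) : (forall i, continuous (fun t => u t 0 i)) ->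
        (forall t, x <= t -> t <= y -> enorm (u t) <= c) ->
        rint x y (fun t => enorm (u t)) <= c * (y - x).
      move=> cu uc; rewrite -(rint_cst _ xy); apply: rint_le.
      - by apply: cont_L1; exact: continuous_enorm.
      - exact: L1_cst.
      - by move=> t; rewrite in_itv/= => /andP[h1 h2]; apply: uc; exact: ltW.
    have b1 : enorm (p y - p x) <= q * (2 * E1) * (y - x) + rint x y (fun t => enorm (e t)).
      apply: (le_trans (C1_enorm_le hp xy)).
      rewrite -(rint_cst _ xy) -rintD; [|exact: L1_cst|by apply: cont_L1; exact: continuous_enorm].
      apply: rint_le => [||t].
      - by apply: cont_L1; apply: continuous_enorm; case: hp.
      - by apply: L1D; [exact: L1_cst|by apply: cont_L1; exact: continuous_enorm].
      rewrite in_itv/= => /andP[h1 h2].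
      have [[_ _ b] _] := bnd t (in_xy t (ltW h1) (ltW h2)).
      rewrite enormN (le_trans (enormD _ _))// lerD2r (le_trans (enorm_mulmx_tr _ (qM t)))//.
      by rewrite ler_wpM2l.
    have b2 : enorm ((wh y - wh x) *m M y) <= q * ((q * K + 2 * E1) * (y - x)).
      apply: (le_trans (qM _ _)); rewrite ler_wpM2l//.
      apply: (le_trans (C1_enorm_le hwh xy)); apply: cst_rint => // t h1 h2.
      by have [_ [_ _ _]] := bnd t (in_xy t h1 h2).
    have b3 : enorm (wh x *m M y - wh x *m M x) <= LM * (y - x) * K.
      apply: (le_trans (HLM _ x0 xy yT)); rewrite ler_wpM2l ?mulr_ge0 ?subr_ge0//.
      by have [_ [_ _ + _]] := bnd x (in_xy x (lexx x) xy).
    rewrite (le_trans (enormD _ _))// (le_trans (lerD (enormD _ _) (lexx _)))//.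
    rewrite rintD; [|exact: L1_cst|by apply: cont_L1; exact: continuous_enorm].
    rewrite rint_cst//.
    have yx0 : 0 <= y - x by rewrite subr_ge0.
    have : (q * (2 * E1) + q * (q * K + 2 * E1) + LM * K) * (y - x) <= c1 * n * (y - x).
      rewrite ler_wpM2r// /c1.
      have g1 : q * (2 * E1) <= q * (2 * (sT * n)) by rewrite !ler_wpM2l.
      have g2 : q * (q * K) <= q * (q * (k1 * n)) by rewrite !ler_wpM2l.
      have g3 : LM * K <= LM * (k1 * n) by rewrite ler_wpM2l.
      by clearbody K E1 k1 sT; lra.
    move: b1 b2 b3; set a1 := enorm _; set a2 := enorm _; set a3 := enorm _.
    set a4 := rint x y _; set z := y - x.
    by clearbody K E1 a1 a2 a3 a4 z; lra.
  have L2m : L2 0 T m by exact: cont_L2.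
  have mn : Num.sqrt (rint 0 T (fun t => m t ^+ 2)) <= Cm * n.
    rewrite -[leRHS]ger0_norm ?mulr_ge0// -sqrtr_sqr ler_wsqrtr//.
    rewrite exprMn sqr_sqrtr; last by rewrite addr_ge0// !mulr_ge0// sqr_ge0.
    apply: (@le_trans _ _ (rint 0 T (fun t => 2 * (c1 * n) ^+ 2 + 2 * enorm (e t) ^+ 2))).
      apply: rint_le => [||t _]; first exact: L2m.2.
        by apply: L1D; [exact: L1_cst|apply: L1Z; exact: (enorm_L2 L2e).2].
      by rewrite /m; have := sqr_ge0 (c1 * n - enorm (e t)); nra.
    rewrite rintD; [|exact: L1_cst|by apply: L1Z; exact: (enorm_L2 L2e).2].
    rewrite rint_cst// rintZ; last exact: (enorm_L2 L2e).2.
    by rewrite -L2norm_sqr_rint -/n subr0 exprMn; nra.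
  have WV := dinterp_error part hw L2m Wm (fun t _ => m0 t).
  have {}WV : L2norm T (fun t => W t - dinterp s w t) <= d%:R * h * (Cm * n).
    by apply: (le_trans WV); rewrite ler_wpM2l// mulr_ge0.
  set V := dinterp s w in WV *; set v := interp s w.
  have L2V : in_L2 T V by exact: dinterp_in_L2.
  have cv : {within `[0, T], continuous v} by have [] := interp_P1 part w.
  have L2v : in_L2 T v by exact: within_in_L2.
  have wv t : t \in `[0, T] -> enorm (w t - v t) <= sT * (d%:R * h * (Cm * n)).
    by move=> tT; exact: (interp_error T0 part hw tT WV).
  have L2wv : in_L2 T (fun t => w t - v t) by exact: in_L2B.
  have wvn : L2norm T (fun t => w t - v t) <= T * (d%:R * h * (Cm * n)).
    have Z0 : 0 <= sT * (d%:R * h * (Cm * n)) by rewrite !mulr_ge0.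
    have := @L2norm_le_cst R d T _ _ T0 Z0 L2wv (fun t tT => wv t (in_oo_cc tT)).
    by rewrite mulrA -expr2 sqr_sqrtr.
  have L2WV : in_L2 T (fun t => W t - V t) by exact: in_L2B.
  have WN : L2norm T W <= sT * (q * k1 + 2 * sT) * n.
    have Z0 : 0 <= (q * k1 + 2 * sT) * n by rewrite !(mulr_ge0, addr_ge0).
    rewrite -mulrA; apply: (L2norm_le_cst T0 Z0 L2W) => t /bE[[_ b1 _] [_ _ b2 _]].
    rewrite /W (le_trans (enormD _ _))// mulrDl lerD//.
      by rewrite (le_trans (qM _ _))// -mulrA ler_wpM2l// (le_trans b2).
    by rewrite (le_trans b1)// -mulrA ler_wpM2l.
  have wN : L2norm T w <= sT * k1 * n.
    have Z0 : 0 <= k1 * n by rewrite mulr_ge0.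
    rewrite -mulrA; apply: (L2norm_le_cst T0 Z0 L2w) => t /bE[_ [_ b2 _ _]].
    exact: le_trans Kn.
  have VN : L2norm T V <= sT * (q * k1 + 2 * sT) * n + d%:R * h * (Cm * n).
    have -> : V = (fun t => W t - (W t - V t)) by apply/funext => t; rewrite subKr.
    by rewrite (le_trans (L2normB _ _))// lerD.
  have vN : L2norm T v <= sT * k1 * n + T * (d%:R * h * (Cm * n)).
    have -> : v = (fun t => w t - (w t - v t)) by apply/funext => t; rewrite subKr.
    by rewrite (le_trans (L2normB _ _))// lerD.
  (* The first part is accessible to the hypothesis [EL]; in the second, an interpolation error of
     order h n meets [G], which is bounded by [eta]. *)
  have split_ : L2dot T G (fun t => W t - w t *m M t) =
      L2dot T G (fun t => V t - v t *m M t) +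
      L2dot T G (fun t => (W t - V t) - (w t - v t) *m M t).
    have L2a : in_L2 T (fun t => V t - v t *m M t) by apply: in_L2B => //; exact: in_L2_mulmx.
    have L2b : in_L2 T (fun t => (W t - V t) - (w t - v t) *m M t).
      by apply: in_L2B => //; exact: in_L2_mulmx.
    rewrite -(L2dotDr L2a L2b L2G); apply: eq_rint => t _; congr dot.
    by rewrite mulmxBl; apply/rowP => j; rewrite !mxE; ring.
  have rest : `|L2dot T G (fun t => (W t - V t) - (w t - v t) *m M t)| <=
      eta * ((1 + q * T) * (d%:R * h * (Cm * n))).
    have L2a : in_L2 T (fun t => (w t - v t) *m M t) by exact: in_L2_mulmx.
    have L2b : in_L2 T (fun t => (W t - V t) - (w t - v t) *m M t) by exact: in_L2B.
    apply: (le_trans (L2dot_le L2G L2b)); rewrite ler_pM ?L2norm_ge0//.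
    rewrite (le_trans (L2normB _ _))// mulrDl mul1r lerD// -mulrA.
    apply: (le_trans (L2norm_mono q0 L2a L2wv (fun t _ => qM t (w t - v t)))).
    by rewrite ler_wpM2l.
  have v0 : v 0 = w 0 by exact: (interp0 part).
  have := EL w; rewrite -/V -/v v0 => ELw.
  (* Here the term will be multiplied by [kappa], so [h] may be replaced by [T], which frees the
     constant from the partition. *)
  have hn : d%:R * h * (Cm * n) <= d%:R * T * Cm * n.
    by rewrite !mulrA !ler_wpM2r// ler_wpM2l.
  have ELw' : `|L2dot T G (fun t => V t - v t *m M t) + dot (e 0) (w 0)| <=
      kappa * ((sT * (q * k1 + 2 * sT) + d%:R * T * Cm) * n + (sT * k1 + T * d%:R * T * Cm) * n).
    apply: (le_trans ELw); rewrite ler_wpM2l// lerD//.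
      by rewrite (le_trans VN)// [leRHS]mulrDl lerD2l.
    rewrite (le_trans vN)// [leRHS]mulrDl lerD2l (le_trans (ler_wpM2l T0' hn))//.
    by rewrite !mulrA.
  rewrite split_ in id.
  move: (ler_norm (L2dot T G (fun t => V t - v t *m M t) + dot (e 0) (w 0))) ELw'.
  move: (ler_norm (L2dot T G (fun t => W t - V t - (w t - v t) *m M t))) rest.
  have l1 := ler_norm (- L2dot T e (fun t => (ph t - p t) *m (M t)^T)).
  have l2 := ler_norm (- L2dot T G (fun t => (wh t - w t) *m M t)).
  move: id err1 err2 l1 l2; rewrite !normrN.
  set i1 := L2dot T G _; set i2 := L2dot T G _; set i3 := L2dot T e _; set i4 := L2dot T G _.
  set i5 := dot _ _ => id err1 err2 l1 l2 l3 r3 l4 r4.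
  have r1 := le_trans l1 err1; have r2 := le_trans l2 err2.
  have {}r3 := le_trans l3 r3; have {}r4 := le_trans l4 r4.
  have S1 : n ^+ 2 = (i1 + i5) + i2 - i3 - i4 by rewrite (addrAC i1) id; ring.
  rewrite S1 /duality_constant.
  set al := sT * (q * k1 + 2 * sT) + d%:R * T * Cm in r4 *.
  set be := sT * k1 + T * d%:R * T * Cm in r4 *.
  have al0 : 0 <= al by rewrite /al !(addr_ge0, mulr_ge0).
  have be0 : 0 <= be by rewrite /be !(addr_ge0, mulr_ge0).
  set ga := (1 + q * T) * d%:R * Cm.
  have ga0 : 0 <= ga by rewrite /ga !(addr_ge0, mulr_ge0).
  have r3' : i2 <= eta * h * ga * n.
    by apply: (le_trans r3); rewrite le_eqVlt; apply/orP; left; apply/eqP; rewrite /ga; ring.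
  clearbody al be ga.
  have x1 : 0 <= kappa * ga * n by rewrite !mulr_ge0.
  have x2 : 0 <= eta * h * (al + be) * n by rewrite !mulr_ge0// addr_ge0.
  move: r1 r2 r3' r4 x1 x2; clear; move=> r1 r2 r3' r4 x1 x2.
  lra.
rewrite -/n.
have Cn0 : 0 <= duality_constant * (kappa + eta * h).
  by rewrite mulr_ge0 ?duality_constant_ge0// addr_ge0// mulr_ge0.
set Q := duality_constant * (kappa + eta * h) in main Cn0 *.
set Z := n * (sT * q) + eta * (sT * q) in main.
have Z0 : 0 <= Z by rewrite !(addr_ge0, mulr_ge0).
(* The accuracy of the dual functions tends to 0 while [Q] and [Z] stay fixed; the division by
   [Z + 1] covers [Z = 0]. *)
have sq : n ^+ 2 <= Q * n.
  apply/ler_addgt0Pr => eps eps0.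
  have Z1 : 0 < Z + 1 by rewrite ltr_wpDl.
  apply: (le_trans (main (eps / (Z + 1)) (divr_gt0 eps0 Z1))); rewrite lerD2l.
  by rewrite mulrAC ler_pdivrMr// ler_wpM2l ?(ltW eps0)// lerDl.
have [n00|np] := leP n 0; first exact: le_trans Cn0.
by rewrite -(ler_pM2r np) -expr2.
Qed.

End Duality.

(** * Euler-Lagrange equation and regularity *)

Section Regularity.
Context {R : realType} {d : nat}.
Variable T : R.
Hypothesis T0 : 0 < T.
Notation mu := (@lebesgue_measure R).
Implicit Types (u v z f : R -> 'rV[R]_d) (F : 'rV[R]_d -> 'rV[R]_d) (t : R).

Lemma class_CS k F : class_C k.+1 F -> class_C k F.
Proof.
elim: k F => [|k IH] F [dF cF]; first by move=> x; exact: differentiable_continuous.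
by split => // v; exact: IH.
Qed.

Lemma within_bounded u : {within `[0, T], continuous u} ->
  exists2 K, 0 <= K & forall t, t \in `[0, T] -> enorm (u t) <= K.
Proof.
move=> cu; have ce := continuous_enorm (fun i => @within_clamp_coord _ _ T T0 u i cu).
have /compact_bounded[K [Kr HK]] :=
  continuous_compact (@cont_within _ 0 T _ ce) (@segment_compact _ 0 T).
exists (`|K| + 1); first by rewrite addr_ge0.
move=> t tT; rewrite -[u t]/(u t) -{1}(clamp_id tT) -[leLHS]ger0_norm ?enorm_ge0//.
apply: HK; first by rewrite (le_lt_trans (ler_norm _))// ltrDl.
by exists t.
Qed.

Lemma comp_clamp_coord (G : 'rV[R]_d -> R) u : continuous G ->
  {within `[0, T], continuous u} -> continuous (fun t => G (u (clamp T t))).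
Proof.
move=> cG cu x; apply: (@continuous_comp _ _ _ (u \o clamp T) G); last exact: cG.
exact: within_comp_clamp.
Qed.

Lemma coord_comp_continuous F i : continuous F -> continuous (fun x => F x 0 i).
Proof.
move=> cF x; apply: (@continuous_comp _ _ _ F (fun v : 'rV[R]_d => v 0 i)); first exact: cF.
exact: coord_continuous.
Qed.

Lemma in_L2_comp F u : continuous F -> {within `[0, T], continuous u} ->
  in_L2 T (fun t => F (u t)).
Proof.
move=> cF cu; apply: (@eq_in_L2 _ _ _ (fun t => F (u (clamp T t)))).
  by move=> t tT; rewrite clamp_id//; exact: in_oo_cc.
apply: in_L2_cont => i; apply: (@comp_clamp_coord (fun x => F x 0 i)) => //.
exact: coord_comp_continuous.
Qed.

Lemma in_L2_mulmx_comp (A : 'rV[R]_d -> 'M[R]_d) u v : (forall i j, continuous (fun x => A x i j)) ->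
  {within `[0, T], continuous u} -> in_L2 T v -> in_L2 T (fun t => v t *m A (u t)).
Proof.
move=> cA cu hv; apply: (@eq_in_L2 _ _ _ (fun t => v t *m A (u (clamp T t)))).
  by move=> t tT; rewrite clamp_id//; exact: in_oo_cc.
by apply: in_L2_mulmx => // i j; exact: (comp_clamp_coord (cA i j)).
Qed.

Lemma H1_clamp u : H1 T u -> H1 T (u \o clamp T) /\
  {ae mu, forall t, t \in `]0, T[ -> wderiv T (u \o clamp T) t = wderiv T u t}.
Proof.
move=> hu; have [h1 h2] := H1_wderiv hu; apply: H1_intro => //.
  by apply: continuous_subspaceT; apply: within_comp_clamp => //; exact: H1_continuous.
move=> phi tphi i; rewrite -(h2 phi tphi i); apply: (@eq_rint _ 0 T) => t tT.
by rewrite /= clamp_id//; exact: in_oo_cc.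
Qed.

Lemma P1space_lin s z v (k : R) : P1space T s z -> P1space T s v ->
  P1space T s (fun t => z t + k *: v t).
Proof.
move=> [cz az] [cv av]; split.
  by move=> t; apply: cvgD; [exact: cz|apply: cvgZl_tmp; exact: cv].
move=> j js; have [a [b ab]] := az j js; have [a' [b' ab']] := av j js.
exists (a + k *: a'), (b + k *: b') => t tj; rewrite ab// ab'//.
by rewrite !scalerDr addrACA; congr (_ + (_ + _)); rewrite !scalerA mulrC.
Qed.

(** The first-order optimality condition in a form that needs only an expansion of J up to O(s^2),
    not a derivative of J. *)
Lemma linear_le_quadratic_eq0 (X C : R) : 0 <= C ->
  (forall s, `|s| <= 1 -> 0 <= s * X + s ^+ 2 * C) -> X = 0.
Proof.
move=> C0 H; apply/eqP; rewrite -normr_le0 leNgt; apply/negP => X0.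
(* [a <= 1] and [a * C < |X|]: for the step [- sg X * a] the negative linear term outweighs the
   quadratic one. *)
pose a := `|X| / (`|X| + C + 1).
have den : 0 < `|X| + C + 1 by rewrite ltr_wpDl// addr_ge0.
have a0 : 0 < a by rewrite divr_gt0.
have a1 : a <= 1 by rewrite ler_pdivrMr// mul1r -addrA lerDl addr_ge0.
have aC : a * C < `|X|.
  by rewrite mulrAC ltr_pdivrMr// ltr_pM2l// -addrA addrCA ltrDl ltr_wpDr.
have sg : - Num.sg X * X = - `|X| by rewrite mulNr -normrEsg.
have sg1 : `|Num.sg X| = 1 by rewrite normr_sg; move: X0; rewrite normr_gt0 => ->.
have := H (- Num.sg X * a); rewrite normrM normrN sg1 mul1r (ger0_norm (ltW a0)) => /(_ a1).
rewrite mulrAC sg exprMn sqrrN -[Num.sg X ^+ 2]real_normK ?num_real// sg1 expr1n mul1r.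
by rewrite expr2; nra.
Qed.

Lemma L2norm_sqrD u v : in_L2 T u -> in_L2 T v ->
  L2norm T (fun t => u t + v t) ^+ 2 = L2norm T u ^+ 2 + 2 * L2dot T u v + L2norm T v ^+ 2.
Proof.
move=> hu hv; have huv : in_L2 T (fun t => u t + v t) by exact: in_L2D.
rewrite !L2norm_sqr (L2dotDl hu hv huv) (L2dotDr hu hv hu) (L2dotDr hu hv hv).
by rewrite (L2dotC T v u); ring.
Qed.

(** [u] is the residual at z, [s D] its linear change along a direction, and [rho] the Taylor
    remainder of F. Since |s| <= 1, s D - rho is O(|s|), so expanding the squares leaves the linear
    term and O(s^2). *)
Lemma perturbation_ge0 u D rho (a b : 'rV[R]_d) (s c : R) :
  in_L2 T u -> in_L2 T D -> in_L2 T rho -> 0 <= c -> `|s| <= 1 -> L2norm T rho <= s ^+ 2 * c ->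
  2^-1 * L2norm T u ^+ 2 + 2^-1 * enorm a ^+ 2 <=
  2^-1 * L2norm T (fun t => u t + (s *: D t - rho t)) ^+ 2 + 2^-1 * enorm (a + s *: b) ^+ 2 ->
  0 <= s * (L2dot T u D + dot a b) +
       s ^+ 2 * (L2norm T u * c + 2^-1 * (L2norm T D + c) ^+ 2 + 2^-1 * dot b b).
Proof.
move=> hu hD hr c0 s1 nrho H.
have hsD : in_L2 T (fun t => s *: D t) by exact: in_L2Z.
have hW : in_L2 T (fun t => s *: D t - rho t) by exact: in_L2B.
have s2 : s ^+ 2 <= `|s| by rewrite -[s ^+ 2]real_normK ?num_real// expr2 ler_piMl.
have E2 : L2dot T u (fun t => s *: D t - rho t) = s * L2dot T u D - L2dot T u rho.
  by rewrite (L2dotBr hsD hr hu) L2dotZr.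
have E3 : enorm (a + s *: b) ^+ 2 = enorm a ^+ 2 + 2 * s * dot a b + s ^+ 2 * dot b b.
  by rewrite !enorm_sqr dotDl !dotDr !dotZl !dotZr (dotC b a); ring.
have B1 : `|L2dot T u rho| <= L2norm T u * (s ^+ 2 * c).
  by rewrite (le_trans (L2dot_le hu hr))// ler_wpM2l// L2norm_ge0.
have B2 : L2norm T (fun t => s *: D t - rho t) <= `|s| * (L2norm T D + c).
  rewrite (le_trans (L2normB hsD hr))// L2normZ// mulrDr lerD2l (le_trans nrho)//.
  by rewrite ler_wpM2r.
have B3 : L2norm T (fun t => s *: D t - rho t) ^+ 2 <= s ^+ 2 * (L2norm T D + c) ^+ 2.
  rewrite -[s ^+ 2]real_normK ?num_real// -exprMn lerXn2r ?nnegrE ?L2norm_ge0//.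
  by rewrite mulr_ge0// addr_ge0// L2norm_ge0.
move: H; rewrite (L2norm_sqrD hu hW) E2 E3.
have := ler_norm (- L2dot T u rho); rewrite normrN.
move: B1 B3; move: (L2dot T u rho) (L2dot T u D) (dot a b) (enorm a ^+ 2) (dot b b).
move: (L2norm T _ ^+ 2) => a1 a2 a3 a4 a5 a6; move: (L2norm T u) (L2norm T D) => a7 a8; clear.
move=> *; lra.
Qed.

(** Minimality is used only along the line z + s v, |s| <= 1, with F replaced by its Taylor
    expansion. [V] is an explicit representative of v', here the derivative of an interpolant. *)
Lemma euler_lagrange F f g z v V : class_C 2 F -> in_L2 T f -> H1 T z -> H1 T v ->
  in_L2 T V -> {ae mu, forall t, t \in `]0, T[ -> wderiv T v t = V t} ->
  (forall s : R, J T F f g z <= J T F f g (fun t => z t + s *: v t)) ->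
  L2dot T (fun t => wderiv T z t - F (z t) - f t) (fun t => V t - v t *m 'J F (z t)) +
  dot (z 0 - g) (v 0) = 0.
Proof.
move=> CF hf hz hv hV aeV Jmin.
have pos (a b c e : R) : 0 <= a -> 0 <= b -> 0 <= c -> 0 <= e ->
    0 <= a * c + 2^-1 * (b + c) ^+ 2 + 2^-1 * e.
  by move=> a0 b0 c0 e0; have := sqr_ge0 (b + c); have := mulr_ge0 a0 c0; lra.
have cF : continuous F := class_C_continuous CF.
have cz := H1_continuous hz; have cv := H1_continuous hv.
have [L2Z _] := H1_wderiv hz.
have L2v := H1_in_L2 hv.
have cJ i j : continuous (fun x => 'J F x i j) by apply: jacobian_continuous; exact: class_CS.
have L2Fz := in_L2_comp cF cz.
have L2vJ : in_L2 T (fun t => v t *m 'J F (z t)) by exact: in_L2_mulmx_comp.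
set Rz := (fun t => wderiv T z t - F (z t) - f t).
set D := (fun t => V t - v t *m 'J F (z t)).
have L2R : in_L2 T Rz by apply: in_L2B => //; exact: in_L2B.
have L2D_ : in_L2 T D by exact: in_L2B.
have [kz kz0 Hkz] := within_bounded cz; have [kv kv0 Hkv] := within_bounded cv.
(* The cube of half-width [kz + kv] contains z(t) and z(t) + s v(t) for all |s| <= 1. *)
have [L L0 [_ _ HL]] := @box_C2_bounds R d F (kz + kv) CF.
set c := Num.sqrt T * (L * kv ^+ 2).
have c0 : 0 <= c by rewrite mulr_ge0 ?sqrtr_ge0// mulr_ge0// sqr_ge0.
set X := L2dot T Rz D + dot (z 0 - g) (v 0).
pose nR := L2norm T Rz; pose nD := L2norm T D.
have nR0 : 0 <= nR by exact: L2norm_ge0.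
have nD0 : 0 <= nD by exact: L2norm_ge0.
apply: (@linear_le_quadratic_eq0 X (nR * c + 2^-1 * (nD + c) ^+ 2 + 2^-1 * dot (v 0) (v 0))).
  exact: pos nR0 nD0 c0 (dot_ge0 _).
move=> s s1.
have [hzv aezv] := H1_lin T0 s hz hv.
have czv := H1_continuous hzv.
pose rho t := F (z t + s *: v t) - F (z t) - s *: (v t *m 'J F (z t)).
have L2rho : in_L2 T rho.
  by apply: in_L2B; [apply: in_L2B => //; exact: in_L2_comp|exact: in_L2Z].
have nrho : L2norm T rho <= s ^+ 2 * c.
  rewrite /c mulrCA; apply: L2norm_le_cst => //.
    by rewrite mulr_ge0 ?sqr_ge0// mulr_ge0// sqr_ge0.
  move=> t /in_oo_cc tT.
  have b1 : box (kz + kv) (z t).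
    by apply: enorm_box; rewrite (le_trans (Hkz t tT))// lerDl.
  have b2 : box (kz + kv) (z t + s *: v t).
    apply: enorm_box; rewrite (le_trans (enormD _ _))// lerD ?Hkz// enormZ.
    by rewrite (le_trans (ler_piMl (enorm_ge0 _) s1))// Hkv.
  have E : z t + s *: v t - z t = s *: v t by rewrite addrC addKr.
  have := HL _ _ b1 b2; rewrite E /rho; move: ('J F _) => A.
  rewrite scalemxAl => /le_trans; apply.
  rewrite enormZ exprMn real_normK ?num_real// mulrCA ler_wpM2l ?sqr_ge0// ler_wpM2l//.
  by rewrite lerXn2r ?nnegrE ?enorm_ge0// Hkv.
pose W t := s *: D t - rho t.
have L2sD : in_L2 T (fun t => s *: D t) by exact: in_L2Z.
have L2W : in_L2 T W by exact: in_L2B.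
have L2RW : in_L2 T (fun t => Rz t + W t) by exact: in_L2D.
have Jzv : J T F f g (fun t => z t + s *: v t) =
    2^-1 * L2norm T (fun t => Rz t + W t) ^+ 2 + 2^-1 * enorm (z 0 - g + s *: v 0) ^+ 2.
  rewrite /J addrAC; suff -> : L2norm T (fun t => wderiv T (fun t => z t + s *: v t) t -
    F (z t + s *: v t) - f t) = L2norm T (fun t => Rz t + W t) by [].
  apply: ae_L2norm => //.
    apply: in_L2B => //; apply: in_L2B; last exact: in_L2_comp.
    by have [] := H1_wderiv hzv.
  apply: aeS2 aezv aeV => t h1 h2 tT; rewrite h1// h2// /Rz /W /D /rho.
  move: (wderiv T z t) (F _) (F _) (f t) (V t) (v t *m _) => a1 a2 a3 a4 a5 a6.
  by rewrite scalerBr; apply/rowP => i; rewrite !mxE; ring.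
have := Jmin s; rewrite Jzv [X in X <= _]/J -/Rz => H.
exact: perturbation_ge0 nrho H.
Qed.

Lemma abs_continuous_coord f i : abs_continuous T f -> ac_on T (fun t => f t 0 i).
Proof.
move=> acf e e0; have [del del0 H] := acf e e0; exists del => // n a b h1 h2 h3.
apply: le_lt_trans (H n a b h1 h2 h3); apply: ler_sum => k _.
have -> : f (b k) 0 i - f (a k) 0 i = (f (b k) - f (a k)) 0 i.
  by rewrite [RHS]mxE [in X in _ = _ + X]mxE.
exact: coord_le_enorm.
Qed.

Lemma ac_on_clamp_continuous phi : ac_on T phi -> continuous (fun t => phi (clamp T t)).
Proof.
move=> acphi x; apply/cvgrPdist_lt => e e0; have [del del0 H] := acphi e e0.
exists del => //= y xy.
have key s t : s <= t -> t - s < del -> `|phi (clamp T t) - phi (clamp T s)| < e.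
  move=> st hst.
  have /andP[l1 l2] := clamp_lipschitz T st.
  have := H 1%N (fun=> clamp T s) (fun=> clamp T t).
  rewrite !big_ord1; apply.
  - move=> _; have := clamp_in T0 s; have := clamp_in T0 t; rewrite !in_itv/=.
    by move=> /andP[_ ->] /andP[-> _]; rewrite -subr_ge0.
  - by move=> j k; rewrite !ord1.
  - exact: le_lt_trans hst.
have [yx|xy'] := leP y x.
  by apply: key => //; rewrite -[ltLHS]ger0_norm ?subr_ge0.
rewrite distrC; apply: key; first exact: ltW.
by rewrite -[ltLHS]ger0_norm ?subr_ge0 ?ltW// distrC.
Qed.

(** The right-hand side F(y) + f is continuous, so y agrees on [0, T] with a primitive [yb] that is
    C^1 on the line. A bound on increments by int m stands in for y'' in L^2. *)
Lemma ivp_solution_regular F f f' g y : class_C 2 F -> abs_continuous T f -> in_L2 T f' ->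
  {ae mu, forall t, t \in `]0, T[ -> is_derive t 1 f (f' t)} ->
  ivp_solution T F f g y ->
  exists (yb Y : R -> 'rV[R]_d) (m : R -> R),
  [/\ is_C1 yb Y, (forall t, t \in `[0, T] -> yb t = y t),
      (forall t, t \in `[0, T] -> Y t = F (y t) + f t) &
      {ae mu, forall t, t \in `]0, T[ -> wderiv T y t = Y t}] /\
  [/\ L2 0 T m, (forall x, x \in `]0, T[ -> 0 <= m x) &
      forall a b i, 0 <= a -> a <= b -> b <= T -> `|Y b 0 i - Y a 0 i| <= rint a b m].
Proof.
move=> CF acf hf' derf [hy [y0 aey]].
have cF : continuous F := class_C_continuous CF.
have cy := H1_continuous hy.
pose Y t := F (y (clamp T t)) + f (clamp T t).
have cY i : continuous (fun t => Y t 0 i).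
  have cf : continuous (fun t => f (clamp T t) 0 i).
    apply: (@ac_on_clamp_continuous (fun t => f t 0 i)); exact: abs_continuous_coord.
  move=> t; rewrite /Y; under eq_fun do rewrite mxE; apply: cvgD.
    exact: (comp_clamp_coord (coord_comp_continuous cF)).
  exact: cf.
have YE t : t \in `[0, T] -> Y t = F (y t) + f t by move=> tT; rewrite /Y clamp_id.
have aeY : {ae mu, forall t, t \in `]0, T[ -> wderiv T y t = Y t}.
  by apply: aeS aey => t h tT; rewrite h// YE//; exact: in_oo_cc.
pose yb t : 'rV[R]_d := \row_i (y 0 0 i + primitive (fun s => Y s 0 i) t).
have hyb : is_C1 yb Y.
  split => // i t; rewrite /yb; have -> : (fun t => (\row_i (y 0 0 i + primitive (fun s => Y s 0 i) t)) 0 i) =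
     (fun t => y 0 0 i + primitive (fun s => Y s 0 i) t).
    by apply/funext => s; rewrite mxE.
  have := derD (is_derive_cst (y 0 0 i) t 1) (is_derive_primitive t (cY i)).
  by rewrite add0r.
have [L2y _] := H1_wderiv hy.
have ybE t : t \in `[0, T] -> yb t = y t.
  rewrite in_itv/= => /andP[t0 tT]; apply/rowP => i; rewrite mxE.
  have := congr1 (fun v : 'rV[R]_d => v 0 i) (H1_increment T0 hy (lexx 0) t0 tT).
  rewrite !mxE.
  have L2i := (in_L2P _ _).1 L2y i.
  rewrite (@ae_eq_rint _ 0 t _ (fun s => Y s 0 i)).
  - rewrite (rint_primitive (cY i) t0) /primitive subrr subr0 => h.
    by rewrite -h [LHS]addrC subrK.
  - by apply: L2_measurable; exact: L2S L2i.
  - exact: cont_measurable.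
  - apply: aeS aeY => s h; rewrite in_itv/= => /andP[s0 st]; rewrite h// in_itv/= s0.
    exact: lt_le_trans tT.
have [ky ky0 Hky] := within_bounded cy.
have [L L0 [HL _ _]] := @box_C2_bounds R d F ky CF.
have L2f' := enorm_L2 hf'.
have L2Y : L2 0 T (fun t => enorm (Y t)) by apply: cont_L2; exact: continuous_enorm.
(* The chain rule bound for |DF(y) y' + f'|, with [L] a Lipschitz constant of F on a cube containing
   the values of y. *)
exists yb, Y, (fun t => L * enorm (Y t) + enorm (f' t)); split => //; split.
- by apply: L2D => //; exact: L2Z.
- by move=> x _; rewrite addr_ge0 ?mulr_ge0 ?enorm_ge0.
move=> a b i a0 ab bT.
have aT : a \in `[0, T] by rewrite in_itv/= a0 (le_trans ab).
have bT' : b \in `[0, T] by rewrite in_itv/= bT (le_trans a0).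
have L1Y : L1 a b (fun t => enorm (Y t)) by apply: L2_L1; exact: L2S L2Y.
have L1f' : L1 a b (fun t => enorm (f' t)) by apply: L2_L1; exact: L2S L2f'.
rewrite rintD//; last exact: L1Z.
rewrite rintZ//.
have -> : Y b 0 i - Y a 0 i = (F (y b) - F (y a)) 0 i + (f b 0 i - f a 0 i).
  by rewrite !YE// !mxE; ring.
apply: (le_trans (ler_normD _ _)); apply: lerD.
  apply: (le_trans (coord_le_enorm _ _)).
  apply: (le_trans (HL _ _ (enorm_box (Hky a aT)) (enorm_box (Hky b bT')))).
  by rewrite ler_wpM2l// -!ybE//; exact: C1_enorm_le hyb ab.
have L2f'i := (in_L2P _ _).1 hf' i.
have derfi : {ae mu, forall x, x \in `]0, T[ -> is_derive x 1 (fun t => f t 0 i) (f' x 0 i)}.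
  apply: aeS derf => x h xT; have [dfx <-] := h xT.
  have dfi := (derivable_mxP _ _ _).1 dfx 0 i.
  by rewrite (derive_mx dfx) mxE; exact: DeriveDef.
have acfi : ac_on T (fun t => f t 0 i) by exact: abs_continuous_coord.
apply: (le_trans (ac_increment_le a0 ab bT acfi (L2_L1 L2f'i) derfi)).
apply: rint_le => // [|x _]; last exact: coord_le_enorm.
by apply: L1_norm; apply: L2_L1; exact: L2S L2f'i.
Qed.

End Regularity.

(** * Error estimates *)

Section Estimates.
Context {R : realType} {d : nat}.
Variable T : R.
Hypothesis T0 : 0 < T.
Notation mu := (@lebesgue_measure R).
Implicit Types (u v z f : R -> 'rV[R]_d) (F : 'rV[R]_d -> 'rV[R]_d) (t : R) (s : seq R).

(** The inner root is at least K, and K >= 2 T^2, so the outer radicand is at least 4 T^2. *)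
Lemma jacobian_threshold (c : R) (K := 2 * T ^+ 2 + T + c ^+ 2) :
  1 / Num.sqrt (K + Num.sqrt (K ^+ 2 + 2 * T * c ^+ 2 * (1 + 2 * T))) <= (2 * T)^-1.
Proof.
have c2 := sqr_ge0 c; have T2 := sqr_ge0 T.
have p0 : 0 <= 2 * T * c ^+ 2 * (1 + 2 * T).
  have h1 : 0 <= 2 * T by move: T0; lra.
  have h2 : 0 <= 1 + 2 * T by move: T0; lra.
  exact: mulr_ge0 (mulr_ge0 h1 c2) h2.
have K2 : 2 * T ^+ 2 <= K by rewrite /K -addrA lerDl addr_ge0// ltW.
have K0 : 0 <= K by move: K2 T2; clear; move: K (T ^+ 2) => a b; lra.
have sK : K <= Num.sqrt (K ^+ 2 + 2 * T * c ^+ 2 * (1 + 2 * T)).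
  by rewrite -{1}(ger0_norm K0) -sqrtr_sqr ler_wsqrtr// lerDl.
move: sK; set S := Num.sqrt (K ^+ 2 + _) => sK.
have T20 : 0 < 2 * T by rewrite mulr_gt0.
have h : 2 * T <= Num.sqrt (K + S).
  rewrite -{1}(ger0_norm (ltW T20)) -sqrtr_sqr ler_wsqrtr// exprMn; move: K2 sK T2; clear; move: K S (T ^+ 2) => a b c'; rewrite expr2; lra.
by rewrite div1r lef_pV2 ?posrE// (lt_le_trans T20 h).
Qed.

Lemma interp_H1 s u : itv_partition 0 T s ->
  H1 T (interp s u) /\ {ae mu, forall t, t \in `]0, T[ -> wderiv T (interp s u) t = dinterp s u t}.
Proof.
move=> part; apply: (H1_intro T0).
- exact: (interp_P1 part u).1.
- exact: dinterp_in_L2.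
- exact: interp_weak_derivative.
Qed.

Lemma residual_in_L2 F f z : continuous F -> in_L2 T f -> H1 T z ->
  in_L2 T (fun t => wderiv T z t - F (z t) - f t).
Proof.
move=> cF hf hz; apply: in_L2B => //; apply: in_L2B; first exact: (H1_wderiv hz).1.
by apply: in_L2_comp => //; exact: H1_continuous.
Qed.

(** The interpolant has the exact initial value, so its J is half the square of its residual, F(y) -
    F(Iy) - (y' - (Iy)'). Both halves of J(z) are nonnegative and each is bounded by this. *)
Lemma residual_bound F f z yb Y s (L k : R) : continuous F -> in_L2 T f -> H1 T z ->
  is_C1 yb Y -> itv_partition 0 T s -> 0 <= L ->
  (forall t, t \in `]0, T[ -> Y t = F (yb t) + f t) ->
  (forall t, t \in `]0, T[ ->
     enorm (F (yb t) - F (interp s yb t)) <= L * enorm (yb t - interp s yb t)) ->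
  L2norm T (fun t => Y t - dinterp s yb t) <= k ->
  J T F f (yb 0) z <= J T F f (yb 0) (interp s yb) ->
  L2norm T (fun t => wderiv T z t - F (z t) - f t) <= (1 + L * T) * k /\
  enorm (z 0 - yb 0) <= (1 + L * T) * k.
Proof.
move=> cF hf hz hyb part L0 YE HL hk Jle.
have [hv aev] := interp_H1 yb part.
have [hy _] := C1_H1 T0 hyb.
have hY : in_L2 T Y by apply: in_L2_cont; exact: hyb.2.
have hdi : in_L2 T (dinterp s yb) by exact: dinterp_in_L2.
have hF : in_L2 T (fun t => F (yb t) - F (interp s yb t)).
  by apply: in_L2B; apply: in_L2_comp => //; exact: H1_continuous.
have k0 : 0 <= k by rewrite (le_trans _ hk)// L2norm_ge0.
have nF : L2norm T (fun t => F (yb t) - F (interp s yb t)) <= L * T * k.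
  have -> : L * T * k = Num.sqrt T * (L * (Num.sqrt T * k)).
    by rewrite -{1}(sqr_sqrtr (ltW T0)) expr2; ring.
  apply: L2norm_le_cst => //; first by rewrite !mulr_ge0 ?sqrtr_ge0.
  move=> t tT; rewrite (le_trans (HL _ tT))// ler_wpM2l//.
  exact: interp_error hyb (in_oo_cc tT) hk.
set nz := L2norm T _.
have nz0 : 0 <= nz by exact: L2norm_ge0.
have e0 := enorm_ge0 (z 0 - yb 0).
have K0 : 0 <= (1 + L * T) * k by rewrite mulr_ge0// addr_ge0// mulr_ge0// ltW.
have nv : L2norm T (fun t => wderiv T (interp s yb) t - F (interp s yb t) - f t) <= (1 + L * T) * k.
  rewrite (@ae_L2norm _ _ _ _ (fun t => F (yb t) - F (interp s yb t) - (Y t - dinterp s yb t))).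
  - rewrite (le_trans (L2normB hF (in_L2B hY hdi)))// mulrDl mul1r addrC lerD//.
  - exact: residual_in_L2.
  - by apply: in_L2B => //; exact: in_L2B.
  - apply: aeS aev => t h tT; rewrite h// YE//.
    move: (F _) (F _) (f t) (dinterp _ _ _) => a b c e.
    by apply/rowP => i; rewrite !mxE; ring.
move: Jle; rewrite /J (interp0 part) subrr enorm0 -/nz.
move: nv; set nI := L2norm T _ => nv Jle.
have nI0 : 0 <= nI by exact: L2norm_ge0.
have nI2 : nI ^+ 2 <= ((1 + L * T) * k) ^+ 2 by rewrite lerXn2r.
move: Jle nI2 nz0 e0 K0; move: nz (enorm _) ((1 + L * T) * k) => a b c; clear => Jle nI2 a0 b0 c0.
have a2 := sqr_ge0 a; have b2 := sqr_ge0 b.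
by split; rewrite -(@ler_pXn2r _ 2)//; lra.
Qed.

(** e' is the residual of z plus F(z) - F(y), and the latter is at most L |e| <= theta |e'| + L sqrt
    T |e(0)|; as theta < 1, the term theta |e'| is absorbed on the left. *)
Lemma energy_error F f z y (L a : R) (theta := L * (T / Num.sqrt 2)) :
  continuous F -> in_L2 T f -> H1 T z -> H1 T y ->
  {ae mu, forall t, t \in `]0, T[ -> wderiv T y t = F (y t) + f t} ->
  0 <= L -> theta < 1 ->
  (forall t, t \in `]0, T[ -> enorm (F (z t) - F (y t)) <= L * enorm (z t - y t)) ->
  L2norm T (fun t => wderiv T z t - F (z t) - f t) <= a -> enorm (z 0 - y 0) <= a ->
  L2norm T (wderiv T (z \- y)) <= a * (1 + L * Num.sqrt T) / (1 - theta).
Proof.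
move=> cF hf hz hy aey L0 th1 HL nR ne0.
have [he aee] := H1_sub T0 hz hy; have [hE _] := H1_wderiv he.
have hFF : in_L2 T (fun t => F (z t) - F (y t)).
  by apply: in_L2B; apply: in_L2_comp => //; exact: H1_continuous.
have hR := residual_in_L2 cF hf hz.
have hc : in_L2 T (fun t => z 0 - y 0) by apply: in_L2_cont => i; exact: cst_continuous.
have he2 := H1_in_L2 he.
set nE := L2norm T _.
have N1 : nE <= a + L2norm T (fun t => F (z t) - F (y t)).
  rewrite /nE (@ae_L2norm _ _ _ _ (fun t => (wderiv T z t - F (z t) - f t) + (F (z t) - F (y t)))) //.
  - by rewrite (le_trans (L2normD hR hFF))// lerD2r.
  - exact: in_L2D.
  - apply: aeS2 aee aey => t h1 h2 tT; rewrite h1// h2//.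
    move: (F _) (F _) (f t) (wderiv T z t) => b1 b2 b3 b4.
    by apply/rowP => i; rewrite !mxE; ring.
have N2 : L2norm T (fun t => F (z t) - F (y t)) <= L * L2norm T (z \- y).
  exact: L2norm_mono.
have N3 : L2norm T (z \- y) <= T / Num.sqrt 2 * nE + Num.sqrt T * a.
  have h1 : in_L2 T (fun t => (z \- y) t - (z \- y) 0) by exact: in_L2B.
  rewrite (@ae_L2norm _ _ _ (z \- y) (fun t => ((z \- y) t - (z \- y) 0) + (z 0 - y 0))) //.
  - rewrite (le_trans (L2normD h1 hc))// lerD//; first exact: Poincare_L2norm.
    by apply: L2norm_le_cst => //; exact: le_trans (enorm_ge0 _) ne0.
  - exact: in_L2D.
  - by apply: aeS (aey) => t _ _; rewrite /= subrK.
rewrite ler_pdivlMr ?subr_gt0//.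
have N4 : L * L2norm T (z \- y) <= theta * nE + L * Num.sqrt T * a.
  apply: (le_trans (ler_wpM2l L0 N3)); rewrite /theta mulrDr !mulrA; exact: lexx.
move: N1 N2 N4; clearbody theta nE; move: (L2norm T (z \- y)) (L2norm T _) => b1 b2; clear => *; lra.
Qed.

(** In the application [u] is the residual at z, [w] the Taylor remainder, [v] the test function
    times DF(y) and [x] the test function times DF(z) - DF(y). Since u and x carry a factor h each
    and w carries h^2, the defect is O(h^2). *)
Lemma perturbed_euler_lagrange u w V v x (p : R) :
  in_L2 T u -> in_L2 T w -> in_L2 T V -> in_L2 T v -> in_L2 T x ->
  L2dot T u (fun t => V t - (v t + x t)) + p = 0 ->
  `|L2dot T (fun t => u t + w t) (fun t => V t - v t) + p| <=
    L2norm T u * L2norm T x + L2norm T w * (L2norm T V + L2norm T v).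
Proof.
move=> hu hw hV hv hx E.
have hvx : in_L2 T (fun t => v t + x t) by exact: in_L2D.
have hVv : in_L2 T (fun t => V t - v t) by exact: in_L2B.
have -> : L2dot T (fun t => u t + w t) (fun t => V t - v t) + p =
    L2dot T u x + L2dot T w (fun t => V t - v t).
  move: E; rewrite (L2dotDl hu hw hVv) (L2dotBr hV hvx hu) (L2dotDr hv hx hu) (L2dotBr hV hv hu).
  move: (L2dot T u V) (L2dot T u v) (L2dot T u x) => b1 b2 b3 b4.
  by rewrite -[LHS]subr0 -b4; ring.
rewrite (le_trans (ler_normD _ _))// lerD// ?(L2dot_le hu hx)//.
rewrite (le_trans (L2dot_le hw hVv))// ler_wpM2l ?L2norm_ge0//.
exact: L2normB.
Qed.

End Estimates.

Lemma consistency_arith (R : realType) (A1 A3 h Lc q sT nV nv nR nx nvM na : R) :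
  0 <= A1 -> 0 <= A3 -> 0 <= h -> 0 <= Lc -> 0 <= q -> 0 <= sT ->
  0 <= nV -> 0 <= nv -> 0 <= nR -> 0 <= nx -> 0 <= nvM -> 0 <= na ->
  nR <= A1 * h -> nx <= Lc * (A3 * h) * nv -> nvM <= q * nv ->
  na <= sT * Lc * A3 ^+ 2 * h ^+ 2 ->
  nR * nx + na * (nV + nvM) <=
    (A1 * Lc * A3 + sT * Lc * A3 ^+ 2 * (1 + q)) * h ^+ 2 * (nV + nv).
Proof.
move=> A10 A30 h0 Lc0 q0 sT0 V0 v0 nR0 nx0 nvM0 na0 HR Hx HvM Ha.
have P1 : nR * nx <= (A1 * h) * (Lc * (A3 * h) * nv) by exact: ler_pM.
have P2 : na * (nV + nvM) <= (sT * Lc * A3 ^+ 2 * h ^+ 2) * (nV + q * nv).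
  by apply: ler_pM; rewrite ?addr_ge0// lerD2l.
apply: (le_trans (lerD P1 P2)).
have Q1 : 0 <= A1 * Lc * A3 * h ^+ 2 by rewrite !mulr_ge0 ?sqr_ge0.
have Q2 : 0 <= sT * Lc * A3 ^+ 2 * h ^+ 2 by rewrite !mulr_ge0 ?sqr_ge0.
have -> : A1 * h * (Lc * (A3 * h) * nv) = A1 * Lc * A3 * h ^+ 2 * nv by ring.
rewrite mulrDl -[_ * (1 + q) * _]mulrAC.
move: Q1 Q2; move: (A1 * Lc * A3 * h ^+ 2) (sT * Lc * A3 ^+ 2 * h ^+ 2) => B1 B2 Q1 Q2.
have R1 := mulr_ge0 Q1 V0; have R2 := mulr_ge0 (mulr_ge0 Q2 q0) V0; have R3 := mulr_ge0 Q2 v0.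
lra.
Qed.

(** * The L^2 error on one partition, with explicit constants *)

Section FiniteElementError.
Context {R : realType} {d : nat}.
Variable T : R.
Hypothesis T0 : 0 < T.
Notation mu := (@lebesgue_measure R).
Implicit Types (v : 'rV[R]_d) (t r : R).

Variables (F : 'rV[R]_d -> 'rV[R]_d) (f y yb Y z : R -> 'rV[R]_d) (s : seq R).
Variables (q L Lc Ym I : R).
Hypotheses (CF : class_C 2 F) (hf : in_L2 T f) (hy : H1 T y).
Hypothesis aey : {ae mu, forall t, t \in `]0, T[ -> wderiv T y t = F (y t) + f t}.
Hypothesis hyb : is_C1 yb Y.
Hypothesis ybE : forall t, t \in `[0, T] -> yb t = y t.
Hypothesis YE : forall t, t \in `[0, T] -> Y t = F (y t) + f t.
Hypothesis part : itv_partition 0 T s.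
Hypotheses (q0 : 0 <= q) (qT : T * q <= 2^-1).
Hypothesis qJ : forall t v, t \in `[0, T] -> enorm (v *m 'J F (y t)) <= q * enorm v.
Hypotheses (L0 : 0 <= L) (LT : L * (T / Num.sqrt 2) < 1).
Hypothesis HL : forall t, t \in `[0, T] -> enorm (F (z t) - F (y t)) <= L * enorm (z t - y t).
Hypothesis Lc0 : 0 <= Lc.
Hypothesis HLc : forall t, t \in `[0, T] ->
  enorm (F (yb t) - F (interp s yb t)) <= Lc * enorm (yb t - interp s yb t).
Hypothesis HJy : forall t r v, t \in `[0, T] -> r \in `[0, T] ->
  enorm (v *m 'J F (y r) - v *m 'J F (y t)) <= Lc * enorm (y r - y t) * enorm v.
Hypothesis HJz : forall t v, t \in `[0, T] ->
  enorm (v *m 'J F (z t) - v *m 'J F (y t)) <= Lc * enorm (z t - y t) * enorm v.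
Hypothesis HT : forall t, t \in `[0, T] ->
  enorm (F (z t) - F (y t) - (z t - y t) *m 'J F (y t)) <= Lc * enorm (z t - y t) ^+ 2.
Hypotheses (Ym0 : 0 <= Ym) (HY : forall t, t \in `[0, T] -> enorm (Y t) <= Ym).
Hypotheses (I0 : 0 <= I) (HI : L2norm T (fun t => Y t - dinterp s yb t) <= I * mesh s).
Hypotheses (hz : H1 T z) (minz : minimizer (J T F f (y 0)) (P1space T s) z).

Definition residual_constant : R := (1 + Lc * T) * I.

Definition energy_constant : R :=
  residual_constant * (1 + L * Num.sqrt T) / (1 - L * (T / Num.sqrt 2)).

Definition sup_constant : R := residual_constant + Num.sqrt T * energy_constant.

(** The duality constant times the coefficients of h^2 in [kappa] and of h in [eta], as used in
    [duality_estimate]. *)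
Definition fe_constant : R := duality_constant (d := d) T q (Lc * Ym) *
  (residual_constant * Lc * sup_constant + Num.sqrt T * Lc * sup_constant ^+ 2 * (1 + q) +
   (energy_constant + q * Num.sqrt T * sup_constant)).

Let T0' : 0 <= T := ltW T0.

Lemma residual_constant_ge0 : 0 <= residual_constant.
Proof. by rewrite mulr_ge0// addr_ge0// mulr_ge0. Qed.

Lemma energy_constant_ge0 : 0 <= energy_constant.
Proof.
rewrite divr_ge0 ?subr_ge0 ?(ltW LT)//; apply: mulr_ge0; first exact: residual_constant_ge0.
by rewrite addr_ge0// mulr_ge0// sqrtr_ge0.
Qed.

Lemma sup_constant_ge0 : 0 <= sup_constant.
Proof.
rewrite addr_ge0 ?residual_constant_ge0// mulr_ge0 ?sqrtr_ge0//; exact: energy_constant_ge0.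
Qed.

Lemma kappa_constant_ge0 : 0 <= residual_constant * Lc * sup_constant +
  Num.sqrt T * Lc * sup_constant ^+ 2 * (1 + q).
Proof.
move: residual_constant_ge0 sup_constant_ge0 (sqrtr_ge0 T).
move: residual_constant sup_constant (Num.sqrt T) => a b c a0 b0 c0.
by rewrite addr_ge0 ?mulr_ge0 ?exprn_ge0 ?addr_ge0.
Qed.

Lemma fe_constant_ge0 : 0 <= fe_constant.
Proof.
have h1 := residual_constant_ge0; have h2 := energy_constant_ge0; have h3 := sup_constant_ge0.
have h4 : 0 <= Num.sqrt T by exact: sqrtr_ge0.
apply: mulr_ge0; first exact: duality_constant_ge0.
rewrite addr_ge0 ?kappa_constant_ge0// addr_ge0//; exact: mulr_ge0 (mulr_ge0 q0 h4) h3.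
Qed.

Let cF : continuous F := class_C_continuous CF.
Let zero_in : 0 \in `[0, T]. Proof. by rewrite in_itv/= lexx. Qed.

Lemma residual_mesh :
  L2norm T (fun t => wderiv T z t - F (z t) - f t) <= residual_constant * mesh s /\
  enorm (z 0 - y 0) <= residual_constant * mesh s.
Proof.
rewrite /residual_constant -mulrA -(ybE zero_in).
apply: (@residual_bound _ _ T T0 F f z yb Y s Lc) => //.
- by move=> t /in_oo_cc tT; rewrite YE// ybE.
- by move=> t /in_oo_cc tT; exact: HLc.
- by rewrite (ybE zero_in); apply: minz.2; exact: interp_P1.
Qed.

Lemma energy_mesh : L2norm T (wderiv T (z \- y)) <= energy_constant * mesh s.
Proof.
have [h1 h2] := residual_mesh.
have h3 := energy_error T0 cF hf hz hy aey L0 LT (fun t tT => HL (in_oo_cc tT)) h1 h2.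
rewrite (le_trans h3)// /energy_constant.
move: (residual_constant) (mesh s) (1 + _) (_^-1) => a b c e.
by rewrite -!mulrA (mulrA c) (mulrC (c * e)) !mulrA.
Qed.

Lemma sup_mesh t : t \in `[0, T] -> enorm (z t - y t) <= sup_constant * mesh s.
Proof.
move=> tT; have [he _] := H1_sub T0 hz hy; have [_ h2] := residual_mesh.
have := enorm_sup_le T0 he tT => /le_trans; apply.
by rewrite mulrDl lerD// -mulrA ler_wpM2l ?sqrtr_ge0//; exact: energy_mesh.
Qed.

Let M t : 'M[R]_d := 'J F (y (clamp T t)).

Let cJ i j : continuous (fun x => 'J F x i j).
Proof. by apply: jacobian_continuous; exact: class_CS. Qed.

Let ME t : t \in `[0, T] -> M t = 'J F (y t).
Proof. by move=> tT; rewrite /M clamp_id. Qed.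

Let cM i j : continuous (fun t => M t i j).
Proof. exact: (comp_clamp_coord T0 (@cJ i j) (H1_continuous hy)). Qed.

Let HLM a b v : 0 <= a -> a <= b -> b <= T ->
  enorm (v *m M b - v *m M a) <= Lc * Ym * (b - a) * enorm v.
Proof.
move=> a0 ab bT.
have aT : a \in `[0, T] by rewrite in_itv/= a0 (le_trans ab).
have bT' : b \in `[0, T] by rewrite in_itv/= bT (le_trans a0).
rewrite !ME//; apply: (le_trans (HJy v aT bT')).
rewrite ler_wpM2r ?enorm_ge0// -mulrA ler_wpM2l// -!ybE//.
apply: (le_trans (C1_enorm_le hyb ab)).
have cY : continuous (fun t => enorm (Y t)) by apply: continuous_enorm; exact: hyb.2.
rewrite -(rint_cst _ ab); apply: rint_le; [exact: cont_L1|exact: L1_cst|].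
move=> t; rewrite in_itv/= => /andP[at_ tb]; apply: HY.
by rewrite in_itv/= (le_trans a0 (ltW at_)) (le_trans (ltW tb) bT).
Qed.

(** Clamped because the dual problem needs a source that is continuous on the whole line. *)
Let e : R -> 'rV[R]_d := (z \- y) \o clamp T.

Let taylor t : 'rV[R]_d := F (z t) - F (y t) - e t *m M t.

Let taylor_in_L2 : in_L2 T taylor.
Proof.
have [he0 _] := H1_sub T0 hz hy; have [he _] := H1_clamp T0 he0.
apply: in_L2B; last by apply: in_L2_mulmx => //; exact: H1_in_L2.
by apply: in_L2B; apply: in_L2_comp => //; exact: H1_continuous.
Qed.

Let taylor_bound :
  L2norm T taylor <= Num.sqrt T * Lc * sup_constant ^+ 2 * mesh s ^+ 2.
Proof.
have h0 := mesh_ge0 s.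
rewrite -2!mulrA -exprMn; apply: L2norm_le_cst => //; first by rewrite mulr_ge0// sqr_ge0.
move=> t /in_oo_cc tT; rewrite /taylor ME// /e/= clamp_id//.
apply: (le_trans (HT tT)); rewrite ler_wpM2l// lerXn2r ?nnegrE ?enorm_ge0//.
  by rewrite mulr_ge0// sup_constant_ge0.
exact: sup_mesh.
Qed.

Lemma fe_error : L2norm T (z \- y) <= fe_constant * mesh s ^+ 2.
Proof.
have h0 := mesh_ge0 s; have A10 := residual_constant_ge0; have A30 := sup_constant_ge0.
have [he0 aee0] := H1_sub T0 hz hy; have [he aee] := H1_clamp T0 he0.
have aee' : {ae mu, forall t, t \in `]0, T[ -> wderiv T e t = wderiv T z t - wderiv T y t}.
  by apply: aeS2 aee aee0 => t h1 h2 tT; exact: etrans (h1 tT) (h2 tT).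
have [hE _] := H1_wderiv he; have he2 := H1_in_L2 he.
have heM : in_L2 T (fun t => e t *m M t) by exact: in_L2_mulmx.
have hR := residual_in_L2 T0 cF hf hz.
have [nR ne0] := residual_mesh.
have qM t v : enorm (v *m M t) <= q * enorm v by apply: qJ; exact: clamp_in.
have ce i : continuous (fun t => e t 0 i).
  by apply: within_clamp_coord => //; exact: H1_continuous.
(* First summand: residual times the change of DF between y and z. Second summand: the Taylor
   remainder, quadratic in the uniform error, paired with V - v M. *)
set kappa := (residual_constant * Lc * sup_constant + Num.sqrt T * Lc * sup_constant ^+ 2 * (1 + q))
  * mesh s ^+ 2.
set eta := (energy_constant + q * Num.sqrt T * sup_constant) * mesh s.
have kappa0 : 0 <= kappa.
  by rewrite mulr_ge0 ?sqr_ge0// kappa_constant_ge0.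
have eta_bound : L2norm T (fun t => wderiv T e t - e t *m M t) <= eta.
  rewrite (le_trans (L2normB hE heM))// /eta mulrDl lerD//.
    rewrite (ae_L2norm hE _ aee); [exact: energy_mesh|exact: (H1_wderiv he0).1].
  rewrite -[q * _ * _ * _]mulrA -[q * _ * _]mulrA mulrCA.
  apply: L2norm_le_cst => // [|t /in_oo_cc tT]; first by rewrite !mulr_ge0.
  by rewrite (le_trans (qM _ _))// ler_wpM2l// /e/= clamp_id//; exact: sup_mesh.
have EL (w : R -> 'rV[R]_d) :
    `|L2dot T (fun t => wderiv T e t - e t *m M t)
       (fun t => dinterp s w t - interp s w t *m M t) + dot (e 0) (interp s w 0)| <=
    kappa * (L2norm T (dinterp s w) + L2norm T (interp s w)).
  have [hv aev] := interp_H1 T0 w part.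
  have hV : in_L2 T (dinterp s w) by exact: dinterp_in_L2.
  have hv2 := H1_in_L2 hv.
  have hvM : in_L2 T (fun t => interp s w t *m M t) by exact: in_L2_mulmx.
  have hvJ : in_L2 T (fun t => interp s w t *m 'J F (z t)).
    by apply: (in_L2_mulmx_comp T0) => //; exact: H1_continuous.
  have Jmin (k : R) : J T F f (y 0) z <= J T F f (y 0) (fun t => z t + k *: interp s w t).
    by apply: minz.2; apply: P1space_lin; [exact: minz.1|exact: interp_P1].
  have E := euler_lagrange T0 CF hf hz hv hV aev Jmin.
  pose x t := interp s w t *m 'J F (z t) - interp s w t *m M t.
  have hx : in_L2 T x by exact: in_L2B.
  have nx : L2norm T x <= Lc * (sup_constant * mesh s) * L2norm T (interp s w).
    apply: L2norm_mono => //; first by rewrite !mulr_ge0.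
    move=> t /in_oo_cc tT; rewrite /x ME//; apply: (le_trans (HJz _ tT)).
    by rewrite ler_wpM2r ?enorm_ge0// ler_wpM2l//; exact: sup_mesh.
  have nvM : L2norm T (fun t => interp s w t *m M t) <= q * L2norm T (interp s w).
    exact: L2norm_mono.
  have Ex : (fun t => dinterp s w t - interp s w t *m 'J F (z t)) =
      (fun t => dinterp s w t - (interp s w t *m M t + x t)).
    by apply/funext => t; rewrite /x addrC [_ + (_ - _)]addrC subrK addrC.
  (* Since y' = F(y) + f, the linearized operator applied to e equals the residual of z plus the
     Taylor remainder. *)
  have -> : L2dot T (fun t => wderiv T e t - e t *m M t)
       (fun t => dinterp s w t - interp s w t *m M t) =
     L2dot T (fun t => (wderiv T z t - F (z t) - f t) + taylor t)
       (fun t => dinterp s w t - interp s w t *m M t).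
    apply: ae_L2dotl; [exact: in_L2B|exact: in_L2D|exact: in_L2B|].
    apply: aeS2 aee' aey => t h1 h2 tT; rewrite h1// h2// /taylor.
    move: (F _) (F _) (f t) (wderiv T z t) (_ *m _) => a1 a2 a3 a4 a5.
    by apply/rowP => i; rewrite !mxE; ring.
  have e0E : e 0 = z 0 - y 0 by rewrite /e/= clamp_id.
  have Ed : dot (e 0) (interp s w 0) = dot (z 0 - y 0) (interp s w 0) by congr dot.
  rewrite [dot (e 0) _]Ed.
  have {}E := etrans (congr1 (fun D => L2dot T (fun t => wderiv T z t - F (z t) - f t) D +
    dot (z 0 - y 0) (interp s w 0)) (esym Ex)) E.
  apply: (le_trans (perturbed_euler_lagrange hR taylor_in_L2 hV hvM hx E)).
  by apply: (consistency_arith A10 A30 h0 Lc0 q0 (sqrtr_ge0 T)) nR nx nvM taylor_bound;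
    exact: L2norm_ge0.
have -> : L2norm T (z \- y) = L2norm T e.
  apply: ae_L2norm => //; first exact: H1_in_L2.
  by apply: aeS aey => t _ /in_oo_cc tT; rewrite /e/= clamp_id.
apply: (le_trans (duality_estimate T0 part cM q0 qM qT (mulr_ge0 Lc0 Ym0) HLM he ce
  kappa0 eta_bound EL)).
rewrite /fe_constant -[leRHS]mulrA ler_wpM2l ?duality_constant_ge0//.
rewrite /kappa /eta [leRHS]mulrDl lerD2l -mulrA -expr2; exact: lexx.
Qed.

End FiniteElementError.

(** * The mesh, the Lipschitz hypothesis and the tube around the solution *)

Lemma mesh_le_length (R : realType) (T : R) (s : seq R) : 0 < T -> itv_partition 0 T s -> mesh s <= T.
Proof.
move=> T0 part; rewrite /mesh; apply: bigmax_le => [|k _]; first exact: ltW.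
have h1 := node_ge0 part (ltnW (ltn_ord k)); have h2 := node_leT part (ltn_ord k).
by rewrite lerBlDr (le_trans h2)// lerDl.
Qed.

(** Strictness excludes the value +oo and leaves room for a real admissible constant above the
    infimum, so it need not be shown that the infimum is attained. *)
Lemma Lip_lt (R : realType) (d : nat) (F : 'rV[R]_d -> 'rV[R]_d) B (k : R) : 0 < k ->
  (Lip F B * k%:E < 1)%E -> exists2 L, 0 <= L &
    L * k < 1 /\ forall x y, B x -> B y -> enorm (F x - F y) <= L * enorm (x - y).
Proof.
move=> k0; rewrite -lte_pdivlMr// mul1e => /ereal_inf_lt[_ [L [L0 HL] <-]].
rewrite lte_fin => Lk; exists L => //; split => //.
by rewrite -ltr_pdivlMr// div1r.
Qed.

Section Tube.
Context {R : realType} {d : nat}.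
Variables (T r : R) (y z : R -> 'rV[R]_d).
Hypotheses (T0 : 0 < T) (r0 : 0 < r) (hy : H1 T y) (hz : Xball T y r z).

Lemma Xball_enorm_le t : t \in `[0, T] -> enorm (z t - y t) <= `|Csup d T| * r.
Proof.
move=> tT; have [hz1 zr] := hz; have [he _] := H1_sub T0 hz1 hy.
apply: (le_trans (enorm_le_Csup T0 he tT)); apply: (le_trans (ler_norm _)).
by rewrite normrM ler_wpM2l// ger0_norm ?sqrtr_ge0// ltW.
Qed.

(** The tube is open of radius Csup r, so y(t) and z(t) lie in it only once Csup > 0. That holds as
    soon as z(t) differs from y(t), and otherwise the bound is trivial. *)
Lemma Xball_lipschitz (F : 'rV[R]_d -> 'rV[R]_d) L t : t \in `[0, T] ->
  (forall x x',
    (\bigcup_(t in `[0, T]) [set p | enorm (p - y t) < Csup d T * r]) x ->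
    (\bigcup_(t in `[0, T]) [set p | enorm (p - y t) < Csup d T * r]) x' ->
    enorm (F x - F x') <= L * enorm (x - x')) ->
  enorm (F (z t) - F (y t)) <= L * enorm (z t - y t).
Proof.
move=> tT H; have [hz1 zr] := hz; have [he _] := H1_sub T0 hz1 hy.
have [e0|e0] := leP (enorm (z t - y t)) 0.
  have E := enorm_eq0 e0.
  by rewrite E enorm0 mulr0 -[z t](subrK (y t)) E add0r subrr enorm0.
have le := enorm_le_Csup T0 he tT.
have C0 : 0 < Csup d T.
  rewrite ltNge; apply/negP => C0; have := lt_le_trans e0 le.
  by rewrite ltNge mulr_le0_ge0// sqrtr_ge0.
by apply: H; exists t => //=; [rewrite (le_lt_trans le)// ltr_pM2l|rewrite subrr enorm0 mulr_gt0].
Qed.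

End Tube.

Unset Implicit Arguments.

Theorem theorem3p1 (R : realType) (d : nat) (T : R) (g : 'rV[R]_d)
    (f : R -> 'rV[R]_d) (F : 'rV[R]_d -> 'rV[R]_d) (ystar : R -> 'rV[R]_d)
    (P : nat -> seq R) (r hbar : R) (yh : nat -> R -> 'rV[R]_d) :
  let CC := Csup d T in
  let Ct := CL2 d T in
  let B := \bigcup_(t in `[0, T]) [set p | enorm (p - ystar t) < CC * r] in
  let K := 2 * T ^+ 2 + T + Ct ^+ 2 in
  0 < T ->
  abs_continuous T f ->
  (exists f' : R -> 'rV[R]_d, in_L2 T f' /\
     {ae (@lebesgue_measure R), forall t, t \in `]0, T[ ->
        is_derive t 1 f (f' t)}) ->
  class_C 3 F ->
  ivp_solution T F f g ystar ->
  (forall z, ivp_solution T F f g z ->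
     forall t, t \in `[0, T] -> z t = ystar t) ->
  (forall n, itv_partition 0 T (P n)) ->
  (forall v : R -> 'rV[R]_d, H1 T v -> forall e : R, 0 < e -> exists2 del : R, 0 < del &
     forall n, mesh (P n) < del ->
       Xnorm T (v \- Xproj T (P1space T (P n)) v) < e) ->
  (ereal_sup [set (opnorm ('J F (ystar t)))%:E | t in `[0%R, T]] <
     (1 / Num.sqrt (K + Num.sqrt (K ^+ 2 +
                       2 * T * Ct ^+ 2 * (1 + 2 * T))))%:E)%E ->
  0 < r ->
  0 < hbar ->
  (forall n, mesh (P n) \in `]0, hbar[ ->
     minimizer (J T F f g) (P1space T (P n)) (yh n) /\
     Xball T ystar r (yh n) /\
     forall z, minimizer (J T F f g) (P1space T (P n)) z ->
       Xball T ystar r z -> forall t, t \in `[0, T] -> z t = yh n t) ->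
  (Lip F B * (T / Num.sqrt 2)%:E < 1)%E ->
  (ereal_sup [set (opnorm ('J F z))%:E | z in B] < (1 / Ct)%:E)%E ->
  exists2 C : R, 0 < C &
    forall n, mesh (P n) \in `]0, hbar[ ->
      L2norm T (yh n \- ystar) <= C * mesh (P n) ^+ 2.
Proof.
move=> CC Ct B K T0 acf [f' [hf' derf]] CF ivp _ part _ hop r0 hb0 hmin hLip _.
have [hy [y0 aey]] := ivp.
have CF2 : class_C 2 F by exact: class_CS.
have hf : in_L2 T f.
  apply: (@eq_in_L2 _ _ _ (fun t => f (clamp T t))).
    by move=> t /in_oo_cc tT; rewrite clamp_id.
  apply: in_L2_cont => i.
  apply: (@ac_on_clamp_continuous _ T T0 (fun t => f t 0 i)); exact: abs_continuous_coord.
have [yb [Y [m [[hyb ybE YE aeY] [hm m0 Ym_]]]]] := ivp_solution_regular T0 CF2 acf hf' derf ivp.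
(* The largest bound on |DF(y)| with T q <= 1/2, the contraction factor of the Picard iteration. *)
pose q := (2 * T)^-1.
have q0 : 0 <= q by rewrite invr_ge0 mulr_ge0// ltW.
have qT : T * q <= 2^-1 by rewrite /q invfM mulrCA divff ?mulr1// gt_eqF.
have qJ t (v : 'rV[R]_d) : t \in `[0, T] -> enorm (v *m 'J F (ystar t)) <= q * enorm v.
  move=> tT; apply: (le_trans (enorm_mulmx _ _)); rewrite ler_wpM2r ?enorm_ge0//.
  apply: le_trans (jacobian_threshold T0 Ct); rewrite ltW// -lte_fin; apply: le_lt_trans hop.
  by apply: ereal_sup_ubound; exists t.
have k0 : 0 < T / Num.sqrt 2 by rewrite divr_gt0// sqrtr_gt0.
have [L L0 [LT HL]] := Lip_lt k0 hLip.
have [M0 M00 HM0] := within_bounded T0 (H1_continuous hy).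
pose I := d%:R * Num.sqrt (rint 0 T (fun t => m t ^+ 2)).
have I0 : 0 <= I by rewrite mulr_ge0// sqrtr_ge0.
(* [M0] covers y, the second term covers every y^h in the ball, and the third every interpolant, as
   mesh <= T. The cube is fixed before the partition, so [Lc] does not depend on h. *)
pose rho := M0 + (`|CC| * r + Num.sqrt T * (I * T)).
have Cr0 : 0 <= `|CC| * r by rewrite mulr_ge0// ltW.
have sI0 : 0 <= Num.sqrt T * (I * T) by rewrite !mulr_ge0 ?sqrtr_ge0// ltW.
have [Lc Lc0 [HLc HJ HT]] := @box_C2_bounds R d F rho CF2.
have by_ t : t \in `[0, T] -> box rho (ystar t).
  by move=> tT; apply: enorm_box; rewrite (le_trans (HM0 t tT))// lerDl addr_ge0.
have cY : {within `[0, T], continuous Y}.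
  by apply: continuous_subspaceT; apply: continuous_rowP; exact: hyb.2.
have [Ym Ym0 HY] := within_bounded T0 cY.
have Q0 := fe_constant_ge0 (d := d) T0 Ym q0 L0 LT Lc0 I0.
(* Adding 1 makes the constant positive, [fe_constant] being only nonnegative. *)
exists (fe_constant (d := d) T q L Lc Ym I + 1); first by rewrite ltr_wpDl.
move=> n hn; have [minz [zball _]] := hmin n hn; have [hz zr] := zball.
have bz t : t \in `[0, T] -> box rho (yh n t).
  move=> tT; apply: enorm_box; rewrite -[yh n t](subrK (ystar t)) addrC.
  apply: (le_trans (enormD _ _)); apply: lerD; first exact: HM0.
  by rewrite (le_trans (Xball_enorm_le T0 hy zball tT))// lerDl.
have HI : L2norm T (fun t => Y t - dinterp (P n) yb t) <= I * mesh (P n).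
  by rewrite (le_trans (dinterp_error (part n) hyb hm Ym_ m0))// /I mulrAC.
have bI t : t \in `[0, T] -> box rho (interp (P n) yb t).
  move=> tT; apply: enorm_box; rewrite -[interp _ _ _](subrK (yb t)) addrC.
  apply: (le_trans (enormD _ _)); apply: lerD; first by rewrite ybE// HM0.
  rewrite enormBC (le_trans (interp_error T0 (part n) hyb tT HI))//.
  apply: (@le_trans _ _ (Num.sqrt T * (I * T))); last by rewrite lerDr.
  by rewrite ler_wpM2l ?sqrtr_ge0// ler_wpM2l// mesh_le_length.
have main : L2norm T (yh n \- ystar) <= fe_constant (d := d) T q L Lc Ym I * mesh (P n) ^+ 2.
  apply: (fe_error T0 CF2 hf hy aey hyb ybE YE (part n) q0 qT qJ L0 LT) HI hz _ => //.
  - by move=> t tT; exact: Xball_lipschitz T0 r0 hy zball _ _ _ tT HL.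
  - move=> t tT; rewrite enormBC [X in _ <= _ * X]enormBC; apply: HLc; last exact: bI.
    by rewrite ybE//; exact: by_.
  - by move=> t t' v tT tT'; apply: HJ; exact: by_.
  - by move=> t v tT; apply: HJ; [exact: by_|exact: bz].
  - by move=> t tT; apply: HT; [exact: by_|exact: bz].
  - by rewrite y0.
by rewrite (le_trans main)// ler_wpM2r ?sqr_ge0// lerDl.
Qed.
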